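(* Let $d\in\{1,2,3\}$. Assume: (A1) $E\in\widetilde{\mathbb{R}}$ is a generalized number with positive valuation $\nu_0(E)>0$; (A2) $f\in\mathcal{C}^\infty(\mathbb{R})$ and $f(0)=0$; (A3) $U_0,U_1\in\mathcal{G}^0(\mathbb{R}^d)$ are compactly supported, with supports contained in the ball $B_0=\{x\in\mathbb{R}^d:|x|\le r\}$ for some $r\ge 0$. For $T>0$ put $K_0=\{(t,x)\in[0,T]\times\mathbb{R}^d:|x|\le t+r\}$. Then for any $T>0$ the problem $$\partial_t^2U-\Delta U=E f(U)\ \text{ in }\ \mathcal{G}^0([0,T]\times\mathbb{R}^d),\qquad U|_{t=0}=U_0,\quad \partial_tU|_{t=0}=U_1\ \text{ in }\ \mathcal{G}^0(\mathbb{R}^d)$$ has a unique solution $U\in\mathcal{G}^0([0,T]\times\mathbb{R}^d)$ with support in $K_0$ (that is, there is exactly one element of $\mathcal{G}^0([0,T]\times\mathbb{R}^d)$ with support contained in $K_0$ that solves the problem).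
   Context: Let $X$ be either a nonempty open subset $\Omega$ of $\mathbb{R}^n$ or the closure $\overline{\Omega}$ of such a set (e.g. $[0,T]\times\mathbb{R}^d$, the closure of $(0,T)\times\mathbb{R}^d$). $\mathcal{C}^\infty(\Omega)$ is the space of real-valued smooth functions on $\Omega$; $\mathcal{C}^\infty(\overline{\Omega})$ is the subspace of those functions all of whose derivatives extend continuously to $\overline{\Omega}$. A net $(u_\varepsilon)_{\varepsilon\in(0,1]}$ in $\mathcal{C}^\infty(X)$ is moderate if for all compact $K\subset X$ and all multi-indices $\alpha$ there is $b\in\mathbb{R}$ with $\sup_{x\in K}|\partial^\alpha u_\varepsilon(x)|=O(\varepsilon^b)$ as $\varepsilon\to0$; it is negligible if for all compact $K\subset X$, all $\alpha$ and all $a\ge0$ one has $\sup_{x\in K}|\partial^\alpha u_\varepsilon(x)|=O(\varepsilon^a)$ as $\varepsilon\to 0$. The Colombeau algebra is $\mathcal{G}(X)=\mathcal{E}_M(X)/\mathcal{N}(X)$, the moderate nets modulo the negligible nets, with operations (sum, product, derivatives, restriction, e.g. to $t=0$) defined on representatives. $\mathcal{G}^0(X)$ is the subalgebra of those $U\in\mathcal{G}(X)$ all of whose derivatives are of bounded type on compact sets, i.e. having a representative with $\sup_{x\in K}|\partial^\alpha u_\varepsilon(x)|=O(1)$ as $\varepsilon\to0$ for every compact $K\subset X$ and every $\alpha$. For $f\in\mathcal{C}^\infty(\mathbb{R})$ and $U\in\mathcal{G}^0(X)$ with representative $(u_\varepsilon)$, $f(U)\in\mathcal{G}^0(X)$ is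 the class of $(f(u_\varepsilon))$, which is well defined. The support of $U\in\mathcal{G}(X)$ is the complement in $X$ of the largest (relatively) open subset $\omega$ of $X$ with $U|_\omega=0$. The ring $\widetilde{\mathbb{R}}$ of generalized numbers is the set of nets $(e_\varepsilon)_{\varepsilon\in(0,1]}$ of real numbers with $|e_\varepsilon|=O(\varepsilon^b)$ for some $b\in\mathbb{R}$, modulo nets that are $O(\varepsilon^a)$ for every $a\ge0$. For $E\in\widetilde{\mathbb{R}}$ with representative $(e_\varepsilon)$, $\nu_0(E)=\sup\{b\in\mathbb{R}:|e_\varepsilon|=O(\varepsilon^b)\text{ as }\varepsilon\to0\}$. $\Delta$ is the Laplacian in $x\in\mathbb{R}^d$. *)

(* Defs.v *)
From HB Require Import structures.
From mathcomp Require Import all_boot all_order all_algebra ring_quotient.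
From mathcomp Require Import all_classical all_reals.
From mathcomp Require Import ereal topology normedtype derive realfun exp.
Import numFieldNormedType.Exports.
Set Implicit Arguments.
Unset Strict Implicit.
Unset Printing Implicit Defensive.
Import Order.TTheory GRing.Theory Num.Theory.
Local Open Scope classical_set_scope.
Local Open Scope ring_scope.

(* The sets X = Omega (with_closure = false) or X = closure Omega
   (with_closure = true) that carry the algebras; Omega is [inner X]. *)
Record region (R : realType) (n : nat) := Region {
  inner : set 'rV[R]_n;
  inner_open : open inner;
  with_closure : bool }.
Arguments inner_open {R n} r.

Section Smooth.
Context {R : realType} {n : nat}.
Implicit Types (X : region R n) (u v : 'rV[R]_n -> R) (s : seq 'I_n).

Definition carrier X : set 'rV[R]_n :=
  if with_closure X then closure (inner X) else inner X.

Definition partial (i : 'I_n) u : 'rV[R]_n -> R :=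
  fun x => 'D_(delta_mx 0 i) u x.

(* Derivatives are indexed by words i_1 ... i_k of coordinates instead of
   multi-indices, so that all mixed partial derivatives, in every order, are
   covered; on smooth functions the order is irrelevant and the words give
   exactly the derivatives of multi-index alpha, alpha_i being the number of
   occurrences of i. *)
Fixpoint pderiv s u : 'rV[R]_n -> R :=
  if s is i :: s' then pderiv s' (partial i u) else u.

(* A function on X is handled through its values on Omega: its value and those
   of its derivatives on X are the continuous extensions of the values on
   Omega. *)
Definition extendable X u := exists g : 'rV[R]_n -> R,
  {within carrier X, continuous g} /\ forall x, inner X x -> g x = u x.

Definition extension X u : 'rV[R]_n -> R :=
  fun x => lim (u @ within (inner X) (nbhs x)).

Definition regular X u :=
  (forall i x, inner X x -> derivable u x (delta_mx 0 i)) /\ extendable X u.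

(* u belongs to C^oo(X). When X = Omega, [extendable X w] is the continuity
   of w on Omega. *)
Definition smooth X u := forall s, regular X (pderiv s u).

Definition pderivX X s u : 'rV[R]_n -> R := extension X (pderiv s u).

Definition smooth_upto X k u :=
  forall s, (size s <= k)%N -> regular X (pderiv s u).

Lemma inner_carrier X : inner X `<=` carrier X.
Proof. by rewrite /carrier; case: ifP => _ x // ?; exact: subset_closure. Qed.

Lemma carrier_closure X : carrier X `<=` closure (inner X).
Proof. by rewrite /carrier; case: ifP => _ x // ?; exact: subset_closure. Qed.

Lemma near_inner X u v x : (forall y, inner X y -> u y = v y) -> inner X x ->
  \forall y \near x, u y = v y.
Proof.
move=> uv Xx; have := open_nbhs_nbhs (conj (inner_open X) Xx).
by apply: filterS => y; exact: uv.
Qed.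

Lemma extension_congr X u v : (forall y, inner X y -> u y = v y) ->
  extension X u = extension X v.
Proof.
move=> uv; apply/funext => x; rewrite /extension; congr (lim _).
have uv' : {in inner X, u =1 v} by move=> y; rewrite inE => /uv.
have vu : {in inner X, v =1 u} by move=> y /uv'.
rewrite eqEsubset; split.
  exact: (@fmap_within_eq _ (inner X) _ (nbhs x) _ _ _ vu).
exact: (@fmap_within_eq _ (inner X) _ (nbhs x) _ _ _ uv').
Qed.

Lemma extension_cvgP X u x : extendable X u -> carrier X x ->
  u @ within (inner X) (nbhs x) --> extension X u x.
Proof.
move=> [g [/subspace_continuousP cg gu]] Xx.
have ? := within_nbhs_proper (carrier_closure Xx).
have ul : u @ within (inner X) (nbhs x) --> g x.
  apply: (@cvg_trans _ (g @ within (inner X) (nbhs x))).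
    apply: (@fmap_within_eq _ (inner X) _ (nbhs x)) => y.
    by rewrite inE => /gu.
  apply: cvg_trans (cg x Xx) => A; rewrite /= !nbhs_simpl.
  by apply: within_subset; exact: inner_carrier.
by rewrite /extension (cvg_lim _ ul).
Qed.

Lemma extension_uniq X u g x : {within carrier X, continuous g} ->
  (forall y, inner X y -> g y = u y) -> carrier X x -> extension X u x = g x.
Proof.
move=> cg gu Xx; have ? := within_nbhs_proper (carrier_closure Xx).
rewrite -(extension_congr gu); apply: cvg_lim => //.
move/subspace_continuousP : cg => /(_ x Xx); apply: cvg_trans => A.
by rewrite /= !nbhs_simpl; apply: within_subset; exact: inner_carrier.
Qed.

Lemma extension_inner X u x : extendable X u -> inner X x ->
  extension X u x = u x.
Proof.
move=> [g [cg gu]] Xx; rewrite (extension_uniq cg gu) ?gu//.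
exact: inner_carrier.
Qed.

Lemma extension_continuous X u : extendable X u ->
  {within carrier X, continuous (extension X u)}.
Proof.
move=> [g [cg gu]]; apply: (subspace_eq_continuous _ cg) => x.
by rewrite inE => Xx; apply/esym; exact: (extension_uniq cg gu).
Qed.

Lemma extension_lim X u x l : carrier X x ->
  u @ within (inner X) (nbhs x) --> l -> extension X u x = l.
Proof.
move=> Xx ul; have ? := within_nbhs_proper (carrier_closure Xx).
exact: cvg_lim.
Qed.

Lemma extendable_congr X u v : (forall y, inner X y -> u y = v y) ->
  extendable X u -> extendable X v.
Proof.
by move=> uv [g [cg gu]]; exists g; split=> // x Xx; rewrite gu// uv.
Qed.

Lemma regular_congr X u v : (forall y, inner X y -> u y = v y) ->
  regular X u -> regular X v.
Proof.
move=> uv [du eu]; split; last exact: extendable_congr eu.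
by move=> i x Xx; apply: near_eq_derivable (du i x Xx); exact: near_inner uv _.
Qed.

Lemma partial_congr X i u v : (forall y, inner X y -> u y = v y) ->
  forall y, inner X y -> partial i u y = partial i v y.
Proof.
by move=> uv y Xy; apply: near_eq_derive; exact: near_inner uv Xy.
Qed.

Lemma pderiv_congr X s u v : (forall y, inner X y -> u y = v y) ->
  forall y, inner X y -> pderiv s u y = pderiv s v y.
Proof.
by elim: s u v => //= i s ih u v uv; apply: ih; exact: partial_congr.
Qed.

Lemma pderivX_congr X s u v : (forall y, inner X y -> u y = v y) ->
  pderivX X s u = pderivX X s v.
Proof. by move=> uv; apply: extension_congr; exact: pderiv_congr. Qed.

Lemma smooth_upto_congr X k u v : (forall y, inner X y -> u y = v y) ->
  smooth_upto X k u -> smooth_upto X k v.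
Proof.
by move=> uv su s sk; apply: regular_congr (su s sk); exact: pderiv_congr.
Qed.

Lemma smooth_uptoP X u : smooth X u <-> forall k, smooth_upto X k u.
Proof. by split=> [su k s _|su s]; [exact: su|exact: (su (size s))]. Qed.

Lemma smooth_upto_le X k l u : (k <= l)%N ->
  smooth_upto X l u -> smooth_upto X k u.
Proof. by move=> kl su s sk; apply: su; exact: leq_trans kl. Qed.

Lemma smooth_uptoS X k u : smooth_upto X k.+1 u <->
  regular X u /\ forall i, smooth_upto X k (partial i u).
Proof.
split=> [su|[ru su] [|i s]//= sk]; last exact: su.
by split=> [|i s sk]; [exact: (su [::])|exact: (su (i :: s))].
Qed.

Lemma smooth_partial X i u : smooth X u -> smooth X (partial i u).
Proof. by move=> su s; exact: (su (i :: s)). Qed.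

Lemma smooth_regular X u : smooth X u -> regular X u.
Proof. by move=> su; exact: (su [::]). Qed.

Lemma regularD X u v : regular X u -> regular X v ->
  regular X (fun x => u x + v x).
Proof.
move=> [du [g [cg gu]]] [dv [h [ch hv]]]; split.
  by move=> i x Xx; apply: derivableD; [exact: du|exact: dv].
exists (fun x => g x + h x); split; last by move=> x Xx; rewrite gu ?hv.
apply/subspace_continuousP => x Xx; apply: cvgD.
  by move/subspace_continuousP : cg; exact.
by move/subspace_continuousP : ch; exact.
Qed.

Lemma regularM X u v : regular X u -> regular X v ->
  regular X (fun x => u x * v x).
Proof.
move=> [du [g [cg gu]]] [dv [h [ch hv]]]; split.
  by move=> i x Xx; apply: derivableM; [exact: du|exact: dv].
exists (fun x => g x * h x); split; last by move=> x Xx; rewrite gu ?hv.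
apply/subspace_continuousP => x Xx; apply: cvgM.
  by move/subspace_continuousP : cg; exact.
by move/subspace_continuousP : ch; exact.
Qed.

Lemma regular_cst X (c : R) : regular X (fun=> c).
Proof.
split=> [i x _|]; first exact: derivable_cst.
exists (fun=> c); split=> //; apply/subspace_continuousP => x _.
exact: cvg_cst.
Qed.

Lemma extensionD X u v x : regular X u -> regular X v -> carrier X x ->
  extension X (fun x => u x + v x) x = extension X u x + extension X v x.
Proof.
move=> [_ eu] [_ ev] Xx; have ? := within_nbhs_proper (carrier_closure Xx).
by apply: extension_lim => //; apply: cvgD; exact: extension_cvgP.
Qed.

Lemma extensionM X u v x : regular X u -> regular X v -> carrier X x ->
  extension X (fun x => u x * v x) x = extension X u x * extension X v x.
Proof.
move=> [_ eu] [_ ev] Xx; have ? := within_nbhs_proper (carrier_closure Xx).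
by apply: extension_lim => //; apply: cvgM; exact: extension_cvgP.
Qed.

Lemma extension_cst X (c : R) x : carrier X x -> extension X (fun=> c) x = c.
Proof.
move=> Xx; have ? := within_nbhs_proper (carrier_closure Xx).
by apply: extension_lim => //; exact: cvg_cst.
Qed.

Lemma partialD X i u v x : regular X u -> regular X v -> inner X x ->
  partial i (fun x => u x + v x) x = partial i u x + partial i v x.
Proof. by move=> [du _] [dv _] Xx; apply: deriveD; [exact: du|exact: dv]. Qed.

Lemma partialM X i u v x : regular X u -> regular X v -> inner X x ->
  partial i (fun x => u x * v x) x = partial i u x * v x + u x * partial i v x.
Proof.
move=> [du _] [dv _] Xx; rewrite addrC.
have := deriveM (du i x Xx) (dv i x Xx).
rewrite /partial => ->; congr (_ + _).
by rewrite mulrC.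
Qed.

Lemma partial_cst i (c : R) : partial i (fun=> c) = fun=> 0.
Proof. by apply/funext => x; exact: derive_cst. Qed.

Lemma smooth_uptoD X k u v : smooth_upto X k u -> smooth_upto X k v ->
  smooth_upto X k (fun x => u x + v x).
Proof.
elim: k u v => [|k ih] u v.
  by move=> su sv [|//] _; apply: regularD; [exact: (su [::])|exact: (sv [::])].
move=> /smooth_uptoS[ru su] /smooth_uptoS[rv sv]; apply/smooth_uptoS; split.
  exact: regularD.
move=> i; apply: (@smooth_upto_congr _ _ (fun x => partial i u x + partial i v x)).
  by move=> x Xx; rewrite (partialD _ ru rv).
exact: ih.
Qed.

Lemma smooth_uptoM X k u v : smooth_upto X k u -> smooth_upto X k v ->
  smooth_upto X k (fun x => u x * v x).
Proof.
elim: k u v => [|k ih] u v.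
  by move=> su sv [|//] _; apply: regularM; [exact: (su [::])|exact: (sv [::])].
move=> su1 sv1; have su0 := smooth_upto_le (leqnSn k) su1.
have sv0 := smooth_upto_le (leqnSn k) sv1.
move/smooth_uptoS : su1 => [ru su]; move/smooth_uptoS : sv1 => [rv sv].
apply/smooth_uptoS; split; first exact: regularM.
move=> i; apply: (@smooth_upto_congr _ _
    (fun x => partial i u x * v x + u x * partial i v x)).
  by move=> x Xx; rewrite (partialM _ ru rv).
by apply: smooth_uptoD; exact: ih.
Qed.

Lemma smoothD X u v : smooth X u -> smooth X v -> smooth X (fun x => u x + v x).
Proof.
by move=> /smooth_uptoP su /smooth_uptoP sv; apply/smooth_uptoP => k;
  exact: smooth_uptoD.
Qed.

Lemma smoothM X u v : smooth X u -> smooth X v -> smooth X (fun x => u x * v x).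
Proof.
by move=> /smooth_uptoP su /smooth_uptoP sv; apply/smooth_uptoP => k;
  exact: smooth_uptoM.
Qed.

Lemma smooth_cst X (c : R) : smooth X (fun=> c).
Proof.
apply/smooth_uptoP => k; elim: k c => [|k ih] c.
  by case=> // _; exact: regular_cst.
by apply/smooth_uptoS; split=> [|i]; [exact: regular_cst|rewrite partial_cst].
Qed.

Lemma smoothZ X (c : R) u : smooth X u -> smooth X (fun x => c * u x).
Proof. by move=> su; apply: smoothM => //; exact: smooth_cst. Qed.

Lemma smoothB X u v : smooth X u -> smooth X v -> smooth X (fun x => u x - v x).
Proof.
move=> su sv; have -> : (fun x => u x - v x) = (fun x => u x + (-1) * v x).
  by apply/funext => x; rewrite mulN1r.
by apply: smoothD => //; exact: smoothZ.
Qed.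

Lemma partialZ X i c u x : regular X u -> inner X x ->
  partial i (fun x => c * u x) x = c * partial i u x.
Proof.
move=> ru Xx.
by rewrite (@partialM X)//; [rewrite partial_cst mul0r add0r|exact: regular_cst].
Qed.

Lemma pderivD X s u v x : smooth X u -> smooth X v -> inner X x ->
  pderiv s (fun x => u x + v x) x = pderiv s u x + pderiv s v x.
Proof.
elim: s u v => //= i s ih u v su sv Xx.
rewrite -ih//; [|exact: smooth_partial..].
apply: (@pderiv_congr X) => // y Xy.
by rewrite (@partialD X)//; exact: smooth_regular.
Qed.

Lemma pderivZ X s c u x : smooth X u -> inner X x ->
  pderiv s (fun x => c * u x) x = c * pderiv s u x.
Proof.
elim: s u => //= i s ih u su Xx.
rewrite -ih//; [|exact: smooth_partial..].
apply: (@pderiv_congr X) => // y Xy.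
by rewrite (@partialZ X)//; exact: smooth_regular.
Qed.

Lemma pderivXD X s u v x : smooth X u -> smooth X v -> carrier X x ->
  pderivX X s (fun x => u x + v x) x = pderivX X s u x + pderivX X s v x.
Proof.
move=> su sv Xx; rewrite /pderivX -extensionD//.
by apply: (fun h => congr1 (@^~ x) (extension_congr h)) => y; exact: pderivD.
Qed.

Lemma pderivXZ X s c u x : smooth X u -> carrier X x ->
  pderivX X s (fun x => c * u x) x = c * pderivX X s u x.
Proof.
move=> su Xx; rewrite /pderivX -[c in RHS](extension_cst _ Xx) -extensionM//.
  by apply: (fun h => congr1 (@^~ x) (extension_congr h)) => y; exact: pderivZ.
exact: regular_cst.
Qed.

Lemma pderivXB X s u v x : smooth X u -> smooth X v -> carrier X x ->
  pderivX X s (fun x => u x - v x) x = pderivX X s u x - pderivX X s v x.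
Proof.
move=> su sv Xx; have -> : (fun x => u x - v x) = (fun x => u x + (-1) * v x).
  by apply/funext => y; rewrite mulN1r.
by rewrite pderivXD ?pderivXZ ?mulN1r//; exact: smoothZ.
Qed.

End Smooth.

Record smooth_fun (R : realType) := SmoothFun {
  sfun :> R -> R;
  sfunP : forall k x, derivable (derive1n k sfun) x 1 }.
Arguments sfunP {R} s k x.

Section SmoothComp.
Context {R : realType}.
Implicit Types f : smooth_fun R.

Lemma sderiv_subproof f k x : derivable (derive1n k (derive1 f)) x 1.
Proof. by rewrite -derive1Sn; exact: sfunP. Qed.

Arguments sderiv_subproof : clear implicits.

Definition sderiv f := SmoothFun (sderiv_subproof f).

Lemma sfun_derivable f (x : R) : derivable f x 1.
Proof. exact: (sfunP f 0). Qed.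

Lemma sfun_continuous f : continuous f.
Proof.
move=> x; apply: differentiable_continuous; apply/derivable1_diffP.
exact: sfun_derivable.
Qed.

Lemma sfun_is_derive f (x : R) : is_derive x 1 f (sderiv f x).
Proof.
by apply: DeriveDef; [exact: sfun_derivable|rewrite /= derive1E].
Qed.

Context {n : nat}.
Implicit Types (X : region R n) (u v : 'rV[R]_n -> R) (s : seq 'I_n).

Lemma is_derive_sfun_comp f u x d : derivable u x d ->
  is_derive x d (f \o u) (sderiv f (u x) * 'D_d u x).
Proof.
move=> du; set g := fun h : R => u (h *: d + x).
have g0 : g 0 = u x by rewrite /g scale0r add0r.
have line (w : 'rV[R]_n -> R) :
    'D_d w x = 'D_1 (fun h : R => w (h *: d + x)) 0.
  rewrite /derive; set g1 := fun h => h^-1 *: _; set g2 := fun h => h^-1 *: _.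
  suff -> : g1 = g2 by [].
  by rewrite funeqE /g1 /g2 => h /=; rewrite addr0 scale0r add0r [_%:A]mulr1.
have dg : is_derive (0 : R) 1 g ('D_d u x).
  have dg0 := iffLR (derivable1P u x d) du.
  by apply: DeriveDef => //; rewrite line.
have df : is_derive (g 0) 1 f (sderiv f (u x)).
  by rewrite g0; exact: sfun_is_derive.
have [dfg efg] := is_derive1_comp df dg.
by apply: DeriveDef; [exact: (iffRL (derivable1P (f \o u) x d) dfg)|rewrite line].
Qed.

Lemma regular_comp X f u : regular X u -> regular X (f \o u).
Proof.
move=> [du [g [cg gu]]]; split.
  by move=> i x Xx; have [] := is_derive_sfun_comp f (du i x Xx).
exists (f \o g); split; last by move=> x Xx /=; rewrite gu.
apply/subspace_continuousP => x Xx.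
apply: (@cvg_comp _ _ _ g f _ (nbhs (g x))).
  by move/subspace_continuousP : cg; exact.
exact: sfun_continuous.
Qed.

Lemma partial_comp X f u i x : regular X u -> inner X x ->
  partial i (f \o u) x = sderiv f (u x) * partial i u x.
Proof.
by move=> [du _] Xx; have [] := is_derive_sfun_comp f (du i x Xx).
Qed.

Lemma extension_comp X f u x : regular X u -> carrier X x ->
  extension X (f \o u) x = f (extension X u x).
Proof.
move=> [_ eu] Xx; apply: extension_lim => //.
apply: (@cvg_comp _ _ _ u f _ (nbhs (extension X u x))).
  exact: extension_cvgP.
exact: sfun_continuous.
Qed.

Lemma smooth_upto_comp X k f u : smooth_upto X k u -> smooth_upto X k (f \o u).
Proof.
elim: k f u => [|k ih] f u.
  by move=> su [|//] _; apply: regular_comp; exact: (su [::]).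
move=> su1; have su0 := smooth_upto_le (leqnSn k) su1.
move/smooth_uptoS : su1 => [ru su].
apply/smooth_uptoS; split; first exact: regular_comp.
move=> i; apply: (@smooth_upto_congr _ _ _ _
    (fun x => (sderiv f \o u) x * partial i u x)).
  by move=> x Xx; rewrite (partial_comp f i ru).
by apply: smooth_uptoM; [exact: ih|exact: su].
Qed.

Lemma smooth_comp X f u : smooth X u -> smooth X (f \o u).
Proof.
by move=> /smooth_uptoP su; apply/smooth_uptoP => k; exact: smooth_upto_comp.
Qed.

End SmoothComp.

Section BigO.
Context {R : realType} {T : Type}.
Implicit Types (K : set T) (w z : R -> T -> R) (a b : R).

(* sup_(x in K) |w_e(x)| = O(e^b) as e -> 0 *)
Definition bigO_on K b w := exists C : R,
  \forall e \near 0^'+, forall x, K x -> `|w e x| <= C * e `^ b.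

Lemma near0_itv : \forall e \near (0 : R)^'+, 0 < e <= 1.
Proof.
near=> e; apply/andP; split; near: e; first exact: nbhs_right_gt.
exact: nbhs_right_le.
Unshelve. all: by end_near. Qed.

Lemma bigO_on_congr K b w z :
  (forall e x, 0 < e <= 1 -> K x -> w e x = z e x) ->
  bigO_on K b w -> bigO_on K b z.
Proof.
move=> wz [C HC]; exists C; near=> e => x Kx.
rewrite -wz//; last by near: e; exact: near0_itv.
by move: x Kx; near: e.
Unshelve. all: by end_near. Qed.

Lemma bigO_on_sub K K' b w : K' `<=` K -> bigO_on K b w -> bigO_on K' b w.
Proof.
by move=> KK' [C HC]; exists C; apply: filterS HC => e He x /KK' /He.
Qed.

Lemma bigO_on_pos K b w : bigO_on K b w -> exists2 C : R, 0 <= C &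
  \forall e \near 0^'+, forall x, K x -> `|w e x| <= C * e `^ b.
Proof.
move=> [C HC]; exists `|C|; first exact: normr_ge0.
apply: filterS HC => e He x Kx; apply: le_trans (He x Kx) _.
by apply: ler_wpM2r; [exact: powR_ge0|exact: ler_norm].
Qed.

Lemma bigO_on_le K a b w : a <= b -> bigO_on K b w -> bigO_on K a w.
Proof.
move=> ab /bigO_on_pos[C C0 HC]; exists C; near=> e => x Kx.
have /andP[e0 e1] : 0 < e <= 1 by near: e; exact: near0_itv.
apply: (@le_trans _ _ (C * e `^ b)); first by move: x Kx; near: e.
by apply: ler_wpM2l => //; apply: ger_powR; rewrite ?e0.
Unshelve. all: by end_near. Qed.

Lemma bigO_on_lt1 K b w : 0 <= b -> (forall a, 0 <= a -> bigO_on K a w) ->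
  \forall e \near 0^'+, forall x, K x -> `|w e x| <= e `^ b.
Proof.
move=> b0 /(_ (b + 1)) [|C HC]; first by rewrite addr_ge0.
have C1 : 0 < `|C| + 1 by rewrite ltr_wpDl.
near=> e => x Kx.
have e0 : 0 < e by near: e; exact: nbhs_right_gt.
apply: (@le_trans _ _ (C * e `^ (b + 1))); first by move: x Kx; near: e.
rewrite powRD; last by apply/implyP => _; rewrite gt_eqF.
rewrite powRr1; last exact: ltW.
suff Ce : C * e <= 1 by rewrite mulrCA -[leRHS]mulr1 ler_wpM2l// powR_ge0.
apply: (@le_trans _ _ ((`|C| + 1) * e)).
  by rewrite ler_wpM2r// ?ltW// ltr_pwDr// ler_norm.
rewrite mulrC -ler_pdivlMr// mul1r.
by near: e; apply: nbhs_right_le; rewrite invr_gt0.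
Unshelve. all: by end_near. Qed.

Lemma bigO_onD K b w z : bigO_on K b w -> bigO_on K b z ->
  bigO_on K b (fun e x => w e x + z e x).
Proof.
move=> [C HC] [D HD]; exists (C + D); near=> e => x Kx.
apply: le_trans (ler_normD _ _) _; rewrite mulrDl lerD//.
  by move: x Kx; near: e.
by move: x Kx; near: e.
Unshelve. all: by end_near. Qed.

Lemma bigO_onM K a b w z : bigO_on K a w -> bigO_on K b z ->
  bigO_on K (a + b) (fun e x => w e x * z e x).
Proof.
move=> [C HC] [D HD]; exists (C * D); near=> e => x Kx.
have e0 : 0 < e by near: e; exact: nbhs_right_gt.
rewrite normrM powRD; last by apply/implyP => _; rewrite gt_eqF.
rewrite mulrACA ler_pM//.
  by move: x Kx; near: e.
by move: x Kx; near: e.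
Unshelve. all: by end_near. Qed.

Lemma bigO_on0 K b : bigO_on K b (fun _ _ => 0).
Proof.
by exists 0; near=> e => x _; rewrite normr0 mul0r.
Unshelve. all: by end_near. Qed.

End BigO.

Section Estimates.
Context {R : realType} {n : nat}.
Implicit Types (X : region R n) (K A : set 'rV[R]_n) (s : seq 'I_n) (a b : R).
Implicit Types (u v : R -> 'rV[R]_n -> R) (f : smooth_fun R).

(* Nets are functions of e : R of which only the values at e in (0, 1] are
   constrained; the values at other e disappear in the quotient, since the
   growth conditions only concern e -> 0+. *)
Definition smooth_net X u := forall e, 0 < e <= 1 -> smooth X (u e).

Definition moderate X u := forall K s, compact K -> K `<=` carrier X ->
  exists b, bigO_on K b (fun e => pderivX X s (u e)).

Definition negligible_on X A u := forall K s a, compact K -> K `<=` A -> 0 <= a ->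
  bigO_on K a (fun e => pderivX X s (u e)).

Definition bounded_type X u := forall K s, compact K -> K `<=` carrier X ->
  bigO_on K 0 (fun e => pderivX X s (u e)).

Definition est X K a k u :=
  forall s, (size s <= k)%N -> bigO_on K a (fun e => pderivX X s (u e)).

Lemma estP X K a u : (forall s, bigO_on K a (fun e => pderivX X s (u e))) <->
  (forall k, est X K a k u).
Proof. by split=> [h k s _|h s]; [exact: h|exact: (h (size s))]. Qed.

Lemma estS X K a k u : est X K a k.+1 u <->
  est X K a 0 u /\ forall i, est X K a k (fun e => partial i (u e)).
Proof.
split=> [h|[h0 hi] [|i s] sk]; [|exact: h0|exact: hi].
by split=> [[|//] _|i s sk]; [exact: (h [::])|exact: (h (i :: s))].
Qed.

Lemma est_le X K a k l u : (k <= l)%N -> est X K a l u -> est X K a k u.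
Proof. by move=> kl h s sk; apply: h; exact: leq_trans kl. Qed.

Lemma est_congr X K a k u v :
  (forall e, 0 < e <= 1 -> forall x, inner X x -> u e x = v e x) ->
  est X K a k u -> est X K a k v.
Proof.
move=> uv h s /h; apply: bigO_on_congr => e x e01 _.
by rewrite (pderivX_congr s (uv e e01)).
Qed.

Lemma smooth_net_partial X i u : smooth_net X u ->
  smooth_net X (fun e => partial i (u e)).
Proof. by move=> su e e01; apply: smooth_partial; exact: su. Qed.

Lemma estD X K a k u v : K `<=` carrier X -> smooth_net X u -> smooth_net X v ->
  est X K a k u -> est X K a k v -> est X K a k (fun e x => u e x + v e x).
Proof.
move=> KX su sv hu hv s sk.
apply: (bigO_on_congr _ (bigO_onD (hu s sk) (hv s sk))) => e x e01 Kx.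
by rewrite pderivXD//; [exact: su|exact: sv|exact: KX].
Qed.

Lemma est0M X K a b u v : K `<=` carrier X -> smooth_net X u -> smooth_net X v ->
  est X K a 0 u -> est X K b 0 v -> est X K (a + b) 0 (fun e x => u e x * v e x).
Proof.
move=> KX su sv hu hv [|//] _.
apply: (bigO_on_congr _ (bigO_onM (hu [::] isT) (hv [::] isT))) => e x e01 Kx.
by rewrite /pderivX/= extensionM//; [exact/smooth_regular/su|
  exact/smooth_regular/sv|exact: KX].
Qed.

Lemma smooth_netM X u v : smooth_net X u -> smooth_net X v ->
  smooth_net X (fun e x => u e x * v e x).
Proof. by move=> su sv e e01; apply: smoothM; [exact: su|exact: sv]. Qed.

Lemma smooth_netD X u v : smooth_net X u -> smooth_net X v ->
  smooth_net X (fun e x => u e x + v e x).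
Proof. by move=> su sv e e01; apply: smoothD; [exact: su|exact: sv]. Qed.

Lemma smooth_netB X u v : smooth_net X u -> smooth_net X v ->
  smooth_net X (fun e x => u e x - v e x).
Proof. by move=> su sv e e01; apply: smoothB; [exact: su|exact: sv]. Qed.

Lemma smooth_net_comp X f u : smooth_net X u ->
  smooth_net X (fun e => f \o u e).
Proof. by move=> su e e01; apply: smooth_comp; exact: su. Qed.

Lemma estM X K a b k u v : K `<=` carrier X -> smooth_net X u -> smooth_net X v ->
  est X K a k u -> est X K b k v -> est X K (a + b) k (fun e x => u e x * v e x).
Proof.
move=> KX; elim: k u v => [|k ih] u v su sv; first exact: est0M.
move=> hu1 hv1; have hu0 := est_le (leqnSn k) hu1.
have hv0 := est_le (leqnSn k) hv1.
move/estS : hu1 => [hu hui]; move/estS : hv1 => [hv hvi].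
apply/estS; split; first exact: est0M.
move=> i; apply: (@est_congr _ _ _ _
    (fun e x => partial i (u e) x * v e x + u e x * partial i (v e) x)).
  move=> e e01 x Xx.
  by rewrite (@partialM _ _ X)//; [exact/smooth_regular/su|exact/smooth_regular/sv].
have sui := smooth_net_partial i su; have svi := smooth_net_partial i sv.
by apply: estD => //; [exact: smooth_netM..|exact: ih|exact: ih].
Qed.

Lemma sfun_bound f (C : R) : exists M : R, forall y, `|y| <= C -> `|f y| <= M.
Proof.
have [C0|C0] := ltP C 0.
  by exists 0 => y yC; have := le_lt_trans yC C0; rewrite normr_lt0.
have cf : {within `[- C, C], continuous (fun y => `|f y|)}.
  apply: continuous_subspaceT => y; apply: cvg_norm; exact: sfun_continuous.
have [|c _ cM] := EVT_max _ cf; first by rewrite ge0_cp.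
by exists `|f c| => y yC; apply: cM; rewrite in_itv/= -ler_norml.
Qed.

Lemma est0_comp X K f u : K `<=` carrier X -> smooth_net X u ->
  est X K 0 0 u -> est X K 0 0 (fun e => f \o u e).
Proof.
move=> KX su hu [|//] _; have [C HC] := hu [::] isT.
have [M HM] := sfun_bound f C; exists M; near=> e => x Kx.
have e01 : 0 < e <= 1 by near: e; exact: near0_itv.
rewrite /pderivX/= powRr0 mulr1 extension_comp; [|exact/smooth_regular/su|exact: KX].
apply: HM; rewrite -[C]mulr1 -(powRr0 e).
by move: x Kx; near: e.
Unshelve. all: by end_near. Qed.

Lemma est_comp X K f k u : K `<=` carrier X -> smooth_net X u ->
  est X K 0 k u -> est X K 0 k (fun e => f \o u e).
Proof.
move=> KX; elim: k f u => [|k ih] f u su hu1; first exact: est0_comp.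
have hu0 := est_le (leqnSn k) hu1; move/estS : hu1 => [hu hui].
apply/estS; split; first exact: est0_comp.
move=> i; apply: (@est_congr _ _ _ _
    (fun e x => (sderiv f \o u e) x * partial i (u e) x)).
  by move=> e e01 x Xx; rewrite (@partial_comp _ _ X)//; exact/smooth_regular/su.
rewrite -[0]addr0; apply: estM => //; [exact: smooth_net_comp|
  exact: smooth_net_partial|exact: ih].
Qed.

Lemma sfun_lip f (C : R) : exists M : R,
  forall y z, `|y| <= C -> `|z| <= C -> `|f y - f z| <= M * `|y - z|.
Proof.
have [M HM] := sfun_bound (sderiv f) C; exists M.
suff lip y z : `|y| <= C -> `|z| <= C -> y <= z -> `|f z - f y| <= M * `|z - y|.
  move=> y z yC zC; have [yz|/ltW zy] := leP y z; last exact: lip.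
  by rewrite distrC [`|y - z|]distrC; exact: lip.
move=> yC zC yz; have [c cyz ->] : exists2 c, c \in `[y, z] &
    f z - f y = sderiv f c * (z - y).
  apply: MVT_segment => // [c _|]; first exact: sfun_is_derive.
  by apply: continuous_subspaceT => c; exact: sfun_continuous.
rewrite normrM ler_wpM2r//; apply: HM.
move: yC zC cyz; rewrite !ler_norml in_itv/= => /andP[yC _] /andP[_ zC] /andP[yc cz].
by rewrite (le_trans yC)// (le_trans cz).
Qed.

Lemma est0_compB X K f a u v : K `<=` carrier X ->
  smooth_net X u -> smooth_net X v -> est X K 0 0 u -> est X K 0 0 v ->
  est X K a 0 (fun e x => u e x - v e x) ->
  est X K a 0 (fun e x => f (u e x) - f (v e x)).
Proof.
move=> KX su sv hu hv huv [|//] _.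
have [C HC] := hu [::] isT; have [D HD] := hv [::] isT.
have [E HE] := bigO_on_pos (huv [::] isT).
have [M HM] := sfun_lip f (Num.max C D); exists (`|M| * E); near=> e => x Kx.
have e01 : 0 < e <= 1 by near: e; exact: near0_itv.
have Xx := KX x Kx; have ru := smooth_regular (su e e01).
have rv := smooth_regular (sv e e01).
have := pderivXB [::] (smooth_comp f (su e e01)) (smooth_comp f (sv e e01)) Xx.
rewrite /= => ->; rewrite /pderivX/= !extension_comp//.
apply: (@le_trans _ _ (M * `|extension X (u e) x - extension X (v e) x|)).
  apply: HM.
    rewrite le_max; apply/orP; left; rewrite -[C]mulr1 -(powRr0 e).
    by move: (x) Kx; near: e.
  rewrite le_max; apply/orP; right; rewrite -[D]mulr1 -(powRr0 e).
  by move: (x) Kx; near: e.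
apply: (@le_trans _ _ (`|M| * `|extension X (u e) x - extension X (v e) x|)).
  by rewrite ler_wpM2r// ler_norm.
rewrite -mulrA ler_wpM2l//.
have := pderivXB [::] (su e e01) (sv e e01) Xx; rewrite /pderivX/= => <-.
by move: (x) Kx; near: e.
Unshelve. all: by end_near. Qed.

Lemma est_compB X K f a k u v : K `<=` carrier X ->
  smooth_net X u -> smooth_net X v -> est X K 0 k u -> est X K 0 k v ->
  est X K a k (fun e x => u e x - v e x) ->
  est X K a k (fun e x => f (u e x) - f (v e x)).
Proof.
move=> KX; elim: k f u v => [|k ih] f u v su sv hu1 hv1 huv1.
  exact: est0_compB.
have hu0 := est_le (leqnSn k) hu1; have hv0 := est_le (leqnSn k) hv1.
have huv0 := est_le (leqnSn k) huv1.
move/estS : hu1 => [hu hui]; move/estS : hv1 => [hv hvi].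
move/estS : huv1 => [huv huvi].
apply/estS; split; first exact: est0_compB.
have sui i := smooth_net_partial i su; have svi i := smooth_net_partial i sv.
move=> i; apply: (@est_congr _ _ _ _
    (fun e x => (sderiv f \o u e) x * (partial i (u e) x - partial i (v e) x) +
       (sderiv f (u e x) - sderiv f (v e x)) * partial i (v e) x)).
  move=> e e01 x Xx.
  have ru := smooth_regular (su e e01); have rv := smooth_regular (sv e e01).
  have -> : (fun x => f (u e x) - f (v e x)) =
      (fun x => (f \o u e) x + (-1) * (f \o v e) x).
    by apply/funext => y; rewrite mulN1r.
  have rfu := regular_comp f ru; have rfv := regular_comp f rv.
  rewrite (@partialD _ _ X)//; last first.
    by apply: regularM => //; exact: regular_cst.
  rewrite (@partialZ _ _ X)// !(@partial_comp _ _ X)//=.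
  by rewrite mulrBr mulrBl mulN1r addrA subrK.
have sB : smooth_net X (fun e x => sderiv f (u e x) - sderiv f (v e x)).
  exact: (smooth_netB (smooth_net_comp (sderiv f) su)
                      (smooth_net_comp (sderiv f) sv)).
apply: estD => //.
- apply: smooth_netM; [exact: smooth_net_comp|exact: smooth_netB].
- exact: smooth_netM.
- rewrite -[a]add0r; apply: estM => //; [exact: smooth_net_comp|
    exact: smooth_netB|exact: est_comp|].
  apply: est_congr (huvi i) => e e01 x Xx.
  have ru := smooth_regular (su e e01); have rv := smooth_regular (sv e e01).
  have -> : (fun x => u e x - v e x) = (fun x => u e x + (-1) * v e x).
    by apply/funext => y; rewrite mulN1r.
  rewrite (@partialD _ _ X)//; last first.
    by apply: regularM => //; exact: regular_cst.
  by rewrite (@partialZ _ _ X)// mulN1r.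
- rewrite -[a]addr0; apply: estM => //; exact: ih.
Qed.

End Estimates.

Section GeneralizedNumbers.
Context {R : realType}.
Implicit Types (c : R -> R) (b : R).

Definition bigO b c := exists C : R, \forall e \near 0^'+, `|c e| <= C * e `^ b.

Lemma bigO_unit b c : bigO b c <-> bigO_on [set: unit] b (fun e _ => c e).
Proof.
split=> [[C HC]|[C HC]]; exists C; apply: filterS HC => e He //.
exact: (He tt).
Qed.

Lemma bigOB b c c' : bigO b c -> bigO b c' -> bigO b (fun e => c e - c' e).
Proof.
move=> [C HC] [D HD]; exists (C + D); near=> e.
by rewrite mulrDl (le_trans (ler_normB _ _))// lerD//; near: e.
Unshelve. all: by end_near. Qed.

Lemma bigO_0 b : bigO b (fun=> 0).
Proof. by exists 0; near=> e; rewrite normr0 mul0r. Unshelve. all: by end_near. Qed.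

Lemma bigO_le a b c : a <= b -> bigO b c -> bigO a c.
Proof. by move=> ab /bigO_unit h; apply/bigO_unit; exact: bigO_on_le h. Qed.

Definition moderate_num : {pred R -> R} := fun c => `[< exists b, bigO b c >].

Lemma moderate_num_zmod : zmod_closed moderate_num.
Proof.
split=> [|c c' /asboolP[b hb] /asboolP[b' hb']]; apply/asboolP.
  by exists 0; exact: bigO_0.
exists (Num.min b b'); apply: bigOB; [apply: bigO_le hb|apply: bigO_le hb'].
  by rewrite ge_min lexx.
by rewrite ge_min lexx orbT.
Qed.

HB.instance Definition _ :=
  GRing.isZmodClosed.Build (R -> R) moderate_num moderate_num_zmod.

End GeneralizedNumbers.

Section GNum.
Variable R : realType.

Record mnum := MNum { mnum_val :> R -> R; mnumP : mnum_val \in moderate_num }.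
HB.instance Definition _ := [isSub for mnum_val].
HB.instance Definition _ := [Choice of mnum by <:].
HB.instance Definition _ := [SubChoice_isSubZmodule of mnum by <:].

Definition null_num : {pred mnum} := fun c => `[< forall a, 0 <= a -> bigO a c >].

Lemma null_num_zmod : zmod_closed null_num.
Proof.
split=> [|c c' /asboolP hc /asboolP hc']; apply/asboolP => a a0.
  exact: bigO_0.
by apply: bigOB; [exact: hc|exact: hc'].
Qed.

HB.instance Definition _ := GRing.isZmodClosed.Build mnum null_num null_num_zmod.

Definition gnum := Quotient.quot null_num.
HB.instance Definition _ := GRing.Zmodule.on gnum.

Definition valuation (E : gnum) : \bar R :=
  ereal_sup [set b%:E | b in [set b | bigO b (repr E)]].

Definition gnum_class (c : mnum) : gnum := \pi_gnum%qT c.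

Lemma repr_gnum_class (c : mnum) a : 0 <= a ->
  bigO a (fun e => repr (gnum_class c) e - c e).
Proof.
move=> a0; suff : repr (gnum_class c) - c \in null_num by move/asboolP; exact.
by rewrite Quotient.idealrBE; apply/eqP; exact: reprK.
Qed.

Lemma bigO_gnum_class (c : mnum) b : bigO b (repr (gnum_class c)) <-> bigO b c.
Proof.
have m0 : 0 <= Num.max 0 b by rewrite le_max lexx.
have h : bigO b (fun e => repr (gnum_class c) e - c e).
  by apply: bigO_le (repr_gnum_class c m0); rewrite le_max lexx orbT.
split=> hc; have := bigOB hc h => -[C HC].
  by exists C; apply: filterS HC => e; rewrite opprB addrCA subrr addr0.
have [D HD] := hc; have [E HE] := h; exists (E + D); near=> e.
rewrite -[repr (gnum_class c) e](subrK (c e)) (le_trans (ler_normD _ _))// mulrDl lerD//.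
  by near: e.
by near: e.
Unshelve. all: by end_near. Qed.

Lemma valuation_class (c : mnum) : valuation (gnum_class c) =
  ereal_sup [set b%:E | b in [set b | bigO b c]].
Proof.
rewrite /valuation; congr (ereal_sup [set b%:E | b in _]).
by apply/seteqP; split=> b /bigO_gnum_class.
Qed.

End GNum.

Section Colombeau.
Context {R : realType} {n : nat}.
Implicit Type X : region R n.

Definition moderate_net X : {pred R -> 'rV[R]_n -> R} :=
  fun u => `[< smooth_net X u /\ moderate X u >].

Lemma pderivX0 X s x : carrier X x -> pderivX X s (fun=> 0) x = 0.
Proof.
move=> Xx; have e0 : (fun=> 0 - 0) = (fun=> 0) :> ('rV[R]_n -> R).
  by apply/funext => y; rewrite subrr.
by rewrite -e0 pderivXB ?subrr//; exact: smooth_cst.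
Qed.

Lemma bigO_onB K b (w z : R -> 'rV[R]_n -> R) : bigO_on K b w ->
  bigO_on K b z -> bigO_on K b (fun e x => w e x - z e x).
Proof.
move=> hw [C HC]; apply: bigO_onD => //; exists C.
by apply: filterS HC => e He x Kx; rewrite normrN; exact: He.
Qed.

Lemma bigO_pderivXB X K s b (u v : R -> 'rV[R]_n -> R) : K `<=` carrier X ->
  smooth_net X u -> smooth_net X v ->
  bigO_on K b (fun e => pderivX X s (u e)) ->
  bigO_on K b (fun e => pderivX X s (v e)) ->
  bigO_on K b (fun e => pderivX X s (fun x => u e x - v e x)).
Proof.
move=> KX su sv hu hv; apply: (bigO_on_congr _ (bigO_onB hu hv)) => e x e01 Kx.
by rewrite pderivXB//; [exact: su|exact: sv|exact: KX].
Qed.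

Lemma bigO_pderivX0 X K s b : K `<=` carrier X ->
  bigO_on K b (fun _ : R => pderivX X s (fun=> 0)).
Proof.
move=> KX; apply: (bigO_on_congr _ (bigO_on0 K b)) => e x _ Kx.
by rewrite pderivX0//; exact: KX.
Qed.

Lemma moderate_net_zmod X : zmod_closed (moderate_net X).
Proof.
split=> [|u v /asboolP[su mu] /asboolP[sv mv]]; apply/asboolP; split.
- by move=> e _; exact: smooth_cst.
- by move=> K s _ KX; exists 0; exact: bigO_pderivX0.
- exact: smooth_netB.
- move=> K s cK KX; have [b hb] := mu K s cK KX; have [b' hb'] := mv K s cK KX.
  exists (Num.min b b'); apply: bigO_pderivXB => //.
    by apply: bigO_on_le hb; rewrite ge_min lexx.
  by apply: bigO_on_le hb'; rewrite ge_min lexx orbT.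
Qed.

HB.instance Definition _ X := GRing.isZmodClosed.Build
  (R -> 'rV[R]_n -> R) (moderate_net X) (moderate_net_zmod X).

Record mnet X := MNet {
  mnet_val :> R -> 'rV[R]_n -> R;
  mnet_valP : mnet_val \in moderate_net X }.
HB.instance Definition _ X := [isSub for @mnet_val X].
HB.instance Definition _ X := [Choice of mnet X by <:].
HB.instance Definition _ X := [SubChoice_isSubZmodule of mnet X by <:].

Lemma mnetP X (u : mnet X) : smooth_net X u /\ moderate X u.
Proof. by have /asboolP := mnet_valP u. Qed.

Lemma mnet_smooth X (u : mnet X) : smooth_net X u.
Proof. by have [] := mnetP u. Qed.

Definition null_net X : {pred mnet X} :=
  fun u => `[< negligible_on X (carrier X) u >].
Arguments null_net : clear implicits.

Lemma null_net_zmod X : zmod_closed (null_net X).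
Proof.
split=> [|u v /asboolP hu /asboolP hv]; apply/asboolP => K s a cK KX a0.
  exact: bigO_pderivX0.
apply: bigO_pderivXB => //; [exact: mnet_smooth|exact: mnet_smooth|
  exact: hu|exact: hv].
Qed.

HB.instance Definition _ X :=
  GRing.isZmodClosed.Build (mnet X) (null_net X) (null_net_zmod X).

Definition colombeau X := Quotient.quot (null_net X).
HB.instance Definition _ X := GRing.Zmodule.on (colombeau X).

Definition Gclass X (u : mnet X) : colombeau X := \pi_(colombeau X)%qT u.

Lemma GclassP X (u v : mnet X) : Gclass u = Gclass v <->
  negligible_on X (carrier X) (fun e x => u e x - v e x).
Proof.
have -> : (Gclass u = Gclass v) <-> (u - v \in null_net X).
  rewrite Quotient.idealrBE; split=> [uv|/eqP//].
  by apply/eqP; exact: uv.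
by split=> [/asboolP|h]; [|apply/asboolP].
Qed.

Lemma Gclass_repr X (U : colombeau X) : Gclass (repr U) = U.
Proof. exact: reprK. Qed.

Lemma repr_Gclass X (u : mnet X) : negligible_on X (carrier X)
  (fun e x => repr (Gclass u) e x - u e x).
Proof. by apply/GclassP; exact: Gclass_repr. Qed.

Lemma GclassB X (u v : mnet X) : Gclass u - Gclass v = Gclass (u - v).
Proof. by rewrite /Gclass !piE. Qed.

Lemma GclassD X (u v : mnet X) : Gclass u + Gclass v = Gclass (u + v).
Proof. by rewrite /Gclass !piE. Qed.

Lemma mnet_partial_subproof X i (u : mnet X) :
  (fun e => partial i (u e)) \in moderate_net X.
Proof.
have [su mu] := mnetP u; apply/asboolP; split; first exact: smooth_net_partial.
by move=> K s cK KX; exact: (mu K (i :: s)).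
Qed.

Definition mnet_partial X i (u : mnet X) : mnet X :=
  MNet (mnet_partial_subproof i u).

Definition Gpartial X i (U : colombeau X) : colombeau X :=
  Gclass (mnet_partial i (repr U)).

Lemma Gpartial_class X i (u : mnet X) :
  Gpartial i (Gclass u) = Gclass (mnet_partial i u).
Proof.
apply/GclassP => K s a cK KX a0.
have h := repr_Gclass u (i :: s) cK KX a0; apply: bigO_on_congr h => e x e01 Kx.
have su := mnet_smooth u e01; have sU := mnet_smooth (repr (Gclass u)) e01.
have Xx := KX x Kx; rewrite (pderivXB (i :: s) sU su Xx).
by rewrite (pderivXB s (smooth_partial i sU) (smooth_partial i su) Xx).
Qed.

Lemma mnet_scale_subproof X (c : mnum R) (u : mnet X) :
  (fun e x => c e * u e x) \in moderate_net X.
Proof.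
have [su mu] := mnetP u; apply/asboolP; split.
  by move=> e e01; apply: smoothZ; exact: su.
move=> K s cK KX; have [b hb] := mu K s cK KX.
have /asboolP[a [C HC]] := mnumP c.
have hc : bigO_on K a (fun e (_ : 'rV[R]_n) => c e).
  by exists C; apply: filterS HC.
exists (a + b); apply: (bigO_on_congr _ (bigO_onM hc hb)) => e x e01 Kx.
by rewrite pderivXZ//; [exact: su|exact: KX].
Qed.

Definition mnet_scale X (c : mnum R) (u : mnet X) : mnet X :=
  MNet (mnet_scale_subproof c u).

Definition Gscale X (E : gnum R) (U : colombeau X) : colombeau X :=
  Gclass (mnet_scale (repr E) (repr U)).

Lemma Gscale_class X (c : mnum R) (u : mnet X) :
  Gscale (gnum_class c) (Gclass u) = Gclass (mnet_scale c u).
Proof.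
apply/GclassP => K s a cK KX a0 /=.
set c' := repr (gnum_class c); set u' := repr (Gclass u).
have su : smooth_net X u := mnet_smooth u.
have su' : smooth_net X u' := mnet_smooth u'.
have [b hb] := (mnetP u').2 K s cK KX.
have /asboolP[g [G HG]] := mnumP c.
have m1 : 0 <= Num.max 0 (a - b) by rewrite le_max lexx.
have m2 : 0 <= Num.max 0 (a - g) by rewrite le_max lexx.
have hc : bigO_on K g (fun e (_ : 'rV[R]_n) => c e).
  by exists G; apply: filterS HG.
have hc' : bigO_on K (Num.max 0 (a - b)) (fun e (_ : 'rV[R]_n) => c' e - c e).
  by have [C HC] := repr_gnum_class c m1; exists C; apply: filterS HC.
have h1 := bigO_onM hc' hb.
have h2 := bigO_onM hc (repr_Gclass u s cK KX m2).
have {}h1 : bigO_on K a (fun e x => (c' e - c e) * pderivX X s (u' e) x).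
  by apply: bigO_on_le h1; rewrite -lerBlDr le_max lexx orbT.
have {}h2 : bigO_on K a (fun e x =>
    c e * pderivX X s (fun y => u' e y - u e y) x).
  by apply: bigO_on_le h2; rewrite -lerBlDl le_max lexx orbT.
apply: (bigO_on_congr _ (bigO_onD h1 h2)) => e x e01 Kx.
have Xx := KX x Kx; have sue := su e e01; have sue' := su' e e01.
rewrite (pderivXB s sue' sue Xx).
rewrite (pderivXB s (smoothZ (c' e) sue') (smoothZ (c e) sue) Xx).
rewrite (pderivXZ s _ sue' Xx) (pderivXZ s _ sue Xx).
by rewrite mulrBl mulrBr addrA subrK.
Qed.

Definition bounded_class X : {pred colombeau X} :=
  fun U => `[< exists u : mnet X, Gclass u = U /\ bounded_type X u >].

Record colombeau0 X := Colombeau0 {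
  G0_val :> colombeau X;
  G0_valP : G0_val \in @bounded_class X }.
HB.instance Definition _ X := [isSub for @G0_val X].

Lemma bounded_repr X (U : colombeau0 X) : bounded_type X (repr (G0_val U)).
Proof.
have /asboolP[u [uU bu]] := G0_valP U; move=> K s cK KX.
have := repr_Gclass u s cK KX (lexx 0); rewrite uU => h.
apply: (bigO_on_congr _ (bigO_onD h (bu K s cK KX))) => e x e01 Kx.
by rewrite pderivXB ?subrK//; [exact: mnet_smooth..|exact: KX].
Qed.

Lemma bounded_comp X (f : smooth_fun R) (u : R -> 'rV[R]_n -> R) : smooth_net X u ->
  bounded_type X u -> bounded_type X (fun e => f \o u e).
Proof.
move=> su bu K s cK KX; move: s; apply/estP => k; apply: est_comp => //.
by move: k; apply/estP => s; exact: bu.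
Qed.

Lemma mnet_comp_subproof X (f : smooth_fun R) (U : colombeau0 X) :
  (fun e => f \o repr (G0_val U) e) \in moderate_net X.
Proof.
have su := @mnet_smooth X (repr (G0_val U)).
apply/asboolP; split; first exact: smooth_net_comp.
move=> K s cK KX; exists 0; apply: bounded_comp => //; exact: bounded_repr.
Qed.

Lemma Gcomp_subproof X (f : smooth_fun R) (U : colombeau0 X) :
  Gclass (MNet (mnet_comp_subproof f U)) \in @bounded_class X.
Proof.
apply/asboolP; exists (MNet (mnet_comp_subproof f U)); split=> //.
by apply: bounded_comp; [exact: mnet_smooth|exact: bounded_repr].
Qed.

Definition Gcomp X (f : smooth_fun R) (U : colombeau0 X) : colombeau0 X :=
  Colombeau0 (Gcomp_subproof f U).

Lemma Gcomp_class X (f : smooth_fun R) (U : colombeau0 X) (u v : mnet X) :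
  Gclass u = U -> bounded_type X u ->
  (forall e x, v e x = f (u e x)) -> G0_val (Gcomp f U) = Gclass v.
Proof.
move=> uU bu vfu; apply/GclassP => K s a cK KX a0 /=.
have -> : mnet_val v = (fun e x => f (u e x)).
  by apply/funext => e; apply/funext => x; rewrite vfu.
move: s; apply/estP => k; apply: est_compB => //; [exact: mnet_smooth..| | |].
- by move: k; apply/estP => s; exact: bounded_repr.
- by move: k; apply/estP => s; exact: bu.
- by move: k; apply/estP => s; rewrite -uU; exact: repr_Gclass.
Qed.

(* U|_A = 0 in G(A), for A relatively open in X: the derivatives at points of
   A extended from Omega or from the intersection of A and Omega agree, so
   this asks the negligibility estimates on the compact subsets of A. *)
Definition vanishes_on X (A : set 'rV[R]_n) (U : colombeau X) :=
  negligible_on X A (repr U).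

Definition rel_open X (A : set 'rV[R]_n) :=
  exists2 O : set 'rV[R]_n, open O & A = carrier X `&` O.

(* The largest relatively open set where U vanishes is the union of all of
   them, see [vanishes_off_supp]. *)
Definition supp X (U : colombeau X) : set 'rV[R]_n :=
  carrier X `\` \bigcup_(A in [set A | rel_open X A /\ vanishes_on A U]) A.

Lemma vanishes_on_class X A (u : mnet X) : A `<=` carrier X ->
  vanishes_on A (Gclass u) <-> negligible_on X A u.
Proof.
move=> AX; set u' := repr (Gclass u); rewrite /vanishes_on -/u'.
have su : smooth_net X u := mnet_smooth u.
have su' : smooth_net X u' := mnet_smooth u'.
split=> h K s a cK KA a0; have KX := subset_trans KA AX.
all: have h1 := h K s a cK KA a0; have h2 := repr_Gclass u s cK KX a0.
  apply: (bigO_on_congr _ (bigO_onB h1 h2)) => e x e01 Kx.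
  have Xx := KX x Kx; rewrite (pderivXB s (su' e e01) (su e e01) Xx).
  by rewrite opprB addrCA subrr addr0.
apply: (bigO_on_congr _ (bigO_onD h2 h1)) => e x e01 Kx.
by have Xx := KX x Kx; rewrite (pderivXB s (su' e e01) (su e e01) Xx) subrK.
Qed.

Lemma bigO_on_near K (w : R -> 'rV[R]_n -> R) b :
  (\forall e \near 0^'+, forall x, K x -> `|w e x| <= e `^ b) -> bigO_on K b w.
Proof. by move=> h; exists 1; apply: filterS h => e h x /h; rewrite mul1r. Qed.

Lemma vanishes_off_supp X (U : colombeau X) :
  rel_open X (carrier X `\` supp U) /\
  vanishes_on (carrier X `\` supp U) U.
Proof.
have sE : carrier X `\` supp U =
    \bigcup_(A in [set A | rel_open X A /\ vanishes_on A U]) A.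
  rewrite /supp setDD setIidr// => x [A [[O _ ->] _] []//].
rewrite sE; split.
  exists (\bigcup_(O in [set O | open O /\ vanishes_on (carrier X `&` O) U]) O).
    by apply: bigcup_open => O [].
  rewrite setI_bigcupr eqEsubset; split=> x.
    by move=> [A [[O oO ->] vA] Ax]; exists O.
  by move=> [O [oO vO] Ox]; exists (carrier X `&` O) => //; split=> //; exists O.
move=> K s a cK KA a0; apply: bigO_on_near.
suff : \forall e \near 0^'+, K `<=` (fun y => K y -> `|pderivX X s (repr U e) y| <= e `^ a).
  by apply: filterS => e h y Ky; exact: h.
apply: (compact_near_coveringP K).1 => // x Kx.
have [A [[O oO AO] vA] Ax] := KA x Kx.
have /nbhs_closedballP[r rO] : nbhs x O.
  by apply: open_nbhs_nbhs; split=> //; move: Ax; rewrite AO => -[].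
have KX : K `<=` carrier X by move=> y /KA[B [[? _ ->] _] []].
have cKr : compact (K `&` closed_ball x r%:num).
  by apply: compact_closedI => //; exact: closed_ball_closed.
have KrA : K `&` closed_ball x r%:num `<=` A.
  by move=> y [Ky yr]; rewrite AO; split; [exact: KX|exact: rO].
have := bigO_on_lt1 a0 (fun b b0 => vA _ s b cKr KrA b0) => h.
exists (closed_ball x r%:num, [set e | forall y,
  (K `&` closed_ball x r%:num) y -> `|pderivX X s (repr U e) y| <= e `^ a]).
  split=> //=; by apply/nbhs_closedballP; exists r.
by move=> [y e] /= [yr h'] Ky; exact: h'.
Qed.

End Colombeau.

Section Slab.
Context {R : realType} {d : nat}.
Implicit Types (T t h : R) (x y : 'rV[R]_d) (z : 'rV[R]_(1 + d)).

Definition whole : region R d := Region openT false.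

Definition time_coord : 'I_(1 + d) := lshift d ord0.
Definition space_coord (i : 'I_d) : 'I_(1 + d) := rshift 1 i.
Definition event t x : 'rV[R]_(1 + d) := row_mx (const_mx t) x.

Lemma event_time t x : event t x ord0 time_coord = t.
Proof. by rewrite /event row_mxEl mxE. Qed.

Lemma event_space t x i : event t x ord0 (space_coord i) = x ord0 i.
Proof. by rewrite /event row_mxEr. Qed.

Lemma time_continuous : continuous (fun z => z ord0 time_coord).
Proof. exact: coord_continuous. Qed.

Lemma open_slab_subproof T : open [set z : 'rV[R]_(1 + d) | 0 < z ord0 time_coord < T].
Proof.
rewrite (_ : [set _ | _] = (fun z => z ord0 time_coord) @^-1` `]0, T[%classic).
  by apply: open_comp => [z _|]; [exact: time_continuous|exact: interval_open].
by apply/seteqP; split=> z /=; rewrite in_itv.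
Qed.

(* [0, T] x R^d, the closure of (0, T) x R^d; see [carrier_slab]. *)
Definition slab T : region R (1 + d) := Region (@open_slab_subproof T) true.

Lemma carrier_whole : carrier whole = setT.
Proof. by []. Qed.

Lemma event_line t h x i :
  event t (h *: delta_mx 0 i + x) = h *: delta_mx 0 (space_coord i) + event t x.
Proof.
apply/rowP => j; rewrite !mxE; case: splitP => k jk.
  rewrite !mxE eqxx/= (_ : (j == space_coord i) = false) ?mulr0 ?add0r//.
  by apply/eqP => /(congr1 val) /=; rewrite jk; case: k {jk} => -[].
rewrite !mxE eqxx/=; congr (_ * _ + _).
by congr (_ %:R); rewrite -!val_eqE/= jk eqn_add2l.
Qed.

Lemma ball_event z t x e : 0 < e -> ball z e (event t x) <->
  `|z ord0 time_coord - t| < e /\ forall i, `|z ord0 (space_coord i) - x ord0 i| < e.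
Proof.
move=> e0; split.
  move=> [_ h]; split; first by have := h ord0 time_coord; rewrite event_time.
  by move=> i; have := h ord0 (space_coord i); rewrite event_space.
move=> [ht hx]; split=> // i j; rewrite (ord1 i).
have [k jk|k jk] := splitP j.
  have -> : j = time_coord by apply/val_inj; rewrite /= jk; case: k {jk} => -[].
  by rewrite event_time; exact: ht.
have -> : j = space_coord k by apply/val_inj.
by rewrite event_space; exact: hx.
Qed.

Lemma event_continuous t : continuous (event t).
Proof.
move=> x; suff : event t @ nbhs x --> event t x by [].
apply/cvg_ballP => e e0; near=> y.
apply/ball_event => //; split; first by rewrite event_time subrr normr0.
move=> i; rewrite event_space.
have : ball x e y by near: y; exact: nbhsx_ballx.
by move=> [_] /(_ ord0 i).
Unshelve. all: by end_near. Qed.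

Lemma carrier_slab T : 0 < T -> carrier (slab T) = [set z : 'rV[R]_(1 + d) | 0 <= z ord0 time_coord <= T].
Proof.
move=> T0; rewrite /carrier/=; apply/seteqP; split.
  have cl : closed [set z : 'rV[R]_(1 + d) | 0 <= z ord0 time_coord <= T].
    rewrite (_ : [set _ | _] = (fun z => z ord0 time_coord) @^-1` `[0, T]%classic).
      apply: preimage_closed; last exact: interval_closed.
      by move=> z _; exact: time_continuous.
    by apply/seteqP; split=> z /=; rewrite in_itv.
  rewrite closure_id in cl; rewrite [X in _ `<=` X]cl; apply: closureS.
  by move=> z /= /andP[z0 zT]; rewrite !ltW.
move=> z /= /andP[z0 zT] B Bz.
pose w : 'rV[R]_(1 + d) := (T / 2 - z ord0 time_coord) *: delta_mx 0 time_coord.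
have cw : (fun h : R => h *: w + z) @ (0 : R)^'+ --> z.
  apply: cvg_within_filter.
  suff : (fun h : R => h *: w + z) @ (0 : R) --> 0 *: w + z.
    by rewrite scale0r add0r.
  by apply: cvgD; [apply: cvgZ; [exact: cvg_id|exact: cvg_cst]|exact: cvg_cst].
have [h [hB /andP[h0 h1]]] : exists h : R, B (h *: w + z) /\ 0 < h <= 1.
  apply: (@filter_ex _ (0 : R)^'+); near=> h.
  by split; near: h; [exact: cw|exact: near0_itv].
exists (h *: w + z); split=> //=.
rewrite !mxE !eqxx mulr1.
move: h0 h1 z0 zT T0; set t := z _ _ => h0 h1 z0 zT T0.
have -> : h * (T / 2 - t) + t = h * (T / 2) + (1 - h) * t.
  by rewrite mulrBr mulrBl mul1r addrAC addrA.
have hT : 0 < h * (T / 2) by rewrite mulr_gt0// divr_gt0.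
have h1t : 0 <= (1 - h) * t by rewrite mulr_ge0// subr_ge0.
have h1t' : (1 - h) * t <= (1 - h) * T by rewrite ler_wpM2l// subr_ge0.
rewrite ltr_wpDr//=; apply: le_lt_trans (lerD (lexx _) h1t') _.
rewrite mulrBl mul1r addrCA gtrDl subr_lt0 ltr_pM2l//.
by rewrite ltr_pdivrMr// ltr_pMr// ltr1n.
Unshelve. all: by end_near. Qed.

Definition trace T (u : 'rV[R]_(1 + d) -> R) : 'rV[R]_d -> R :=
  fun x => extension (slab T) u (event 0 x).

Lemma is_derive_line T u t x i h : regular (slab T) u -> 0 < t < T ->
  is_derive h 1 (fun s : R => u (event t (s *: delta_mx 0 i + x)))
    (partial (space_coord i) u (event t (h *: delta_mx 0 i + x))).
Proof.
move=> [du _] t0T; set z := event t _.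
have dz : derivable u z (delta_mx 0 (space_coord i)) by apply: du; rewrite /= event_time.
have e : (fun k : R => k^-1 *: ((u \o shift z) (k *: delta_mx 0 (space_coord i)) - u z)) =
    (fun k : R => k^-1 *: (((fun s : R => u (event t (s *: delta_mx 0 i + x))) \o
      shift h) (k *: (1 : R)) - u z)).
  apply/funext => k /=; congr (_ *: (u _ - _)).
  by rewrite [_%:A]mulr1 scalerDl -addrA event_line.
by apply: DeriveDef; rewrite ?/partial /derivable /derive -e.
Qed.

Lemma MVT_sym (f df : R -> R) h : (forall s : R, is_derive s 1 f (df s)) ->
  exists2 c, `|c| <= `|h| & f h - f 0 = df c * h.
Proof.
move=> fdf.
have cf (a b : R) : {within `[a, b], continuous f}.
  apply: continuous_subspaceT => s; apply: differentiable_continuous.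
  by apply/derivable1_diffP; have [] := fdf s.
have [h0|/ltW h0] := leP 0 h.
  have [c + ->] := MVT_segment h0 (fun s _ => fdf s) (cf 0 h).
  rewrite in_itv/= => /andP[c0 ch]; exists c; last by rewrite subr0.
  by rewrite !ger0_norm.
have [c + e] := MVT_segment h0 (fun s _ => fdf s) (cf h 0).
rewrite in_itv/= => /andP[hc c0]; exists c; first by rewrite !ler0_norm ?lerN2.
by rewrite -opprB e sub0r mulrN opprK.
Qed.

Lemma carrier_event T x : 0 < T -> carrier (slab T) (event 0 x).
Proof. by move=> T0; rewrite carrier_slab//= event_time lexx ltW. Qed.

Lemma event_cvg0 T x : 0 < T ->
  event^~ x @ (0 : R)^'+ --> within (inner (slab T)) (nbhs (event 0 x)).
Proof.
move=> T0 A /nbhs_ballP[e /= e0 He].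
suff : \forall t \near (0 : R)^'+, A (event t x) by [].
near=> t.
apply: (He (event t x)) => /=.
  apply/ball_event => //; rewrite event_time; split.
    rewrite sub0r normrN gtr0_norm; last by near: t; exact: nbhs_right_gt.
    by near: t; exact: nbhs_right_lt.
  by move=> i; rewrite event_space subrr normr0.
rewrite event_time; apply/andP; split; near: t; first exact: nbhs_right_gt.
exact: nbhs_right_lt.
Unshelve. all: by end_near. Qed.

Lemma trace_cvg T u x : 0 < T -> regular (slab T) u ->
  (fun t => u (event t x)) @ (0 : R)^'+ --> trace T u x.
Proof.
move=> T0 [_ eu]; apply: (@cvg_comp _ _ _ (event^~ x) u _
    (within (inner (slab T)) (nbhs (event 0 x)))); first exact: event_cvg0.
by apply: extension_cvgP => //; exact: carrier_event.
Qed.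

Lemma is_derive_trace T u i x : 0 < T -> regular (slab T) u ->
  extendable (slab T) (partial (space_coord i) u) ->
  is_derive x (delta_mx 0 i) (trace T u) (trace T (partial (space_coord i) u) x).
Proof.
move=> T0 ru edu; set l := trace T (partial (space_coord i) u) x.
suff h : (fun h : R => h^-1 *: ((trace T u \o shift x) (h *: delta_mx 0 i) -
    trace T u x)) @ 0^' --> l.
  by apply: DeriveDef; [apply/cvg_ex; exists l|exact: cvg_lim].
apply/cvgrPdist_le => /= eps eps0.
have /nbhs_ballP[e /= e0 He] : within (inner (slab T)) (nbhs (event 0 x))
    [set z | `|l - partial (space_coord i) u z| <= eps].
  have := extension_cvgP edu (@carrier_event T x T0).
  by move/cvgrPdist_le => /(_ eps eps0).
near=> h.
have h0 : h != 0 by near: h; exact: nbhs_dnbhs_neq.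
have he : `|h| < e.
  near: h; apply: dnbhs0_lt => //.
rewrite -(ler_pM2l (_ : 0 < `|h|)) ?normr_gt0// -normrM mulrBr.
rewrite [h * (_ *: _)]mulrA mulfV// mul1r.
set y := h *: delta_mx 0 i + x.
have cl : (fun t => `|h * l - (u (event t y) - u (event t x))|) @ (0 : R)^'+ -->
    `|h * l - (trace T u y - trace T u x)|.
  apply: cvg_norm; apply: cvgB; first exact: cvg_cst.
  by apply: cvgB; exact: trace_cvg.
rewrite -(cvg_lim _ cl)//; apply: limr_le; first by apply/cvg_ex; eexists; exact: cl.
near=> t.
have t0 : 0 < t by near: t; exact: nbhs_right_gt.
have tT : t < T by near: t; exact: nbhs_right_lt.
have te : t < e by near: t; exact: nbhs_right_lt.
have t0T : 0 < t < T by rewrite t0.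
have [c ch] := MVT_sym h (fun s => is_derive_line x i s ru t0T).
rewrite -/y scale0r add0r => ->.
rewrite mulrC -mulrBl normrM mulrC ler_wpM2l//.
apply: (He (event t (c *: delta_mx 0 i + x))) => /=; last by rewrite event_time.
apply/ball_event => //; rewrite event_time; split.
  by rewrite sub0r normrN gtr0_norm.
move=> j; rewrite event_space !mxE opprD addrCA subrr addr0 normrN normrM.
apply: le_lt_trans he; rewrite -[leRHS]mulr1 ler_pM//.
by case: (_ && _); rewrite ?normr1 ?normr0.
Unshelve. all: by end_near. Qed.

Lemma partial_trace T u i : 0 < T -> smooth (slab T) u ->
  partial i (trace T u) = trace T (partial (space_coord i) u).
Proof.
move=> T0 su; apply/funext => x.
have [] // := @is_derive_trace T u i x T0 (smooth_regular su).
by have [] := smooth_regular (smooth_partial (space_coord i) su).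
Qed.

Lemma pderiv_trace T u s : 0 < T -> smooth (slab T) u ->
  pderiv s (trace T u) = trace T (pderiv (map space_coord s) u).
Proof.
move=> T0; elim: s u => //= i s ih u su.
by rewrite partial_trace// ih//; exact: smooth_partial.
Qed.

Lemma trace_continuous T u : 0 < T -> extendable (slab T) u ->
  continuous (trace T u).
Proof.
move=> T0 eu x; have Xx := @carrier_event T x T0.
apply: (@cvg_comp _ _ _ (event 0) (extension (slab T) u) _
    (within (carrier (slab T)) (nbhs (event 0 x)))); last first.
  by have /subspace_continuousP := extension_continuous eu; exact.
move=> A HA; have : nbhs x (event 0 @^-1` [set z | carrier (slab T) z -> A z]).
  exact: (@event_continuous 0 x _ HA).
by apply: filterS => y; apply; exact: carrier_event.
Qed.

Lemma smooth_trace T u : 0 < T -> smooth (slab T) u -> smooth whole (trace T u).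
Proof.
move=> T0 su s; rewrite pderiv_trace//; set v := pderiv _ _.
have sv : smooth (slab T) v.
  by rewrite /v; elim: (map _ _) (u) su => //= i r ih w sw; apply: ih; exact: smooth_partial.
split=> [i x _|].
  have [] // := @is_derive_trace T v i x T0 (smooth_regular sv).
  by have [] := smooth_regular (smooth_partial (space_coord i) sv).
exists (trace T v); split=> //; apply: continuous_subspaceT.
by apply: trace_continuous => //; have [] := smooth_regular sv.
Qed.

Lemma pderivX_trace T u s x : 0 < T -> smooth (slab T) u ->
  pderivX whole s (trace T u) x = pderivX (slab T) (map space_coord s) u (event 0 x).
Proof.
move=> T0 su; have [_ eu] := smooth_trace T0 su s.
by rewrite /pderivX extension_inner// pderiv_trace.
Qed.

Lemma bigO_trace T (u : R -> 'rV[R]_(1 + d) -> R) K s b : 0 < T ->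
  smooth_net (slab T) u ->
  bigO_on (event 0 @` K) b (fun e => pderivX (slab T) (map space_coord s) (u e)) ->
  bigO_on K b (fun e => pderivX whole s (trace T (u e))).
Proof.
move=> T0 su [C HC]; exists C; near=> e => x Kx.
have e01 : 0 < e <= 1 by near: e; exact: near0_itv.
rewrite pderivX_trace//; last exact: su.
have : (event 0 @` K) (event 0 x) by exists x.
by move: (event 0 x); near: e.
Unshelve. all: by end_near. Qed.

Lemma compact_event K : compact K -> compact (event 0 @` K).
Proof.
by apply: continuous_compact; apply: continuous_subspaceT; exact: event_continuous.
Qed.

Lemma event_sub T K : 0 < T -> event 0 @` K `<=` carrier (slab T).
Proof. by move=> T0 _ [x _ <-]; exact: carrier_event. Qed.

Lemma mnet_trace_subproof T (T0 : 0 < T) (u : mnet (slab T)) :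
  (fun e => trace T (u e)) \in moderate_net whole.
Proof.
have [su mu] := mnetP u; apply/asboolP; split.
  by move=> e e01; apply: smooth_trace => //; exact: su.
move=> K s cK _.
have [b hb] := mu _ (map space_coord s) (compact_event cK) (@event_sub T K T0).
by exists b; exact: bigO_trace.
Qed.

Definition mnet_trace T (T0 : 0 < T) (u : mnet (slab T)) : mnet whole :=
  MNet (mnet_trace_subproof T0 u).

Definition Gtrace T (T0 : 0 < T) (U : colombeau (slab T)) : colombeau whole :=
  Gclass (mnet_trace T0 (repr U)).

Lemma Gtrace_class T (T0 : 0 < T) (u : mnet (slab T)) :
  Gtrace T0 (Gclass u) = Gclass (mnet_trace T0 u).
Proof.
apply/GclassP => K s a cK _ a0.
have su := mnet_smooth u; have sU := mnet_smooth (repr (Gclass u)).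
have h := repr_Gclass u (map space_coord s) (compact_event cK) (@event_sub T K T0) a0.
have := bigO_trace T0 (smooth_netB sU su) h.
apply: bigO_on_congr => e x e01 Kx.
have sue := su e e01; have sUe := sU e e01.
have Xx : carrier whole x by rewrite carrier_whole.
rewrite (pderivX_trace s x T0 (smoothB sUe sue)).
rewrite (pderivXB (map space_coord s) sUe sue (@carrier_event T x T0)).
rewrite (pderivXB s (smooth_trace T0 sUe) (smooth_trace T0 sue) Xx).
by rewrite (pderivX_trace s x T0 sUe) (pderivX_trace s x T0 sue).
Qed.

Definition Gdt T (U : colombeau (slab T)) := Gpartial time_coord U.

Definition Glaplacian T (U : colombeau (slab T)) :=
  \sum_(i < d) Gpartial (space_coord i) (Gpartial (space_coord i) U).

(* The norm of 'rV[R]_d in the library is the sup norm. *)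
Definition enorm x := Num.sqrt (\sum_(i < d) x ord0 i ^+ 2).

Definition cone T (r : R) : set 'rV[R]_(1 + d) :=
  [set z | carrier (slab T) z /\ enorm (rsubmx z) <= z ord0 time_coord + r].

End Slab.

(* Main.v *)
Require Import Defs.
From HB Require Import structures.
From mathcomp Require Import all_boot all_order all_algebra ring_quotient.
From mathcomp Require Import all_classical all_reals.
From mathcomp Require Import ereal topology normedtype derive realfun exp.
From mathcomp Require Import measure lebesgue_measure lebesgue_integral ftc trigo.
From mathcomp Require Import ring lra.
Import numFieldNormedType.Exports.
Set Implicit Arguments.
Unset Strict Implicit.
Unset Printing Implicit Defensive.
Import Order.TTheory GRing.Theory Num.Theory.
Local Open Scope classical_set_scope.
Local Open Scope ring_scope.

(* For d <= 3 both Duhamel's operator, which inverts the d'Alembertian with zero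
   data, and Kirchhoff's formula are means over the backward light cone. They
   rest on one integration by parts along the rays of the cone; the radial part
   of the Laplacian is handled by a divergence in the angles.

   Existence: since c_e = O(e^b) with b > 0, consecutive Picard iterates differ
   by O(e^(b k)) with all their derivatives, so the equation is solved only up
   to O(e^(b k)) by the k-th one. Letting k grow slowly as e -> 0 gives a bounded
   net with a negligible defect.

   Uniqueness and support: if two bounded nets have negligible defects and
   traces with negligible difference on the base of a truncated cone, then
   their difference is bounded there, and Kirchhoff's formula improves
   O(e^a) to O(e^(a+b)); so it is negligible. Cones covering the slab
   give uniqueness, and comparison with 0 outside the cone of influence gives
   the support. *)

(** * Differential calculus on words of coordinates *)

(** For a fixed e nothing makes the Picard iterates converge up to time T: f is any smooth function,
    with no global bound. Hence no exact solution is sought at fixed e; equality in the algebra,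
    which tolerates a negligible defect, does the work of convergence. The means are integrals over
    a fixed box of three angles, one for the time along the ray and two for the sphere. Rays depend
    smoothly on these angles and linearly on the vertex, also at t = 0 and at the poles. Derivatives
    therefore pass under the integral everywhere, and a derivative of a mean is a sum of means of
    the same kind. Kirchhoff's formula contains first derivatives of the data. This loss is
    harmless, since derivatives commute with the d'Alembertian and all of them are estimated
    together. The dimension enters through the unit sphere of R^3: for d <= 3 a function of d
    coordinates is averaged over it, the coordinates beyond the d-th being dropped. *)

Section Calculus.
Context {R : realType}.

Lemma is_deriveDf (V : normedModType R) (f g : V -> R) (x v : V) (a b : R) :
  is_derive x v f a -> is_derive x v g b -> is_derive x v (fun y => f y + g y) (a + b).
Proof. exact: is_deriveD. Qed.

Lemma is_deriveBf (V : normedModType R) (f g : V -> R) (x v : V) (a b : R) :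
  is_derive x v f a -> is_derive x v g b -> is_derive x v (fun y => f y - g y) (a - b).
Proof. exact: is_deriveB. Qed.

Lemma is_deriveMf (V : normedModType R) (f g : V -> R) (x v : V) (a b : R) :
  is_derive x v f a -> is_derive x v g b ->
  is_derive x v (fun y => f y * g y) (a * g x + f x * b).
Proof.
move=> da db; have := is_deriveM da db.
by rewrite addrC [g x *: a]mulrC.
Qed.

Lemma is_deriveZf (V : normedModType R) (f : V -> R) (x v : V) (k a : R) :
  is_derive x v f a -> is_derive x v (fun y => k * f y) (k * a).
Proof. exact: is_deriveZ. Qed.

Lemma is_derive_ext (V : normedModType R) (f g : V -> R) (x v : V) (a b : R) :
  f =1 g -> a = b -> is_derive x v f a -> is_derive x v g b.
Proof. by move=> /funext -> ->. Qed.

Lemma is_derive_translate (f : R -> R) (x y l : R) :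
  is_derive (y + x) 1 f l -> is_derive y 1 (fun r => f (r + x)) l.
Proof.
have e : (fun k : R => k^-1 *: ((f \o shift (y + x)) (k *: (1 : R)) - f (y + x))) =
    (fun k : R => k^-1 *: (((fun r => f (r + x)) \o shift y) (k *: (1 : R)) - f (y + x))).
  by apply/funext => k /=; rewrite addrA.
move=> [df ef]; apply: DeriveDef; first by move: df; rewrite /derivable e.
by move: ef; rewrite /derive e.
Qed.

(** Differentiability is asked only for |s| <= |h|, so that the lemma applies along segments inside
    an open region; [MVT_sym] asks it on the whole line. *)
Lemma MVT_local (f df : R -> R) h :
  (forall s : R, `|s| <= `|h| -> is_derive s 1 f (df s)) ->
  exists2 c, `|c| <= `|h| & f h - f 0 = df c * h.
Proof.
move=> fdf.
have cf (a b : R) : `|a| <= `|h| -> `|b| <= `|h| ->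
    {within `[a, b], continuous f}.
  move=> ah bh; apply: derivable_within_continuous => s.
  rewrite in_itv/= => /andP[as_ sb].
  have /fdf[] // : `|s| <= `|h|.
  move: ah bh; rewrite !ler_norml => /andP[ah _] /andP[_ bh].
  by rewrite (le_trans ah)// (le_trans sb).
have h00 : `|0 : R| <= `|h| by rewrite normr0.
have [h0|/ltW h0] := leP 0 h.
  have dh s : s \in `]0, h[ -> is_derive s 1 f (df s).
    by rewrite in_itv/= => /andP[s0 sh]; apply: fdf; rewrite !gtr0_norm ?ltW// (lt_trans s0).
  have [c + ->] := MVT_segment h0 dh (cf 0 h h00 (lexx _)).
  rewrite in_itv/= => /andP[c0 ch]; exists c; last by rewrite subr0.
  by rewrite !ger0_norm.
have dh s : s \in `]h, 0[ -> is_derive s 1 f (df s).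
  rewrite in_itv/= => /andP[hs s0]; apply: fdf; rewrite !ltr0_norm ?lerN2 ?ltW//.
  exact: lt_trans s0.
have [c + e] := MVT_segment h0 dh (cf h 0 (lexx _) h00).
rewrite in_itv/= => /andP[hc c0]; exists c; first by rewrite !ler0_norm ?lerN2.
by rewrite -opprB e sub0r mulrN opprK.
Qed.

Lemma cvg_sumr (T : Type) (F : set_system T) (FF : Filter F) (I : Type)
    (r : seq I) (f : I -> T -> R) (l : I -> R) :
  (forall i, f i @ F --> l i) -> (fun x => \sum_(i <- r) f i x) @ F --> \sum_(i <- r) l i.
Proof.
move=> fl; elim: r => [|i r ih].
  rewrite big_nil (_ : (fun _ => _) = (fun=> 0)); first exact: cvg_cst.
  by apply/funext => x; rewrite big_nil.
rewrite big_cons (_ : (fun _ => _) = (fun x => f i x + \sum_(j <- r) f j x)).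
  by apply: cvgD.
by apply/funext => x; rewrite big_cons.
Qed.

Lemma derive_lineE (V : normedModType R) (u : V -> R) (z v : V) (s : R) :
  (fun k : R => k^-1 *: ((u \o shift (s *: v + z)) (k *: v) - u (s *: v + z))) =
  (fun k : R => k^-1 *: (((fun r : R => u (r *: v + z)) \o shift s) (k *: (1 : R))
    - (fun r : R => u (r *: v + z)) s)).
Proof. by apply/funext => k /=; rewrite [_%:A]mulr1 scalerDl -addrA. Qed.

Lemma is_derive_along (V : normedModType R) (u : V -> R) (z v : V) (s l : R) :
  is_derive (s *: v + z) v u l <-> is_derive s 1 (fun r : R => u (r *: v + z)) l.
Proof.
split=> -[du el]; apply: DeriveDef.
- by move: du; rewrite /derivable derive_lineE.
- by move: el; rewrite /derive derive_lineE.
- by move: du; rewrite /derivable -derive_lineE.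
- by move: el; rewrite /derive -derive_lineE.
Qed.

Lemma is_derive_along0 (V : normedModType R) (u : V -> R) (z v : V) (l : R) :
  is_derive z v u l <-> is_derive (0 : R) 1 (fun r : R => u (r *: v + z)) l.
Proof. by rewrite -is_derive_along scale0r add0r. Qed.

Context {n : nat}.
Implicit Types (X : region R n) (u v : 'rV[R]_n -> R) (x y z : 'rV[R]_n).

Lemma partialE i u x : partial i u x = 'D_(delta_mx 0 i) u x.
Proof. by []. Qed.

Lemma is_derive_partial X u i z s : regular X u ->
  inner X (s *: delta_mx 0 i + z) ->
  is_derive s 1 (fun r => u (r *: delta_mx 0 i + z))
    (partial i u (s *: delta_mx 0 i + z)).
Proof.
move=> [du _] Xz; apply: (iffLR (is_derive_along u _ _ _ _)).
exact: (@derivableP _ _ _ u (s *: delta_mx 0 i + z) (delta_mx 0 i) (du _ _ Xz)).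
Qed.

(** Continuity comes from [extendable]: the existence of partial derivatives alone would not give
    it. *)
Lemma regular_continuous X u x : regular X u -> inner X x -> {for x, continuous u}.
Proof.
move=> [_ [g [/subspace_continuousP cg gu]]] Xx.
have Xn : nbhs x (inner X) by apply: open_nbhs_nbhs; split=> //; exact: inner_open.
suff : u @ nbhs x --> g x by rewrite -[X in _ --> X -> _]/(g x) gu.
have : g @ within (carrier X) (nbhs x) --> g x by apply: cg; exact: inner_carrier.
move=> h A /h; rewrite /nbhs/= /within/= => hA.
suff : \forall y \near x, A (u y) by [].
near=> y; have Xy : inner X y by near: y.
rewrite -gu//.
by have : carrier X y -> A (g y) by [near: y; exact: hA]; apply; exact: inner_carrier.
Unshelve. all: by end_near. Qed.

Lemma smooth_continuous X u x : smooth X u -> inner X x -> {for x, continuous u}.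
Proof. by move=> su; apply: regular_continuous; exact: smooth_regular. Qed.

Lemma ball_rVP x y e : 0 < e ->
  ball x e y <-> forall i, `|x ord0 i - y ord0 i| < e.
Proof.
move=> e0; split=> [[_ h] i|h]; first exact: (h ord0 i).
by split=> // i j; rewrite (ord1 i); exact: h.
Qed.

(* A segment from x to y is followed one coordinate at a time. *)
Lemma slope_form X u x : smooth X u -> inner X x ->
  exists m : 'rV[R]_n -> 'I_n -> R,
    (forall i, m^~ i @ nbhs x --> partial i u x) /\
    \forall y \near x, u y - u x = \sum_i (y ord0 i - x ord0 i) * m y i.
Proof.
move=> su Xx.
have /nbhs_ballP[e /= e0 He] : nbhs x (inner X).
  by apply: open_nbhs_nbhs; split=> //; exact: inner_open.
pose hyb (y : 'rV[R]_n) k := \row_i (if (i < k)%N then y ord0 i else x ord0 i).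
have hybS (y : 'rV[R]_n) (i : 'I_n) : hyb y i.+1 =
    (y ord0 i - x ord0 i) *: delta_mx 0 i + hyb y i.
  apply/rowP => j; rewrite !mxE eqxx/= ltnS leq_eqVlt.
  have [->|ji] := eqVneq j i; first by rewrite eqxx ltnn mulr1 subrK.
  by rewrite mulr0 add0r (_ : (j == i :> nat) = false)//; apply/negbTE.
(* The intermediate point c lies in every ball around x that contains y, so it tends to x with y;
   this gives the continuity of the slopes at x. *)
have hc (y : 'rV[R]_n) (i : 'I_n) : exists c : 'rV[R]_n, ball x e y ->
    u (hyb y i.+1) - u (hyb y i) = (y ord0 i - x ord0 i) * partial i u c /\
    forall r, 0 < r -> ball x r y -> ball x r c.
  have [Hy|nHy] := pselect (ball x e y); last by exists x => /nHy.
  set h := y ord0 i - x ord0 i.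
  have hb r (s : R) : 0 < r -> ball x r y -> `|s| <= `|h| ->
      ball x r (s *: delta_mx 0 i + hyb y i).
    move=> r0 /(ball_rVP _ _ r0) xy sh; apply/(ball_rVP _ _ r0) => j.
    rewrite !mxE eqxx/=; have [->|ji] := eqVneq j i.
      rewrite ltnn mulr1 opprD addrCA subrr addr0 normrN.
      by rewrite (le_lt_trans sh)// /h distrC.
    by rewrite mulr0 add0r; case: ifP => _; rewrite ?subrr ?normr0.
  have [s sh|c ch] := @MVT_local (fun s => u (s *: delta_mx 0 i + hyb y i))
    (fun s => partial i u (s *: delta_mx 0 i + hyb y i)) h.
    by apply: (is_derive_partial (smooth_regular su)); apply: He; exact: hb.
  rewrite -hybS scale0r add0r => eqc.
  exists (c *: delta_mx 0 i + hyb y i) => _; split; first by rewrite eqc mulrC.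
  by move=> r r0 xy; exact: hb.
have /choice[C HC] : forall yi : 'rV[R]_n * 'I_n, exists c : 'rV[R]_n, ball x e yi.1 ->
    u (hyb yi.1 yi.2.+1) - u (hyb yi.1 yi.2) =
      (yi.1 ord0 yi.2 - x ord0 yi.2) * partial yi.2 u c /\
    forall r, 0 < r -> ball x r yi.1 -> ball x r c.
  by move=> [y i]; exact: hc.
exists (fun y i => partial i u (C (y, i))); split=> [i|].
  have cp := smooth_continuous (smooth_partial i su) Xx.
  apply: (@cvg_comp _ _ _ (fun y => C (y, i)) (partial i u) _ (nbhs x)) => //.
  apply/cvg_ballP => r r0; near=> y.
  have [|_] := HC (y, i); first by near: y; exact: nbhsx_ballx.
  by apply => //=; near: y; exact: nbhsx_ballx.
near=> y.
have Hy : ball x e y by near: y; exact: nbhsx_ballx.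
have -> : \sum_i (y ord0 i - x ord0 i) * partial i u (C (y, i)) =
    \sum_(i < n) (u (hyb y i.+1) - u (hyb y i)).
  by apply: eq_bigr => i _; have [<-] := HC (y, i) Hy.
rewrite -(big_mkord predT (fun i => u (hyb y i.+1) - u (hyb y i))).
rewrite telescope_sumr//; congr (u _ - u _); apply/rowP => j; rewrite !mxE.
  by rewrite ltn_ord.
by rewrite ltn0.
Unshelve. all: by end_near. Qed.

(** [slope_form] takes the place of total differentiability: composed with q and divided by h, its
    identity tends term by term to the chain rule. *)
Lemma is_derive_curve X u (q : R -> 'rV[R]_n) (q' : 'I_n -> R) s :
  smooth X u -> inner X (q s) ->
  (forall i, is_derive s 1 (fun r => q r ord0 i) (q' i)) ->
  is_derive s 1 (u \o q) (\sum_i q' i * partial i u (q s)).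
Proof.
move=> su Xq dq; have [m [mc mE]] := slope_form su Xq.
have cq : q @ nbhs s --> q s.
  apply/cvg_ballP => e e0.
  suff : \forall r \near s, forall i, `|q s ord0 i - q r ord0 i| < e.
    by apply: filterS => r h; apply/ball_rVP.
  apply: (@filter_forall _ _ (fun i r => is_true (`|q s ord0 i - q r ord0 i| < e)) (nbhs s)) => i.
  have ci : {for s, continuous (fun r => q r ord0 i)}.
    by apply: differentiable_continuous; apply/derivable1_diffP; have [] := dq i.
  by have /cvgrPdist_lt := ci; apply.
have cs : (fun h : R => h + s) @ (0 : R)^' --> s.
  apply: (@cvg_trans _ ((fun h : R => h + s) @ nbhs (0 : R))).
    by apply: cvg_app; exact: cvg_within.
  suff : (fun h : R => h + s) @ nbhs (0 : R) --> 0 + s by rewrite add0r.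
  by apply: cvgD; [exact: cvg_id|exact: cvg_cst].
suff H : (fun h : R => h^-1 *: (((u \o q) \o shift s) (h *: (1 : R)) - (u \o q) s))
    @ (0 : R)^' --> \sum_i q' i * partial i u (q s).
  by apply: DeriveDef; [apply/cvg_ex; eexists; exact: H|exact: cvg_lim].
apply: (@cvg_trans _ ((fun h : R => \sum_i
    (h^-1 *: (q (h + s) ord0 i - q s ord0 i)) * m (q (h + s)) i) @ (0 : R)^')).
  apply: near_eq_cvg.
  have := @cvg_comp _ _ _ _ q _ _ _ cs cq _ mE.
  rewrite /= !near_simpl => -[]; rewrite /= => e e0 He.
  exists e => // h he h0; rewrite /= (_ : h *: (1 : R) = h); last by rewrite [_%:A]mulr1.
  have := He h he h0 => /= ->; rewrite scaler_sumr; apply: eq_bigr => i _.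
  by rewrite -scalerAl.
apply: cvg_sumr => i; apply: cvgM.
  have [dqi eqi] := dq i; rewrite -eqi.
  have := dqi; rewrite /derivable => /cvg_ex[l hl].
  have -> : 'D_1 (fun r => q r ord0 i) s = l by exact: cvg_lim.
  apply: cvg_trans hl; apply: near_eq_cvg; near=> h => /=.
  by rewrite (_ : h *: (1 : R) = h)//; rewrite [_%:A]mulr1.
by apply: cvg_comp (mc i); apply: cvg_comp cs cq.
Unshelve. all: by end_near. Qed.

End Calculus.

(* Unifying two derivatives by unfolding them to limits would not terminate in
   practice. *)
Opaque partial.

(** * Symmetry of mixed derivatives *)

Section Words.
Context {R : realType} {n : nat}.
Implicit Types (X : region R n) (u v : 'rV[R]_n -> R) (x y z : 'rV[R]_n).

(* The second difference of u is h^2 times a mixed derivative at a nearby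
   point. *)
Lemma second_difference X u x i j (e h : R) : smooth X u ->
  ball x e `<=` inner X -> 0 < h -> h + h < e ->
  exists2 c, ball x e c & u (h *: delta_mx 0 i + (h *: delta_mx 0 j + x)) -
    u (h *: delta_mx 0 i + x) - u (h *: delta_mx 0 j + x) + u x =
    h * h * partial j (partial i u) c.
Proof.
move=> su He h0 he; have e0 : 0 < e by rewrite (lt_trans _ he)// addr_gt0.
have hb (a b : R) (k l : 'I_n) : `|a| <= `|h| -> `|b| <= `|h| ->
    ball x e (a *: delta_mx 0 k + (b *: delta_mx 0 l + x)).
  rewrite (gtr0_norm h0) => ah bh; apply/(ball_rVP _ _ e0) => m.
  rewrite !mxE eqxx/=; apply: le_lt_trans he.
  rewrite distrC addrA addrK (le_trans (ler_normD _ _))// lerD//.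
    by case: (_ == _); rewrite ?mulr1 ?mulr0 ?normr0// ltW.
  by case: (_ == _); rewrite ?mulr1 ?mulr0 ?normr0// ltW.
have hh : `|h| <= `|h| by [].
have h00 : `|0 : R| <= `|h| by rewrite normr0.
have dl (w : 'rV[R]_n -> R) (k l : 'I_n) (a b : R) : smooth X w ->
    `|a| <= `|h| -> `|b| <= `|h| ->
    is_derive b 1 (fun r => w (r *: delta_mx 0 k + (a *: delta_mx 0 l + x)))
      (partial k w (b *: delta_mx 0 k + (a *: delta_mx 0 l + x))).
  move=> sw ah bh; apply: (is_derive_partial (smooth_regular sw)).
  by apply: He; exact: hb.
have [s sh|c ch] := @MVT_local R
    (fun r => u (r *: delta_mx 0 i + (h *: delta_mx 0 j + x)) -
              u (r *: delta_mx 0 i + (0 *: delta_mx 0 j + x)))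
    (fun r => partial i u (r *: delta_mx 0 i + (h *: delta_mx 0 j + x)) -
              partial i u (r *: delta_mx 0 i + (0 *: delta_mx 0 j + x))) h.
  by apply: is_deriveB; exact: dl.
rewrite !scale0r !add0r => e1.
have [s sh|c' c'h] := @MVT_local R
    (fun r => partial i u (r *: delta_mx 0 j + (c *: delta_mx 0 i + x)))
    (fun r => partial j (partial i u) (r *: delta_mx 0 j + (c *: delta_mx 0 i + x))) h.
  by apply: dl => //; exact: smooth_partial.
rewrite scale0r add0r addrCA => e2.
exists (c' *: delta_mx 0 j + (c *: delta_mx 0 i + x)); first exact: hb.
by rewrite -mulrA [h * partial _ _ _]mulrC -e2 mulrC -e1; ring.
Qed.

(** The second difference is symmetric in i and j, so the two mixed derivatives take a common value,
    at two points c and c' arbitrarily near x; their continuity at x concludes. *)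
Lemma partialC X u x i j : smooth X u -> inner X x ->
  partial i (partial j u) x = partial j (partial i u) x.
Proof.
move=> su Xx.
have /nbhs_ballP[e /= e0 He] : nbhs x (inner X).
  by apply: open_nbhs_nbhs; split=> //; exact: inner_open.
have sP : smooth X (partial i (partial j u)) by do 2 apply: smooth_partial.
have sQ : smooth X (partial j (partial i u)) by do 2 apply: smooth_partial.
(* P and Q hide the mixed derivatives behind variables, so that unification cannot unfold them. *)
have [P PE] := ex_intro (eq^~ (partial i (partial j u))) _ erefl.
have [Q QE] := ex_intro (eq^~ (partial j (partial i u))) _ erefl.
have cP : {for x, continuous P} by rewrite PE; exact: (smooth_continuous sP).
have cQ : {for x, continuous Q} by rewrite QE; exact: (smooth_continuous sQ).
rewrite -PE -QE.
apply/eqP; rewrite -subr_eq0 -normr_le0.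
apply/ler_addgt0Pr.
move=> eps eps0.
rewrite add0r.
have e20 : 0 < eps / 2 by rewrite divr_gt0.
have /nbhs_ballP[r1 /= r10 Hr1] : \forall y \near x, `|P x - P y| < eps / 2.
  by move/cvgrPdist_lt : cP; apply.
have /nbhs_ballP[r2 /= r20 Hr2] : \forall y \near x, `|Q x - Q y| < eps / 2.
  by move/cvgrPdist_lt : cQ; apply.
pose m := Num.min e (Num.min r1 r2).
have m0 : 0 < m by rewrite !lt_min e0 r10.
have me : ball x m `<=` ball x e by apply: le_ball; rewrite !ge_min lexx.
have mr1 : ball x m `<=` ball x r1 by apply: le_ball; rewrite !ge_min lexx !orbT.
have mr2 : ball x m `<=` ball x r2 by apply: le_ball; rewrite !ge_min lexx !orbT.
have m40 : 0 < m / 4 by rewrite divr_gt0.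
have hm : m / 4 + m / 4 < m by lra.
have [c /mr2/Hr2 /= cx e1] := second_difference i j su (subset_trans me He) m40 hm.
have [c' /mr1/Hr1 /= cx' e2] := second_difference j i su (subset_trans me He) m40 hm.
rewrite -PE -QE in e1 e2.
have PQ : P c' = Q c.
  apply: (@mulfI _ (m / 4 * (m / 4))); first by rewrite gt_eqF// mulr_gt0.
  refine (etrans (esym e2) (etrans _ e1)).
  by rewrite (addrCA (m / 4 *: delta_mx 0 j)); congr (_ + _); exact: addrAC.
have -> : P x - Q x = (P x - P c') - (Q x - Q c).
  by rewrite PQ opprB addrA subrK.
rewrite (le_trans (ler_normB _ _))//.
by rewrite [leRHS]splitr lerD// ltW.
Qed.

Lemma smooth_pderiv X u s : smooth X u -> smooth X (pderiv s u).
Proof. by elim: s u => //= i s ih u su; apply: ih; exact: smooth_partial. Qed.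

Lemma pderiv_cat s t u : pderiv (s ++ t) u = pderiv t (pderiv s u).
Proof. by elim: s u => //= i s ih u. Qed.

Lemma pderiv_partial X s i u x : smooth X u -> inner X x ->
  pderiv s (partial i u) x = partial i (pderiv s u) x.
Proof.
elim: s u x => //= j s ih u x su Xx.
have <- := ih (partial j u) x (smooth_partial j su) Xx.
by apply: (pderiv_congr _ _ Xx) => y Xy; exact: (partialC _ _ su Xy).
Qed.

(** This makes words interchangeable with multi-indices; [word_bound] uses it to bring the time
    derivatives to the front. *)
Lemma pderiv_perm X s t u x : perm_eq s t -> smooth X u -> inner X x ->
  pderiv s u x = pderiv t u x.
Proof.
elim: s t u => [|i s ih] t u st su Xx.
  by move: st; rewrite perm_sym => /perm_nilP ->.
have /path.splitPr ti : i \in t by rewrite -(perm_mem st) mem_head.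
case: ti st => t1 t2 st; rewrite pderiv_cat/=.
rewrite (ih (t1 ++ t2))//; last exact: smooth_partial.
  rewrite pderiv_cat; apply: (@pderiv_congr _ _ X) => // y Xy.
  exact: (pderiv_partial _ _ su Xy).
by rewrite -(perm_cons i) (perm_trans st)// -cat_cons -cat1s perm_catCA.
Qed.

Lemma smooth_sum X (I : Type) (r : seq I) (F : I -> 'rV[R]_n -> R) :
  (forall i, smooth X (F i)) -> smooth X (fun x => \sum_(i <- r) F i x).
Proof.
move=> sF; elim: r => [|i r ih].
  rewrite (_ : (fun _ => _) = (fun=> 0)); first exact: smooth_cst.
  by apply/funext => x; rewrite big_nil.
rewrite (_ : (fun _ => _) = (fun x => F i x + \sum_(j <- r) F j x)).
  exact: smoothD.
by apply/funext => x; rewrite big_cons.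
Qed.

Lemma pderivB X s u v x : smooth X u -> smooth X v -> inner X x ->
  pderiv s (fun y => u y - v y) x = pderiv s u x - pderiv s v x.
Proof.
move=> su sv Xx; have -> : (fun y => u y - v y) = (fun y => u y + (-1) * v y).
  by apply/funext => y; rewrite mulN1r.
rewrite (pderivD _ _ _ Xx)//; last exact: smoothZ.
by rewrite (pderivZ _ _ sv Xx) mulN1r.
Qed.

Lemma pderiv_cst (s : seq 'I_n) (c : R) : s != [::] ->
  pderiv s (fun=> c) = fun=> 0.
Proof.
case: s => //= i s _; rewrite partial_cst; elim: s => //= j s ih.
by rewrite partial_cst.
Qed.

Lemma pderiv_sum X (I : Type) (r : seq I) (F : I -> 'rV[R]_n -> R) s x :
  (forall i, smooth X (F i)) -> inner X x ->
  pderiv s (fun x => \sum_(i <- r) F i x) x = \sum_(i <- r) pderiv s (F i) x.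
Proof.
move=> sF Xx; elim: r => [|i r ih].
  rewrite big_nil (_ : (fun _ => _) = (fun=> 0)).
    by elim: s => //= j s; rewrite partial_cst.
  by apply/funext => y; rewrite big_nil.
rewrite big_cons -ih -(pderivD _ _ _ Xx)//; last exact: smooth_sum.
by congr (pderiv s _ x); apply/funext => y; rewrite big_cons.
Qed.

End Words.

(** * The d'Alembertian *)

Section DAlembert.
Context {R : realType} {d : nat}.
Implicit Types (X : region R (1 + d)) (u v : 'rV[R]_(1 + d) -> R).

Local Notation tc := (@time_coord d).
Local Notation sc := (@space_coord d).

Definition lap u (z : 'rV[R]_(1 + d)) : R :=
  \sum_(i < d) partial (sc i) (partial (sc i) u) z.

Definition dal u (z : 'rV[R]_(1 + d)) : R :=
  partial tc (partial tc u) z - lap u z.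

Lemma smooth_lap X u : smooth X u -> smooth X (lap u).
Proof. by move=> su; apply: smooth_sum => i; do 2 apply: smooth_partial. Qed.

Lemma smooth_dal X u : smooth X u -> smooth X (dal u).
Proof.
move=> su; apply: smoothB; last exact: smooth_lap.
by do 2 apply: smooth_partial.
Qed.

(** The coefficients are constant, so symmetry of mixed derivatives is enough. An estimate of order
    zero for the wave equation thus applies to every derivative of the solution. *)
Lemma pderiv_dal X s u z : smooth X u -> inner X z ->
  pderiv s (dal u) z = dal (pderiv s u) z.
Proof.
have pp (i : 'I_(1 + d)) : smooth X u -> inner X z ->
    pderiv s (partial i (partial i u)) z = partial i (partial i (pderiv s u)) z.
  move=> su Xz; rewrite (pderiv_partial _ _ (smooth_partial i su) Xz).
  by apply: (@partial_congr _ _ X) => // y Xy; exact: pderiv_partial su Xy.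
move=> su Xz; rewrite [LHS](pderivB _ _ _ Xz); last 2 first.
- by do 2 apply: smooth_partial.
- exact: smooth_lap.
rewrite pp// [X in _ - X](pderiv_sum _ _ _ Xz); last first.
  by move=> i; do 2 apply: smooth_partial.
by congr (_ - _); apply: eq_bigr => i _; rewrite pp.
Qed.

Lemma dalB X u v z : smooth X u -> smooth X v -> inner X z ->
  dal (fun y => u y - v y) z = dal u z - dal v z.
Proof.
move=> su sv Xz.
have pp i : partial i (partial i (fun y => u y - v y)) z =
    partial i (partial i u) z - partial i (partial i v) z.
  exact: (pderivB [:: i; i] su sv Xz).
have e : lap (fun y => u y - v y) z = lap u z - lap v z.
  by apply: etrans (sumrB _ _ _ _); apply: eq_bigr => i _; exact: pp.
apply: (etrans (congr2 (fun a b => a - b) (pp tc) e)).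
by rewrite !opprD !opprK addrACA.
Qed.

End DAlembert.

(** * Iterated integrals of continuous functions *)

Section Integral1.
Context {R : realType}.
Implicit Types (h g H : R -> R) (b M x : R).

Lemma ex_primitive h : continuous h ->
  exists H, forall x, 0 <= x -> is_derive x 1 H (h x).
Proof.
(* The lower limit -1 leaves 0 in the interior, so that the derivative at 0 is two-sided. *)
move=> ch; exists (fun x => \int[lebesgue_measure]_(t in `[(-1 : R), x]) h t) => x x0.
have ih : lebesgue_measure.-integrable `[(-1 : R), x + 1] (EFin \o h).
  apply: continuous_compact_integrable; first exact: segment_compact.
  exact: continuous_subspaceT.
have [] := @continuous_FTC1_closed R h (-1) x (x + 1) _ ih _ (ch x).
- by rewrite ltrDl.
- by rewrite (lt_le_trans _ x0)// ltrN10.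
move=> dF eF; exact: (DeriveDef dF (etrans (esym (derive1E _ _)) eF)).
Qed.

(** A chosen primitive stands for the integral: only its derivative on x >= 0 is used, and bounds
    and linearity follow from the mean value theorem, with no measure theory. *)
Definition primitive h : R -> R :=
  get [set H | forall x, 0 <= x -> is_derive x 1 H (h x)].

Definition integ b h : R := primitive h b - primitive h 0.

Lemma is_derive_primitive h x : continuous h -> 0 <= x ->
  is_derive x 1 (primitive h) (h x).
Proof.
move=> /ex_primitive eH x0.
have /= := @getPex _ [set H | forall x, 0 <= x -> is_derive x 1 H (h x)] eH.
by move=> /(_ x x0).
Qed.

Lemma integ_bound b h M : 0 <= b -> continuous h ->
  (forall x, 0 <= x <= b -> `|h x| <= M) -> `|integ b h| <= b * M.
Proof.
move=> b0 ch hM; rewrite /integ.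
have [x||c cb ->] := @MVT_segment R (primitive h) h 0 b b0.
- by rewrite in_itv/= => /andP[x0 _]; apply: is_derive_primitive => //; exact: ltW.
- apply: derivable_within_continuous => x; rewrite in_itv/= => /andP[x0 _].
  by have [] := is_derive_primitive ch x0.
by rewrite subr0 normrM mulrC (ger0_norm b0) ler_wpM2l// hM// -[_ <= _ <= _]/(c \in `[0, b]).
Qed.

(** Two primitives differ by a constant. Linearity of [integ] and every integration by parts below
    come from exhibiting a suitable H. *)
Lemma FTC_integ b h H : 0 <= b -> continuous h ->
  (forall x, 0 <= x -> is_derive x 1 H (h x)) -> integ b h = H b - H 0.
Proof.
move=> b0 ch dH; rewrite /integ.
have dB x : 0 <= x ->
    is_derive x 1 (fun x => H x - primitive h x) (h x - h x).
  by move=> x0; exact: is_deriveBf (dH x x0) (is_derive_primitive ch x0).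
have [x||c cb] := @MVT_segment R (fun x => H x - primitive h x) (fun x => h x - h x) 0 b b0.
- by rewrite in_itv/= => /andP[x0 _]; apply: dB; exact: ltW.
- apply: derivable_within_continuous => x; rewrite in_itv/= => /andP[x0 _].
  by have [] := dB x x0.
by rewrite subrr mul0r; move: (H b) (H 0) (primitive h b) (primitive h 0) => *; lra.
Qed.

Lemma integD b h g : 0 <= b -> continuous h -> continuous g ->
  integ b (fun x => h x + g x) = integ b h + integ b g.
Proof.
move=> b0 ch cg.
have cD : continuous (fun x => h x + g x) by move=> x; apply: cvgD; [exact: ch|exact: cg].
have dP x : 0 <= x ->
    is_derive x 1 (fun x => primitive h x + primitive g x) (h x + g x).
  by move=> x0; exact: is_deriveDf (is_derive_primitive ch x0) (is_derive_primitive cg x0).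
by rewrite (FTC_integ b0 cD dP) /integ opprD addrACA.
Qed.

Lemma integZ b k h : 0 <= b -> continuous h ->
  integ b (fun x => k * h x) = k * integ b h.
Proof.
move=> b0 ch.
have cZ : continuous (fun x => k * h x).
  by move=> x; apply: cvgM; [exact: cvg_cst|exact: ch].
have dP x : 0 <= x -> is_derive x 1 (fun x => k * primitive h x) (k * h x).
  by move=> x0; exact: is_deriveZf (is_derive_primitive ch x0).
by rewrite (FTC_integ b0 cZ dP) /integ mulrBr.
Qed.

Lemma integB b h g : 0 <= b -> continuous h -> continuous g ->
  integ b (fun x => h x - g x) = integ b h - integ b g.
Proof.
move=> b0 ch cg; have -> : (fun x => h x - g x) = (fun x => h x + (-1) * g x).
  by apply/funext => x; rewrite mulN1r.
rewrite integD ?integZ ?mulN1r//.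
by move=> x; apply: cvgM; [exact: cvg_cst|exact: cg].
Qed.

(** The tube lemma: compactness of the segment makes continuity at the points (x, s) uniform in
    s. *)
Lemma uniform_near_segment (T : topologicalType) (h : T -> R -> R) b (x : T) (e : R) :
  continuous (fun p : T * R => h p.1 p.2) -> 0 < e ->
  \forall y \near x, forall s, 0 <= s <= b -> `|h x s - h y s| < e.
Proof.
move=> ch e0.
have /compact_near_coveringP : compact `[0, b] by exact: segment_compact.
move=> /(_ T (nbhs x) (fun y s => is_true (`|h x s - h y s| < e)) _) H.
suff : \forall y \near x, `[0, b] `<=` (fun s => is_true (`|h x s - h y s| < e)).
  by apply: filterS => y Hy s sb; apply: Hy; rewrite /= in_itv.
apply: H => s _.
have e20 : 0 < e / 2 by rewrite divr_gt0.
have /cvgrPdist_lt/(_ _ e20) [[A B] [/= nA nB] AB] := ch (x, s).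
exists (B, A) => //= -[s' y] /= [Bs' Ay].
have h1 := AB (y, s') (conj Ay Bs').
have h2 := AB (x, s') (conj (nbhs_singleton nA) Bs').
move: h1 h2 => /=; move: (h x s) (h y s') (h x s') => a c c'; rewrite distrC => h1 h2.
rewrite (_ : c' - c = (c' - a) + (a - c)); last by rewrite addrA subrK.
by rewrite (le_lt_trans (ler_normD _ _))// [ltRHS]splitr distrC ltrD// distrC.
Qed.

Lemma slice_continuous (T U : topologicalType) (h : T -> U -> R) (x : T) :
  continuous (fun p : T * U => h p.1 p.2) -> continuous (h x).
Proof.
move=> ch s.
have e : (fun s => (x, s)) @ nbhs s --> nbhs (x, s).
  by apply: cvg_pair; [exact: cvg_cst|exact: cvg_id].
exact: (@cvg_comp _ _ _ (fun s => (x, s)) (fun p => h p.1 p.2) _ (nbhs (x, s)) _ e (ch (x, s))).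
Qed.

Lemma integ_continuous (T : topologicalType) (h : T -> R -> R) b : 0 <= b ->
  continuous (fun p : T * R => h p.1 p.2) ->
  continuous (fun y : T => integ b (h y)).
Proof.
move=> b0 ch x; apply/cvgrPdist_le => /= e e0.
(* The divisor is b + 1 because b may be 0. *)
have e'0 : 0 < e / (b + 1) by rewrite divr_gt0// ltr_wpDl.
have := @uniform_near_segment _ h b x _ ch e'0.
apply: filterS => y Hy.
rewrite -integB//; [|exact: slice_continuous..].
apply: (@le_trans _ _ (b * (e / (b + 1)))).
  apply: integ_bound => // [s|s /Hy/ltW//].
  by apply: cvgB; exact: slice_continuous.
by rewrite mulrCA ger_pMr// ler_pdivrMr ?ltr_wpDl// mul1r lerDl.
Qed.

(** For each s the difference quotient is a value of h' at a point near x, by the mean value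
    theorem; [uniform_near_segment] makes the error small uniformly in s. *)
Lemma is_derive_integ (h h' : R -> R -> R) b x : 0 <= b ->
  (forall x s, is_derive x 1 (h^~ s) (h' x s)) -> (forall x, continuous (h x)) ->
  continuous (fun p : R * R => h' p.1 p.2) ->
  is_derive x 1 (fun x => integ b (h x)) (integ b (h' x)).
Proof.
move=> b0 dh ch ch'.
have c1 y : continuous (h' y) := @slice_continuous _ _ _ y ch'.
suff H : (fun k : R => k^-1 *: (((fun x => integ b (h x)) \o shift x) (k *: (1 : R))
    - integ b (h x))) @ (0 : R)^' --> integ b (h' x).
  by apply: DeriveDef; [apply/cvg_ex; eexists; exact: H|exact: cvg_lim].
apply/cvgrPdist_le => /= e e0.
have e'0 : 0 < e / (b + 1) by rewrite divr_gt0// ltr_wpDl.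
have /nbhs_ballP[r /= r0 Hr] := @uniform_near_segment _ h' b x _ ch' e'0.
near=> k; have k0 : k != 0 by near: k; exact: nbhs_dnbhs_neq.
have kr : `|k| < r by near: k; exact: dnbhs0_lt.
rewrite (_ : k *: (1 : R) = k); last by rewrite [_%:A]mulr1.
have cB : continuous (fun s => h (k + x) s - h x s).
  by move=> s; apply: cvgB; exact: ch.
have cZ : continuous (fun s => k^-1 * (h (k + x) s - h x s)).
  by move=> s; apply: cvgM; [exact: cvg_cst|exact: cB].
have -> : k^-1 *: (((fun x => integ b (h x)) \o shift x) k - integ b (h x)) =
    integ b (fun s => k^-1 * (h (k + x) s - h x s)).
  by rewrite (integZ _ b0 cB) (integB b0 (ch _) (ch _)).
rewrite -(integB b0 (c1 x) cZ).
apply: (@le_trans _ _ (b * (e / (b + 1)))).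
  apply: integ_bound => // [s|s sb].
    by apply: cvgB; [exact: c1|exact: cZ].
  have [y yk|c ck] := @MVT_local R (fun y => h (y + x) s) (fun y => h' (y + x) s) k.
    by apply: (is_derive_translate (f := h^~ s)); exact: dh.
  rewrite add0r => ->; rewrite mulrCA mulVf// mulr1 ltW// Hr//=.
  by rewrite /ball/= opprD addrCA subrr addr0 normrN (le_lt_trans ck).
by rewrite mulrCA ger_pMr// ler_pdivrMr ?ltr_wpDl// mul1r lerDl.
Unshelve. all: by end_near. Qed.

End Integral1.

Section Continuity.
Context {R : realType}.

Lemma cont_comp (A B C : topologicalType) (f : A -> B) (g : B -> C) :
  continuous f -> continuous g -> continuous (fun x => g (f x)).
Proof. by move=> cf cg x; apply: continuous_comp; [exact: cf|exact: cg]. Qed.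

Lemma cont_pair (A B C : topologicalType) (f : A -> B) (g : A -> C) :
  continuous f -> continuous g -> continuous (fun x => (f x, g x)).
Proof. by move=> cf cg x; apply: cvg_pair; [exact: cf|exact: cg]. Qed.

Lemma cont_fst (A B : topologicalType) : continuous (fun x : A * B => x.1).
Proof. by move=> x; exact: cvg_fst. Qed.

Lemma cont_snd (A B : topologicalType) : continuous (fun x : A * B => x.2).
Proof. by move=> x; exact: cvg_snd. Qed.

Lemma cont_id (A : topologicalType) : continuous (fun x : A => x).
Proof. by move=> x; exact: cvg_id. Qed.

Lemma cont_cst (A B : topologicalType) (b : B) : continuous (fun _ : A => b).
Proof. by move=> x; exact: cvg_cst. Qed.

Lemma contD (A : topologicalType) (f g : A -> R) :
  continuous f -> continuous g -> continuous (fun x => f x + g x).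
Proof. by move=> cf cg x; apply: cvgD; [exact: cf|exact: cg]. Qed.

Lemma contB (A : topologicalType) (f g : A -> R) :
  continuous f -> continuous g -> continuous (fun x => f x - g x).
Proof. by move=> cf cg x; apply: cvgB; [exact: cf|exact: cg]. Qed.

Lemma contN (A : topologicalType) (f : A -> R) :
  continuous f -> continuous (fun x => - f x).
Proof. by move=> cf x; apply: cvgN; exact: cf. Qed.

Lemma contM (A : topologicalType) (f g : A -> R) :
  continuous f -> continuous g -> continuous (fun x => f x * g x).
Proof. by move=> cf cg x; apply: cvgM; [exact: cf|exact: cg]. Qed.

Lemma contX (A : topologicalType) (f : A -> R) k :
  continuous f -> continuous (fun x => f x ^+ k).
Proof.
move=> cf; elim: k => [|k ih]; first exact: cont_cst.
rewrite (_ : (fun _ => _) = (fun x => f x * f x ^+ k)); first exact: contM.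
by apply/funext => x; rewrite exprS.
Qed.

Lemma cont_sum (A : topologicalType) (I : Type) (r : seq I) (f : I -> A -> R) :
  (forall i, continuous (f i)) -> continuous (fun x => \sum_(i <- r) f i x).
Proof. by move=> cf x; apply: cvg_sumr => i; exact: cf. Qed.

Lemma cont_sin (A : topologicalType) (f : A -> R) :
  continuous f -> continuous (fun x => sin (f x)).
Proof. by move=> cf; apply: cont_comp cf _; exact: continuous_sin. Qed.

Lemma cont_cos (A : topologicalType) (f : A -> R) :
  continuous f -> continuous (fun x => cos (f x)).
Proof. by move=> cf; apply: cont_comp cf _; exact: continuous_cos. Qed.

Lemma cont_comp_fst (A B C : topologicalType) (f : A -> B * C) :
  continuous f -> continuous (fun x => (f x).1).
Proof. by move=> cf; apply: cont_comp cf _; exact: cont_fst. Qed.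

Lemma cont_comp_snd (A B C : topologicalType) (f : A -> B * C) :
  continuous f -> continuous (fun x => (f x).2).
Proof. by move=> cf; apply: cont_comp cf _; exact: cont_snd. Qed.

End Continuity.

(** Matching on the body of the function keeps higher-order unification deterministic. A difference
    is also a sum, so its case comes first; goals outside this grammar are left to the caller. *)
Ltac cont :=
  lazymatch goal with
  | |- forall x, continuous_at x ?f =>
    lazymatch f with
    | fun x => x => refine (@cont_id _)
    | fun x => (@?g x, @?h x) => refine (cont_pair _ _); cont
    | fun x => fst x => refine (@cont_fst _ _)
    | fun x => snd x => refine (@cont_snd _ _)
    | fun x => fst (@?g x) => refine (cont_comp_fst _); cont
    | fun x => snd (@?g x) => refine (cont_comp_snd _); cont
    | fun x => sin (@?g x) => refine (cont_sin _); cont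
    | fun x => cos (@?g x) => refine (cont_cos _); cont
    | fun x => (@?g x + - @?h x)%R => refine (contB _ _); cont
    | fun x => (@?g x + @?h x)%R => refine (contD _ _); cont
    | fun x => (@?g x * @?h x)%R => refine (contM _ _); cont
    | fun x => (- @?g x)%R => refine (contN _); cont
    | fun x => (@?g x ^+ ?k)%R => refine (contX _); cont
    | @pair _ _ ?b => refine (cont_pair (@cont_cst _ _ b) (@cont_id _))
    | GRing.mul ?b => change (continuous (fun x => GRing.mul b x));
        refine (contM _ _); [refine (@cont_cst _ _ _) | refine (@cont_id _)]
    | @fst _ _ => refine (@cont_fst _ _)
    | @snd _ _ => refine (@cont_snd _ _)
    | _ => first [assumption | refine (@cont_cst _ _ _) | refine (@cont_id _)
                 | (let y := fresh in intros y; apply: cvg_cst) | idtac]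
    end
  | |- _ => idtac
  end.

(** * Integrals over the box of three angles *)

Section Integral3.
Context {R : realType}.
Implicit Types (M : R).

Local Notation P2 := (R * R)%type.
Local Notation P3 := (R * P2)%type.

(** The integral is taken for d theta d phi: the surface element sin theta is left to the
    integrands. *)
Definition sph (h : P2 -> R) : R :=
  integ pi (fun th => integ (pi *+ 2) (fun ph => h (th, ph))).

Definition tri (h : P3 -> R) : R := integ pi (fun ta => sph (fun q => h (ta, q))).

Let pi0 : 0 <= pi :> R. Proof. exact: pi_ge0. Qed.
Let pi20 : 0 <= pi *+ 2 :> R. Proof. by rewrite mulrn_wge0// pi_ge0. Qed.

Lemma cont_slice (T U V : topologicalType) (h : T * U -> V) x :
  continuous h -> continuous (fun y => h (x, y)).
Proof.
move=> ch; have cx : continuous (fun y : U => (x, y)).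
  exact: cont_pair (@cont_cst _ _ x) (@cont_id _).
exact: cont_comp cx ch.
Qed.

Lemma sph_inner_continuous (T : topologicalType) (h : T * P2 -> R) : continuous h ->
  continuous (fun xt : T * R => integ (pi *+ 2) (fun ph => h (xt.1, (xt.2, ph)))).
Proof.
move=> ch; apply: (@integ_continuous _ _ (fun (xt : T * R) ph => h (xt.1, (xt.2, ph)))) => //.
by apply: (cont_comp (f := fun x : (T * R) * R => (x.1.1, (x.1.2, x.2))) _ ch); cont.
Qed.

Lemma sph_continuous (T : topologicalType) (h : T * P2 -> R) : continuous h ->
  continuous (fun x => sph (fun q => h (x, q))).
Proof.
move=> ch; apply: (@integ_continuous _ _ (fun (x : T) th =>
  integ (pi *+ 2) (fun ph => h (x, (th, ph))))) => //.
exact: sph_inner_continuous.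
Qed.

Lemma tri_continuous (T : topologicalType) (h : T * P3 -> R) : continuous h ->
  continuous (fun x => tri (fun p => h (x, p))).
Proof.
move=> ch; apply: (@integ_continuous _ _ (fun (x : T) ta =>
  sph (fun q => h (x, (ta, q))))) => //.
apply: (@sph_continuous (T * R)%type (fun xq => h (xq.1.1, (xq.1.2, xq.2)))).
by apply: (cont_comp (f := fun x : (T * R) * P2 => (x.1.1, (x.1.2, x.2))) _ ch); cont.
Qed.

Lemma sph_inner_cont (h : P2 -> R) : continuous h ->
  continuous (fun th => integ (pi *+ 2) (fun ph => h (th, ph))).
Proof.
move=> ch; apply: (@integ_continuous _ _ (fun th ph => h (th, ph))) => //.
by apply: (cont_comp (f := fun x : R * R => (x.1, x.2)) _ ch); cont.
Qed.

Lemma tri_inner_cont (h : P3 -> R) : continuous h ->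
  continuous (fun ta => sph (fun q => h (ta, q))).
Proof. exact: sph_continuous. Qed.

Lemma sphD (h g : P2 -> R) : continuous h -> continuous g ->
  sph (fun q => h q + g q) = sph h + sph g.
Proof.
move=> ch cg; rewrite /sph -integD//; [|exact: sph_inner_cont..].
congr integ; apply/funext => th; rewrite integD//; exact: cont_slice.
Qed.

Lemma sphZ k (h : P2 -> R) : continuous h -> sph (fun q => k * h q) = k * sph h.
Proof.
move=> ch; rewrite /sph -integZ//; last exact: sph_inner_cont.
congr integ; apply/funext => th; rewrite integZ//; exact: cont_slice.
Qed.

Lemma sph_bound (h : P2 -> R) M : continuous h -> (forall q, `|h q| <= M) ->
  `|sph h| <= pi * ((pi *+ 2) * M).
Proof.
move=> ch hM; apply: integ_bound => // [|th _]; first exact: sph_inner_cont.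
by apply: integ_bound => // ; exact: cont_slice.
Qed.

Lemma triD (h g : P3 -> R) : continuous h -> continuous g ->
  tri (fun q => h q + g q) = tri h + tri g.
Proof.
move=> ch cg; rewrite /tri -integD//; [|exact: tri_inner_cont..].
congr integ; apply/funext => ta; rewrite sphD//; exact: cont_slice.
Qed.

Lemma triZ k (h : P3 -> R) : continuous h -> tri (fun q => k * h q) = k * tri h.
Proof.
move=> ch; rewrite /tri -integZ//; last exact: tri_inner_cont.
congr integ; apply/funext => ta; rewrite sphZ//; exact: cont_slice.
Qed.

Lemma triB (h g : P3 -> R) : continuous h -> continuous g ->
  tri (fun q => h q - g q) = tri h - tri g.
Proof.
move=> ch cg; have -> : (fun q => h q - g q) = (fun q => h q + (-1) * g q).
  by apply/funext => x; rewrite mulN1r.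
by rewrite triD ?triZ ?mulN1r//; cont.
Qed.

Lemma tri_sum (I : Type) (r : seq I) (h : I -> P3 -> R) :
  (forall i, continuous (h i)) ->
  tri (fun p => \sum_(i <- r) h i p) = \sum_(i <- r) tri (h i).
Proof.
move=> ch; elim: r => [|i r ih].
  rewrite big_nil (_ : (fun _ => _) = (fun p => 0 * (0 : R))).
    by rewrite triZ ?mul0r//; cont.
  by apply/funext => p; rewrite big_nil mul0r.
rewrite big_cons -ih -triD//; last exact: cont_sum.
by congr tri; apply/funext => p; rewrite big_cons.
Qed.

Definition tri_cst : R := pi * (pi * (pi *+ 2)).

Lemma tri_cst_ge0 : 0 <= tri_cst.
Proof. by rewrite !mulr_ge0. Qed.

Lemma tri_bound (h : P3 -> R) M : continuous h -> (forall q, `|h q| <= M) ->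
  `|tri h| <= tri_cst * M.
Proof.
move=> ch hM; rewrite /tri_cst -!mulrA; apply: integ_bound => // [|ta _].
  exact: tri_inner_cont.
by apply: sph_bound => //; exact: cont_slice.
Qed.

Lemma sph_is_derive (h h' : R * P2 -> R) (x : R) :
  (forall (y : R) (q : P2), is_derive y 1 (fun r : R => h (r, q)) (h' (y, q))) ->
  continuous h -> continuous h' ->
  is_derive x 1 (fun y : R => sph (fun q => h (y, q))) (sph (fun q => h' (x, q))).
Proof.
move=> dh ch ch'.
apply: (@is_derive_integ _ (fun x th => integ (pi *+ 2) (fun ph => h (x, (th, ph))))
  (fun x th => integ (pi *+ 2) (fun ph => h' (x, (th, ph))))) => //.
- move=> y th; apply: (@is_derive_integ _ (fun x ph => h (x, (th, ph)))
    (fun x ph => h' (x, (th, ph)))) => //.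
  + by move=> z; apply: (cont_comp (f := fun ph => (z, (th, ph))) _ ch); cont.
  + by apply: (cont_comp (f := fun x : R * R => (x.1, (th, x.2))) _ ch'); cont.
- by move=> y; apply: (@sph_inner_cont (fun q => h (y, q))); exact: cont_slice.
- exact: sph_inner_continuous.
Qed.

Lemma tri_is_derive (h h' : R * P3 -> R) (x : R) :
  (forall (y : R) (q : P3), is_derive y 1 (fun r : R => h (r, q)) (h' (y, q))) ->
  continuous h -> continuous h' ->
  is_derive x 1 (fun y : R => tri (fun q => h (y, q))) (tri (fun q => h' (x, q))).
Proof.
move=> dh ch ch'.
apply: (@is_derive_integ _ (fun x ta => sph (fun q => h (x, (ta, q))))
  (fun x ta => sph (fun q => h' (x, (ta, q))))) => //.
- have cf (ta : R) : continuous (fun xq : R * P2 => (xq.1, (ta, xq.2))) by cont.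
  move=> y ta; apply: (@sph_is_derive (fun xq => h (xq.1, (ta, xq.2)))
    (fun xq => h' (xq.1, (ta, xq.2)))) => //.
  - by move=> r q; exact: (dh r (ta, q)).
  - exact: cont_comp (cf ta) ch.
  - exact: cont_comp (cf ta) ch'.
- move=> y; apply: (@sph_continuous _ (fun tq => h (y, tq))); exact: cont_slice.
- have cf : continuous (fun xq : (R * R) * P2 => (xq.1.1, (xq.1.2, xq.2))) by cont.
  apply: (@sph_continuous _ (fun xq => h' (xq.1.1, (xq.1.2, xq.2)))).
  exact: cont_comp cf ch'.
Qed.

Lemma tri_is_derive_dir (V : normedModType R) (h h' : V * P3 -> R) (z v : V) :
  (forall z q, is_derive z v (fun x => h (x, q)) (h' (z, q))) ->
  continuous h -> continuous h' ->
  is_derive z v (fun x => tri (fun q => h (x, q))) (tri (fun q => h' (z, q))).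
Proof.
move=> dh ch ch'; apply/is_derive_along0.
have cl : continuous (fun x : R => x *: v + z).
  move=> x; apply: cvgD; last exact: cvg_cst.
  by apply: cvgZ; [exact: cvg_id|exact: cvg_cst].
have clp : continuous (fun xp : R * P3 => (xp.1 *: v + z, xp.2)).
  by apply: cont_pair; [exact: cont_comp (@cont_fst _ _) cl|exact: cont_snd].
have := @tri_is_derive (fun xp => h (xp.1 *: v + z, xp.2))
  (fun xp => h' (xp.1 *: v + z, xp.2)) 0; rewrite /= scale0r add0r; apply.
- by move=> x q; apply/(is_derive_along (fun y => h (y, q))); exact: dh.
- exact: cont_comp clp ch.
- exact: cont_comp clp ch'.
Qed.

(** Of the integrations by parts in the three angles only this one keeps boundary terms: the vertex
    at [pi] and the base of the cone at 0. In [tri_dtheta] and [tri_dphi] the endpoints cancel. *)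
Lemma tri_dtau (H H' : P3 -> R) :
  (forall (ta : R) (q : P2), is_derive ta 1 (fun x : R => H (x, q)) (H' (ta, q))) ->
  continuous H -> continuous H' ->
  tri H' = sph (fun q => H (pi, q)) - sph (fun q => H (0, q)).
Proof.
move=> dH cH cH'; apply: (@FTC_integ _ _ _ (fun ta => sph (fun q => H (ta, q)))) => //.
  exact: tri_inner_cont.
by move=> x _; exact: (@sph_is_derive H H').
Qed.

Lemma integ0 b : 0 <= b -> integ b (fun=> 0) = 0 :> R.
Proof.
move=> b0; have c0 : continuous (fun _ : R => 0 : R) by cont.
by have := @integZ R b 0 _ b0 c0; rewrite !mul0r.
Qed.

Lemma tri_dtheta (H H' : P3 -> R) :
  (forall ta th ph : R, is_derive th 1 (fun x : R => H (ta, (x, ph))) (H' (ta, (th, ph)))) ->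
  continuous H -> continuous H' ->
  (forall ta ph, H (ta, (pi, ph)) = H (ta, (0, ph))) -> tri H' = 0.
Proof.
move=> dH cH cH' H0.
rewrite /tri (_ : (fun _ => _) = (fun=> 0)) ?integ0//; apply/funext => ta.
have cs : continuous (fun q => H (ta, q)) by exact: cont_slice.
have cs' : continuous (fun q => H' (ta, q)) by exact: cont_slice.
have E : integ (pi *+ 2) (fun ph => H (ta, (pi, ph))) -
    integ (pi *+ 2) (fun ph => H (ta, (0, ph))) = 0.
  by apply/eqP; rewrite subr_eq0; apply/eqP; congr integ; apply/funext => ph; exact: H0.
rewrite -[RHS]E; apply: (@FTC_integ _ _ _
    (fun th => integ (pi *+ 2) (fun ph => H (ta, (th, ph))))) => //.
  exact: (@sph_inner_cont (fun q => H' (ta, q))).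
move=> x _; apply: (@is_derive_integ _ (fun th ph => H (ta, (th, ph)))
  (fun th ph => H' (ta, (th, ph)))) => //.
  by move=> th; apply: (cont_comp (f := fun ph => (ta, (th, ph))) _ cH); cont.
by apply: (cont_comp (f := fun tp : R * R => (ta, (tp.1, tp.2))) _ cH'); cont.
Qed.

Lemma tri_dphi (H H' : P3 -> R) :
  (forall ta th ph : R, is_derive ph 1 (fun x : R => H (ta, (th, x))) (H' (ta, (th, ph)))) ->
  continuous H' ->
  (forall ta th, H (ta, (th, pi *+ 2)) = H (ta, (th, 0))) -> tri H' = 0.
Proof.
move=> dH cH' H0.
rewrite /tri (_ : (fun _ => _) = (fun=> 0)) ?integ0//; apply/funext => ta.
rewrite /sph (_ : (fun _ => _) = (fun=> 0)) ?integ0//; apply/funext => th.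
have E : H (ta, (th, pi *+ 2)) - H (ta, (th, 0)) = 0 by rewrite H0 subrr.
rewrite -[RHS]E; apply: (@FTC_integ _ _ _ (fun ph => H (ta, (th, ph)))) => //.
by apply: (cont_comp (f := fun ph => (ta, (th, ph))) _ cH'); cont.
Qed.

Lemma sph_sin (c : R) : sph (fun q => c * sin q.1) = 4 * pi * c.
Proof.
rewrite sphZ; last by cont.
suff -> : sph (fun q => sin q.1) = 4 * pi by rewrite mulrC.
have cs : continuous (@sin R) by exact: continuous_sin.
have E : integ pi (@sin R) = 2.
  have -> : 2 = (- cos pi) - (- cos 0) :> R by rewrite cospi cos0; ring.
  have dc (x : R) : 0 <= x -> is_derive x 1 (fun x : R => - cos x) (sin x).
    by move=> _; apply: is_derive_eq; exact: opprK.
  exact: (FTC_integ pi0 cs dc).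
rewrite /sph (_ : (fun _ => _) = (fun th => (pi *+ 2) * sin th)).
  by rewrite (integZ _ pi0 cs) E -mulr_natr; ring.
apply/funext => th /=.
have -> : pi *+ 2 * sin th = sin th * (pi *+ 2) - sin th * 0 :> R.
  by rewrite mulr0 subr0 mulrC.
apply: (@FTC_integ _ _ _ (fun x => sin th * x)) => //.
  by cont.
move=> x _; apply: is_derive_ext (is_deriveZf (sin th) (is_derive_id x 1)) => //.
by rewrite mulr1.
Qed.

End Integral3.

(** * Means over the backward light cone *)

Section Rays.
Context {R : realType} {d : nat}.
Local Notation P2 := (R * R)%type.
Local Notation P3 := (R * P2)%type.
Local Notation tc := (@time_coord d).
Local Notation sc := (@space_coord d).
Local Notation Z := 'rV[R]_(1 + d).
Implicit Types (z w : Z) (p : P3) (q : P2) (c : P3 -> R) (F : Z -> R).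

Lemma coord_ind (P : 'I_(1 + d) -> Prop) :
  P tc -> (forall i, P (sc i)) -> forall j, P j.
Proof.
move=> P0 PS j; have [k jk|k jk] := splitP j.
  by rewrite (_ : j = tc)//; apply/val_inj; rewrite /= jk; case: k {jk} => -[].
by rewrite (_ : j = sc k)//; exact/val_inj.
Qed.

Lemma sum_coord (G : 'I_(1 + d) -> R) :
  \sum_j G j = G tc + \sum_(i < d) G (sc i).
Proof. by rewrite big_split_ord/= big_ord1. Qed.

Lemma tc_sc i : (tc == sc i) = false.
Proof. by []. Qed.

Lemma sc_inj i j : (sc i == sc j) = (i == j).
Proof. by rewrite -!val_eqE/= eqn_add2l. Qed.

Lemma cont_rV (T : topologicalType) n (f : T -> 'rV[R]_n) :
  (forall i, continuous (fun x => f x ord0 i)) -> continuous f.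
Proof.
move=> cf x.
suff : f @ nbhs x --> f x by [].
apply/cvg_ballP => e e0.
suff : \forall y \near x, forall i, `|f x ord0 i - f y ord0 i| < e.
  by apply: filterS => r h; apply/ball_rVP.
apply: (@filter_forall _ _ (fun i y => is_true (`|f x ord0 i - f y ord0 i| < e)) (nbhs x)) => i.
by have /cvgrPdist_lt := cf i x; apply.
Qed.

(* The angle parametrises the time fraction smoothly with values in [0, 1],
   so that rays never leave the backward cone, whatever the parameters. *)
Definition frac p : R := (1 - cos p.1) / 2.
Definition dfrac p : R := sin p.1 / 2.

Lemma frac_ge0 p : 0 <= frac p.
Proof. by rewrite divr_ge0// subr_ge0 cos_le1. Qed.

Lemma frac_le1 p : frac p <= 1.
Proof. by rewrite ler_pdivrMr// mul1r; have := cos_geN1 p.1; lra. Qed.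

(* For d < 3 only the first d components of the unit vector enter, which is
   the method of descent. *)
Definition omega q (k : nat) : R :=
  match k with
  | 0 => sin q.1 * cos q.2
  | 1 => sin q.1 * sin q.2
  | _ => cos q.1
  end.

Lemma omega_norm q : omega q 0 ^+ 2 + omega q 1 ^+ 2 + omega q 2 ^+ 2 = 1.
Proof.
rewrite /= !exprMn -mulrDr (addrC (cos _ ^+ 2) _) (addrC (sin q.2 ^+ 2)) cos2Dsin2.
by rewrite mulr1 addrC cos2Dsin2.
Qed.

Lemma omega_le1 q k : `|omega q k| <= 1.
Proof.
rewrite -(@expr_le1 _ 2)// real_normK ?num_real//.
rewrite -(omega_norm q).
have s k' : 0 <= omega q k' ^+ 2 by exact: sqr_ge0.
have := s 0%N; have := s 1%N; have := s 2%N.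
by case: k => [|[|k]]; rewrite ?[omega q _.+2]/(omega q 2); lra.
Qed.

(** With z = (t, x) and s = [frac p], this is the point of the backward light cone of z at time s t:
    space is displaced by the lost time t (1 - s) in the direction [omega]. *)
Definition ray p z : Z :=
  event (frac p * z ord0 tc)
    (\row_i (z ord0 (sc i) + z ord0 tc * (1 - frac p) * omega p.2 i)).

Lemma ray_time p z : ray p z ord0 tc = frac p * z ord0 tc.
Proof. exact: event_time. Qed.

Lemma ray_space p z i :
  ray p z ord0 (sc i) = z ord0 (sc i) + z ord0 tc * (1 - frac p) * omega p.2 i.
Proof. by rewrite event_space mxE. Qed.

Lemma ray_linear p k w z j :
  ray p (k *: w + z) ord0 j = k * ray p w ord0 j + ray p z ord0 j.
Proof.
by elim/coord_ind: j => [|i]; rewrite ?ray_time ?ray_space !mxE; ring.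
Qed.

Lemma cont_omega (T : topologicalType) (f : T -> P2) k :
  continuous f -> continuous (fun x => omega (f x) k).
Proof. by move=> cf; case: k => [|[|k]] /=; cont. Qed.

Lemma cont_frac (T : topologicalType) (f : T -> P3) :
  continuous f -> continuous (fun x => frac (f x)).
Proof. by move=> cf; rewrite /frac; cont. Qed.

Lemma cont_dfrac (T : topologicalType) (f : T -> P3) :
  continuous f -> continuous (fun x => dfrac (f x)).
Proof. by move=> cf; rewrite /dfrac; cont. Qed.

Lemma cont_coord (T : topologicalType) (g : T -> Z) j :
  continuous g -> continuous (fun x => g x ord0 j).
Proof.
move=> cg; have cj : continuous (fun M : Z => M ord0 j) by exact: coord_continuous.
exact: cont_comp cg cj.
Qed.

Lemma cont_ray (T : topologicalType) (f : T -> P3) (g : T -> Z) :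
  continuous f -> continuous g -> continuous (fun x => ray (f x) (g x)).
Proof.
move=> cf cg; apply: cont_rV; apply: coord_ind => [|i].
  rewrite (_ : (fun _ => _) = (fun x => frac (f x) * g x ord0 tc)).
    by apply: contM; [exact: cont_frac|exact: cont_coord].
  by apply/funext => x; rewrite ray_time.
rewrite (_ : (fun _ => _) = (fun x => g x ord0 (sc i) +
    g x ord0 tc * (1 - frac (f x)) * omega (f x).2 i)).
  apply: contD; first exact: cont_coord.
  apply: contM; last by apply: cont_omega; cont.
  apply: contM; first exact: cont_coord.
  by apply: contB; [exact: cont_cst|exact: cont_frac].
by apply/funext => x; rewrite ray_space.
Qed.

(** The matrix of the linear map [ray p]. By the chain rule its entries, all at most 1 in absolute
    value, are the factors that differentiation puts into a mean. *)
Definition ray_coef (i j : 'I_(1 + d)) p : R := ray p (delta_mx ord0 i) ord0 j.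

Lemma cont_ray_coef i j : continuous (ray_coef i j).
Proof.
by apply: cont_coord; apply: cont_ray; [exact: cont_id|exact: cont_cst].
Qed.

Lemma ray_coef_le1 i j p : `|ray_coef i j p| <= 1.
Proof.
have f1 : `|1 - frac p| <= 1.
  by have := frac_ge0 p; have := frac_le1 p; rewrite ler_norml; lra.
rewrite /ray_coef; elim/coord_ind: j => [|j]; rewrite ?ray_time ?ray_space !mxE.
  rewrite eqxx/= normrM; case: (_ == _); rewrite ?normr0 ?mulr0// normr1 mulr1.
  by rewrite ger0_norm ?frac_ge0 ?frac_le1.
elim/coord_ind: i => [|i]; rewrite !eqxx/= ?tc_sc.
  rewrite add0r mul1r normrM.
  by rewrite -[leRHS]mulr1 ler_pM// omega_le1.
by rewrite mul0r mul0r addr0; case: (_ == _); rewrite ?normr0 ?normr1.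
Qed.

Local Notation X := (@whole R (1 + d)).

(** The weight is arbitrary because differentiation multiplies it by [ray_coef]: the family is
    closed under derivatives, and induction on the order becomes possible. *)
Definition ray_mean c F z : R :=
  tri (fun p => c p * F (ray p z)).

Lemma smooth_whole_continuous F : smooth X F -> continuous F.
Proof. by move=> sF x; exact: (smooth_continuous sF). Qed.

Lemma cont_ray_integrand c F : continuous c -> continuous F ->
  continuous (fun zp : Z * P3 => c zp.2 * F (ray zp.2 zp.1)).
Proof.
move=> cc cF; apply: contM; first exact: cont_comp (@cont_snd _ _) cc.
by apply: (cont_comp _ cF); apply: cont_ray; cont.
Qed.

Lemma ray_mean_continuous c F : continuous c -> continuous F ->
  continuous (ray_mean c F).
Proof.
move=> cc cF.
exact: (@tri_continuous R Z (fun zp => c zp.2 * F (ray zp.2 zp.1)) (cont_ray_integrand cc cF)).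
Qed.

Lemma is_derive_ray (Y : region R (1 + d)) F z i p : smooth Y F -> inner Y (ray p z) ->
  is_derive z (delta_mx ord0 i) (fun x => F (ray p x))
    (\sum_j ray_coef i j p * partial j F (ray p z)).
Proof.
move=> sF Yz; apply/is_derive_along0.
have e : ray p z = ray p (0 *: delta_mx ord0 i + z) by rewrite scale0r add0r.
rewrite e; apply: (is_derive_curve (q := fun r => ray p (r *: delta_mx ord0 i + z)) sF).
  by rewrite -e.
move=> j; rewrite (_ : (fun _ => _) = (fun r => r * ray_coef i j p + ray p z ord0 j)).
  have d1 := is_deriveMf (is_derive_id (0 : R) 1) (is_derive_cst (ray_coef i j p) (0 : R) 1).
  apply: is_derive_ext (is_deriveDf d1 (is_derive_cst (ray p z ord0 j) (0 : R) 1)) => //.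
  by rewrite /= mul1r mulr0 !addr0.
by apply/funext => r; rewrite ray_linear.
Qed.

Lemma is_derive_ray_mean c F z i : continuous c -> smooth X F ->
  is_derive z (delta_mx ord0 i) (ray_mean c F)
    (\sum_j ray_mean (fun p => c p * ray_coef i j p) (partial j F) z).
Proof.
move=> cc sF.
have cF : continuous F := smooth_whole_continuous sF.
have cpF j : continuous (partial j F).
  exact: smooth_whole_continuous (smooth_partial j sF).
pose h' (zp : Z * P3) := c zp.2 * \sum_j ray_coef i j zp.2 * partial j F (ray zp.2 zp.1).
have := @tri_is_derive_dir R _ (fun zp : Z * P3 => c zp.2 * F (ray zp.2 zp.1))
  h' z (delta_mx ord0 i).
have -> : tri (fun p => h' (z, p)) =
    \sum_j ray_mean (fun p => c p * ray_coef i j p) (partial j F) z.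
  rewrite /ray_mean -tri_sum.
    by congr tri; apply/funext => p; rewrite /h' mulr_sumr; apply: eq_bigr => j _; rewrite mulrA.
  move=> j; apply: contM; first by apply: contM => //; exact: cont_ray_coef.
  apply: (cont_comp _ (cpF j)); apply: cont_ray; [exact: cont_id|exact: cont_cst].
apply.
- by move=> y p; exact: (is_deriveZf (c p) (@is_derive_ray X F y i p sF Logic.I)).
- exact: cont_ray_integrand.
- apply: contM; first exact: cont_comp (@cont_snd _ _) cc.
  apply: cont_sum => j; apply: contM.
    exact: cont_comp (@cont_snd _ _) (@cont_ray_coef i j).
  by apply: (cont_comp _ (cpF j)); apply: cont_ray; cont.
Qed.

Lemma partial_ray_mean c F i : continuous c -> smooth X F ->
  partial i (ray_mean c F) =
  (fun z => \sum_j ray_mean (fun p => c p * ray_coef i j p) (partial j F) z).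
Proof.
by move=> cc sF; apply/funext => z; have [_ <-] := @is_derive_ray_mean c F z i cc sF.
Qed.

Lemma regular_ray_mean c F : continuous c -> smooth X F -> regular X (ray_mean c F).
Proof.
move=> cc sF; split=> [i z _|]; first by have [] := is_derive_ray_mean z i cc sF.
exists (ray_mean c F); split=> //; apply: continuous_subspaceT.
by apply: ray_mean_continuous => //; exact: smooth_whole_continuous.
Qed.

Lemma smooth_upto_sum (Y : region R (1 + d)) k (I : Type) (r : seq I) (F : I -> Z -> R) :
  (forall i, smooth_upto Y k (F i)) -> smooth_upto Y k (fun x => \sum_(i <- r) F i x).
Proof.
move=> sF; elim: r => [|i r ih].
  rewrite (_ : (fun _ => _) = (fun=> 0)).
    by move: k {sF}; apply/smooth_uptoP; exact: smooth_cst.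
  by apply/funext => x; rewrite big_nil.
rewrite (_ : (fun _ => _) = (fun x => F i x + \sum_(j <- r) F j x)).
  exact: smooth_uptoD.
by apply/funext => x; rewrite big_cons.
Qed.

Lemma smooth_ray_mean c F : continuous c -> smooth X F -> smooth X (ray_mean c F).
Proof.
move=> cc sF; apply/smooth_uptoP => k; elim: k c F cc sF => [|k ih] c F cc sF.
  by case=> // _; exact: regular_ray_mean.
apply/smooth_uptoS; split=> [|i]; first exact: regular_ray_mean.
rewrite (partial_ray_mean i cc sF); apply: smooth_upto_sum => j; apply: ih.
  by apply: contM => //; exact: cont_ray_coef.
exact: smooth_partial.
Qed.

Lemma pderivX_inner (Y : region R (1 + d)) s F z : smooth Y F -> inner Y z ->
  pderivX Y s F z = pderiv s F z.
Proof. by move=> sF Yz; apply: extension_inner => //; have [] := sF s. Qed.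

Lemma est0_inner (Y : region R (1 + d)) K a (u : R -> Z -> R) :
  K `<=` inner Y -> smooth_net Y u -> est Y K a 0 u <-> bigO_on K a u.
Proof.
move=> KY su; split=> [/(_ [::] isT)|h [|//] _]; last first.
  apply: bigO_on_congr h => e x e01 Kx.
  by rewrite pderivX_inner//; [exact: su|exact: KY].
apply: bigO_on_congr => e x e01 Kx.
by rewrite pderivX_inner//; [exact: su|exact: KY].
Qed.

Lemma est_sum (Y : region R (1 + d)) K a k (I : Type) (r : seq I) (u : I -> R -> Z -> R) :
  K `<=` carrier Y -> (forall i, smooth_net Y (u i)) ->
  (forall i, est Y K a k (u i)) -> est Y K a k (fun e x => \sum_(i <- r) u i e x).
Proof.
move=> KY su hu; elim: r => [|i r ih].
  apply: (@est_congr _ _ _ _ _ _ (fun _ => fun=> 0)).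
    by move=> e _ x _; rewrite big_nil.
  by move=> s _; exact: bigO_pderivX0.
apply: (@est_congr _ _ _ _ _ _ (fun e x => u i e x + \sum_(j <- r) u j e x)).
  by move=> e _ x _; rewrite big_cons.
by apply: estD => // e e01; apply: smooth_sum => j; exact: su.
Qed.

Definition ray_closed (K : set Z) := forall z p, K z -> K (ray p z).

(** A ray from a point of K stays in K, so a bound of u on K gives one of its mean on K. A
    derivative replaces c by c times [ray_coef], which is still bounded by M, and the induction goes
    on. *)
Lemma est_ray_mean K a k c M (u : R -> Z -> R) : ray_closed K ->
  continuous c -> (forall p, `|c p| <= M) -> smooth_net X u -> est X K a k u ->
  est X K a k (fun e => ray_mean c (u e)).
Proof.
move=> rK; elim: k c u => [|k ih] c u cc cM su hu.
  apply/est0_inner => //; first by move=> e e01; apply: smooth_ray_mean => //; exact: su.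
  move/est0_inner : hu => /(_ (fun _ _ => I) su)/bigO_on_pos[C C0 HC].
  exists (@tri_cst R * (M * C)); near=> e => z Kz.
  have e01 : 0 < e <= 1 by near: e; exact: near0_itv.
  rewrite -(mulrA (@tri_cst R)) -(mulrA M); apply: (@tri_bound R (fun p => c p * u e (ray p z))) => [|p].
    apply: (cont_slice (h := fun zp => c zp.2 * u e (ray zp.2 zp.1))).
    by apply: cont_ray_integrand => //; apply: smooth_whole_continuous; exact: su.
  rewrite normrM ler_pM//.
  by move: (ray p z) (rK z p Kz); near: e.
have hk := est_le (leqnSn k) hu; move/estS : hu => [_ hui].
apply/estS; split; first exact: est_le (leq0n k) (ih c u cc cM su hk).
move=> i; apply: (@est_congr _ _ _ _ _ _ (fun e z =>
    \sum_j ray_mean (fun p => c p * ray_coef i j p) (partial j (u e)) z)).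
  by move=> e e01 z _; rewrite (partial_ray_mean i cc (su e e01)).
have cj j : continuous (fun p => c p * ray_coef i j p).
  by apply: contM => //; exact: cont_ray_coef.
apply: est_sum => // [j e e01|j].
  by apply: smooth_ray_mean => //; apply: smooth_partial; exact: su.
apply: (ih (fun p => c p * ray_coef i j p) (fun e => partial j (u e)) (cj j)).
- by move=> p; rewrite normrM -[M]mulr1 ler_pM// ray_coef_le1.
- exact: smooth_net_partial.
- exact: hui.
Unshelve. all: by end_near. Qed.

End Rays.

(** * The angular part of the Laplacian *)

Section Divergence.
Context {R : realType} {d : nat}.
Hypothesis d3 : (d <= 3)%N.
Local Notation P2 := (R * R)%type.
Local Notation P3 := (R * P2)%type.
Local Notation tc := (@time_coord d).
Local Notation sc := (@space_coord d).
Local Notation Z := 'rV[R]_(1 + d).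
Implicit Types (z w : Z) (p : P3) (q : P2).

(** The derivative of [omega] in the colatitude; [omega], [omega_th] and [eta] form an orthonormal
    frame of R^3. *)
Definition omega_th q (k : nat) : R :=
  match k with
  | 0 => cos q.1 * cos q.2
  | 1 => cos q.1 * sin q.2
  | _ => - sin q.1
  end.

(* [sin q.1 * eta q k] is the derivative of [omega q k] in the longitude. *)
Definition eta q (k : nat) : R :=
  match k with
  | 0 => - sin q.2
  | 1 => cos q.2
  | _ => 0
  end.

Definition eta_ph q (k : nat) : R :=
  match k with
  | 0 => - cos q.2
  | 1 => - sin q.2
  | _ => 0
  end.

Lemma is_derive_sinf (x : R) : is_derive x 1 (fun x : R => sin x) (cos x).
Proof. exact: is_derive_sin. Qed.

Lemma is_derive_cosf (x : R) : is_derive x 1 (fun x : R => cos x) (- sin x).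
Proof. exact: is_derive_cos. Qed.

Lemma is_deriveMr (f : R -> R) (x k a : R) :
  is_derive x 1 f a -> is_derive x 1 (fun y => f y * k) (a * k).
Proof.
move=> df; apply: is_derive_ext (is_deriveZf k df) => [y|]; exact: mulrC.
Qed.

Lemma is_deriveNf (f : R -> R) (x a : R) :
  is_derive x 1 f a -> is_derive x 1 (fun y => - f y) (- a).
Proof. exact: is_deriveN. Qed.

Lemma is_derive_cstf (V : normedModType R) (x v : V) (c : R) :
  is_derive x v (fun=> c) 0.
Proof. exact: is_derive_cst. Qed.

Lemma is_derive_sumf (V : normedModType R) (x v : V) n (f : 'I_n -> V -> R) (a : 'I_n -> R) :
  (forall i, is_derive x v (f i) (a i)) ->
  is_derive x v (fun y => \sum_i f i y) (\sum_i a i).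
Proof.
move=> df; have := is_derive_sum df.
by rewrite (_ : \sum_(i < n) f i = (fun y => \sum_i f i y))//; apply/funext => y; rewrite fct_sumE.
Qed.

Lemma is_derive_omega_th (th ph : R) k :
  is_derive th 1 (fun x : R => omega (x, ph) k) (omega_th (th, ph) k).
Proof.
by case: k => [|[|k]] /=; [apply: is_deriveMr; exact: is_derive_sinf
  |apply: is_deriveMr; exact: is_derive_sinf|exact: is_derive_cosf].
Qed.

Lemma is_derive_omega_ph (th ph : R) k :
  is_derive ph 1 (fun x : R => omega (th, x) k) (sin th * eta (th, ph) k).
Proof.
case: k => [|[|k]] /=; [apply: is_deriveZf; exact: is_derive_cosf
  |apply: is_deriveZf; exact: is_derive_sinf|].
by rewrite mulr0; exact: is_derive_cstf.
Qed.

Lemma is_derive_omega_th2 (th ph : R) k :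
  is_derive th 1 (fun x : R => omega_th (x, ph) k) (- omega (th, ph) k).
Proof.
case: k => [|[|k]] /=.
- by rewrite -mulNr; apply: is_deriveMr; exact: is_derive_cosf.
- by rewrite -mulNr; apply: is_deriveMr; exact: is_derive_cosf.
- by apply: is_deriveNf; exact: is_derive_sinf.
Qed.

Lemma is_derive_eta (th ph : R) k :
  is_derive ph 1 (fun x : R => eta (th, x) k) (eta_ph (th, ph) k).
Proof.
by case: k => [|[|k]] /=; [apply: is_deriveNf; exact: is_derive_sinf
  |exact: is_derive_cosf|exact: is_derive_cstf].
Qed.

Lemma is_derive_frac (ta : R) q :
  is_derive ta 1 (fun x : R => frac (x, q)) (dfrac (ta, q)).
Proof.
rewrite /frac /dfrac /=; apply: is_deriveMr; rewrite -[sin ta]opprK -sub0r.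
exact: is_deriveBf (is_derive_cstf _ _ _) (is_derive_cosf ta).
Qed.

(** The coordinates of the unit vector are eigenfunctions of the spherical Laplacian for the
    eigenvalue -2; the equation is multiplied by sin theta. *)
Lemma frame_gradient q k : (k < 3)%N ->
  cos q.1 * omega_th q k - sin q.1 * omega q k + eta_ph q k =
  - (2 * sin q.1 * omega q k).
Proof.
have s1 : sin q.1 ^+ 2 = 1 - cos q.1 ^+ 2 by exact: sin2cos2.
case: k => [|[|[|//]]] _ /=; ring: s1.
Qed.

(** Completeness of the orthonormal frame: the three projections add up to the identity. *)
Lemma frame_hessian q k l : (k < 3)%N -> (l < 3)%N ->
  omega_th q k * omega_th q l + eta q k * eta q l =
  (k == l)%:R - omega q k * omega q l.
Proof.
have s1 : sin q.1 ^+ 2 = 1 - cos q.1 ^+ 2 by exact: sin2cos2.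
have s2 : sin q.2 ^+ 2 = 1 - cos q.2 ^+ 2 by exact: sin2cos2.
by case: k => [|[|[|//]]] _; case: l => [|[|[|//]]] _ /=; ring: s1 s2.
Qed.

Lemma cont_omega_th (T : topologicalType) (f : T -> P2) k :
  continuous f -> continuous (fun x => omega_th (f x) k).
Proof. by move=> cf; case: k => [|[|k]] /=; cont. Qed.

Lemma cont_eta (T : topologicalType) (f : T -> P2) k :
  continuous f -> continuous (fun x => eta (f x) k).
Proof. by move=> cf; case: k => [|[|k]] /=; cont. Qed.

Lemma cont_eta_ph (T : topologicalType) (f : T -> P2) k :
  continuous f -> continuous (fun x => eta_ph (f x) k).
Proof. by move=> cf; case: k => [|[|k]] /=; cont. Qed.

(** * Calculus along rays that stay in a given region *)

Section OneRegion.
Variables (Y : region R (1 + d)) (z : Z).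
Hypothesis Yz : forall p, inner Y (ray p z).
Implicit Types (F W : Z -> R).

Local Notation t := (z ord0 tc).

Lemma cont_ray_fun W : smooth Y W -> continuous (fun p => W (ray p z)).
Proof.
move=> sW p; apply: (@continuous_comp _ _ _ (fun p => ray p z) W).
  by apply: cont_ray; [exact: cont_id|exact: cont_cst].
exact: (smooth_continuous sW (Yz p)).
Qed.

Definition rad W p : R := \sum_(i < d) omega p.2 i * partial (sc i) W (ray p z).

Lemma cont_rad W : smooth Y W -> continuous (rad W).
Proof.
move=> sW; apply: cont_sum => i; apply: contM; first by apply: cont_omega; cont.
by apply: cont_ray_fun; exact: smooth_partial.
Qed.

(** The common form of the derivatives in tau, theta and phi, where f moves one of the
    parameters. *)
Lemma is_derive_ray_param W (f : R -> P3) (s : R) (a : R) (b : 'I_d -> R) :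
  smooth Y W ->
  is_derive s 1 (fun r => frac (f r) * t) a ->
  (forall i : 'I_d, is_derive s 1 (fun r => t * (1 - frac (f r)) * omega (f r).2 i) (b i)) ->
  is_derive s 1 (fun r => W (ray (f r) z))
    (a * partial tc W (ray (f s) z) + \sum_i b i * partial (sc i) W (ray (f s) z)).
Proof.
move=> sW da db.
pose q' := fun j : 'I_(1 + d) => match fintype.split j with inl _ => a | inr i => b i end.
have q0 : q' tc = a by rewrite /q' (unsplitK (inl _)).
have qs i : q' (sc i) = b i by rewrite /q' (unsplitK (inr _)).
have -> : a * partial tc W (ray (f s) z) + \sum_i b i * partial (sc i) W (ray (f s) z) =
    \sum_j q' j * partial j W (ray (f s) z).
  by rewrite sum_coord q0; congr (_ + _); apply: eq_bigr => i _; rewrite qs.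
apply: (is_derive_curve (q := fun r => ray (f r) z) sW (Yz (f s))).
apply: coord_ind => [|i].
  by rewrite q0; apply: is_derive_ext da => // r; rewrite ray_time.
rewrite qs; apply: is_derive_ext (is_deriveDf (is_derive_cstf s 1 (z ord0 (sc i))) (db i)).
  by move=> r; rewrite ray_space.
by rewrite add0r.
Qed.

Lemma is_derive_ray_tau W (ta : R) q : smooth Y W ->
  is_derive ta 1 (fun x => W (ray (x, q) z))
    (dfrac (ta, q) * t * (partial tc W (ray (ta, q) z) - rad W (ta, q))).
Proof.
move=> sW; have df := is_derive_frac ta q.
have db (i : 'I_d) : is_derive ta 1 (fun r => t * (1 - frac (r, q)) * omega q i)
    (- (dfrac (ta, q) * t * omega q i)).
  have := is_deriveMr (omega q i) (is_deriveZf t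
    (is_deriveBf (is_derive_cstf ta 1 1) df)).
  by apply: is_derive_ext => //; ring.
have := @is_derive_ray_param W (fun x => (x, q)) ta _ _ sW (is_deriveMr t df) db.
apply: is_derive_ext => //=.
rewrite mulrBr /rad mulr_sumr -sumrN; congr (_ + _); apply: eq_bigr => i _ /=.
by rewrite mulrA mulNr.
Qed.

Lemma is_derive_ray_theta W (ta th ph : R) : smooth Y W ->
  is_derive th 1 (fun x => W (ray (ta, (x, ph)) z))
    (t * (1 - frac (ta, (th, ph))) * \sum_(i < d) omega_th (th, ph) i *
      partial (sc i) W (ray (ta, (th, ph)) z)).
Proof.
move=> sW.
have db (i : 'I_d) : is_derive th 1
    (fun r => t * (1 - frac (ta, (r, ph))) * omega (r, ph) i)
    (t * (1 - frac (ta, (th, ph))) * omega_th (th, ph) i).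
  by have := is_deriveZf (t * (1 - frac (ta, (th, ph)))) (is_derive_omega_th th ph i);
    apply: is_derive_ext.
have := @is_derive_ray_param W (fun x => (ta, (x, ph))) th 0 _ sW
  (is_derive_cstf th 1 (frac (ta, (th, ph)) * t)) db.
apply: is_derive_ext => //.
by rewrite mul0r add0r mulr_sumr; apply: eq_bigr => i _; rewrite [RHS]mulrA.
Qed.

Lemma is_derive_ray_phi W (ta th ph : R) : smooth Y W ->
  is_derive ph 1 (fun x => W (ray (ta, (th, x)) z))
    (t * (1 - frac (ta, (th, ph))) * \sum_(i < d) (sin th * eta (th, ph) i) *
      partial (sc i) W (ray (ta, (th, ph)) z)).
Proof.
move=> sW.
have db (i : 'I_d) : is_derive ph 1
    (fun r => t * (1 - frac (ta, (th, r))) * omega (th, r) i)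
    (t * (1 - frac (ta, (th, ph))) * (sin th * eta (th, ph) i)).
  by have := is_deriveZf (t * (1 - frac (ta, (th, ph)))) (is_derive_omega_ph th ph i);
    apply: is_derive_ext.
have := @is_derive_ray_param W (fun x => (ta, (th, x))) ph 0 _ sW
  (is_derive_cstf ph 1 (frac (ta, (th, ph)) * t)) db.
apply: is_derive_ext => //.
by rewrite mul0r add0r mulr_sumr; apply: eq_bigr => i _; rewrite [RHS]mulrA.
Qed.

Definition hess F p : R :=
  \sum_(i < d) omega p.2 i * rad (partial (sc i) F) p.

(** For rho = t (1 - s) not 0 the inner bracket is the spherical Laplacian of F on the sphere of
    radius rho, divided by rho; it is written without division so as to make sense at rho = 0. The
    factors sin and [dfrac] are the surface element and ds. *)
Definition ang F p : R := dfrac p * (sin p.2.1 *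
  (t * (1 - frac p) * (lap F (ray p z) - hess F p) - 2 * rad F p)).

(* The radial part of the Laplacian on a sphere has the same mean as the
   Laplacian: the difference is a divergence in the angles. *)
Lemma tri_ang F : smooth Y F -> tri (ang F) = 0.
Proof.
move=> sF.
have sp i : smooth Y (partial (sc i) F) := smooth_partial (sc i) sF.
have spp i j : smooth Y (partial (sc j) (partial (sc i) F)) := smooth_partial _ (sp i).
pose g i p := partial (sc i) F (ray p z).
pose h j i p := partial (sc j) (partial (sc i) F) (ray p z).
have cg i : continuous (g i) := cont_ray_fun (sp i).
have ch j i : continuous (h j i) := cont_ray_fun (spp i j).
pose rho p : R := t * (1 - frac p).
have crho : continuous rho.
  apply: contM; first exact: cont_cst.
  by apply: contB; [exact: cont_cst|apply: cont_frac; exact: cont_id].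
(* H1 and H2 are the components along [omega_th] and [eta] of the gradient of F, with the surface
   element; in H2 the latter cancels the 1 / sin theta of the longitude. H1' and H2' are their
   derivatives in theta and phi. *)
pose H1 p := dfrac p * (sin p.2.1 * \sum_(i < d) omega_th p.2 i * g i p).
pose H1' p := dfrac p * (cos p.2.1 * (\sum_(i < d) omega_th p.2 i * g i p) +
  sin p.2.1 * \sum_(i < d) (- omega p.2 i * g i p +
    omega_th p.2 i * (rho p * \sum_(j < d) omega_th p.2 j * h j i p))).
pose H2 p := dfrac p * \sum_(i < d) eta p.2 i * g i p.
pose H2' p := dfrac p * \sum_(i < d) (eta_ph p.2 i * g i p +
  eta p.2 i * (rho p * \sum_(j < d) (sin p.2.1 * eta p.2 j) * h j i p)).
have cd : continuous (fun p : P3 => dfrac p) by exact: (cont_dfrac (@cont_id _)).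
have c2 : continuous (fun p : P3 => p.2) by cont.
have cs : continuous (fun p : P3 => sin p.2.1) by cont.
have cc : continuous (fun p : P3 => cos p.2.1) by cont.
have cot i : continuous (fun p : P3 => omega_th p.2 i) by exact: cont_omega_th.
have coo i : continuous (fun p : P3 => omega p.2 i) by exact: cont_omega.
have coe i : continuous (fun p : P3 => eta p.2 i) by exact: cont_eta.
have cop i : continuous (fun p : P3 => eta_ph p.2 i) by exact: cont_eta_ph.
have cH1' : continuous H1'.
  apply: contM => //; apply: contD; first by apply: contM => //; apply: cont_sum => i; exact: contM.
  apply: contM => //; apply: cont_sum => i; apply: contD.
    by apply: contM => //; exact: contN.
  apply: contM => //; apply: contM => //; apply: cont_sum => j; exact: contM.
have cH2' : continuous H2'.
  apply: contM => //; apply: cont_sum => i; apply: contD; first exact: contM.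
  apply: contM => //; apply: contM => //; apply: cont_sum => j; apply: contM => //.
  exact: contM.
have t1 : tri H1' = 0.
  apply: (@tri_dtheta _ H1); last 1 first.
  - by move=> ta ph; rewrite /H1 /= sinpi sin0 !mul0r.
  - move=> ta th ph.
    have dH := is_deriveZf (dfrac (ta, (th, ph))) (is_deriveMf (is_derive_sinf th)
      (is_derive_sumf (fun i : 'I_d => is_deriveMf (is_derive_omega_th2 th ph i)
        (is_derive_ray_theta ta th ph (sp i))))).
    by move: dH; apply: is_derive_ext.
  - apply: contM => //; apply: contM => //; apply: cont_sum => i; exact: contM.
  - exact: cH1'.
have t2 : tri H2' = 0.
  apply: (@tri_dphi _ H2); [|exact: cH2'|].
  - move=> ta th ph.
    have dH := is_deriveZf (dfrac (ta, (th, ph))) (is_derive_sumf (fun i : 'I_d =>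
      is_deriveMf (is_derive_eta th ph i) (is_derive_ray_phi ta th ph (sp i)))).
    by move: dH; apply: is_derive_ext.
  - move=> ta th; rewrite /H2 /=; congr (_ * _); apply: eq_bigr => i _.
    have eo k : omega (th, pi *+ 2) k = omega (th, 0 : R) k.
      by case: k => [|[|k]] //=; rewrite ?sin2pi ?cos2pi ?sin0 ?cos0.
    congr (_ * _).
      by case: (nat_of_ord i) => [|[|k]] //=; rewrite ?sin2pi ?cos2pi ?sin0 ?cos0.
    rewrite /g; congr (partial (sc i) F _); apply/rowP; apply: coord_ind => [|j].
      by rewrite !ray_time.
    by rewrite !ray_space /= eo.
have -> : ang F = (fun p => H1' p + H2' p).
  apply/funext => p; rewrite -mulrDr; congr (_ * _).
  (* The identity is proved coordinate by coordinate: [frame_hessian] gives the second-order terms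
     (E2) and [frame_gradient] those of first order (E1). *)
  pose T i := sin p.2.1 * (rho p * (h i i p - omega p.2 i * rad (partial (sc i) F) p) -
    2 * (omega p.2 i * g i p)).
  have -> : sin p.2.1 * (t * (1 - frac p) * (lap F (ray p z) - hess F p) - 2 * rad F p) =
      \sum_i T i.
    by rewrite -mulr_sumr sumrB -!mulr_sumr sumrB.
  rewrite !mulr_sumr -!big_split; apply: eq_bigr => i _ /=.
  have i3 : (i < 3)%N by rewrite (leq_trans (ltn_ord i)).
  pose S1 := \sum_(j < d) omega_th p.2 j * h j i p.
  pose S2 := \sum_(j < d) eta p.2 j * h j i p.
  have E2 : omega_th p.2 i * S1 + eta p.2 i * S2 =
      h i i p - omega p.2 i * rad (partial (sc i) F) p.
    rewrite !mulr_sumr -big_split/=.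
    transitivity (\sum_(j < d) ((i == j)%:R * h j i p - omega p.2 i * (omega p.2 j * h j i p))).
      apply: eq_bigr => j _; have j3 : (j < 3)%N by rewrite (leq_trans (ltn_ord j)).
      by rewrite !mulrA -mulrDl frame_hessian// mulrBl.
    rewrite sumrB; congr (_ - _).
    rewrite (bigD1 i)//= eqxx mul1r big1 ?addr0// => j ji.
    by rewrite eq_sym (negbTE ji) mul0r.
  have -> : \sum_(j < d) sin p.2.1 * eta p.2 j * h j i p = sin p.2.1 * S2.
    by rewrite mulr_sumr; apply: eq_bigr => j _; rewrite mulrA.
  rewrite -/S1 /T -E2; have E1 := frame_gradient p.2 i3; clear E2.
  move: E1 => /(congr1 (fun x => x * g i p)).
  move: (g i p) (rho p) S1 S2 (omega p.2 i) (omega_th p.2 i) (eta p.2 i) (eta_ph p.2 i)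
    (sin p.2.1) (cos p.2.1) => a b c e f k l m n o E1.
  transitivity (n * (b * (k * c + l * e)) + - (2 * n * f) * a); first by ring.
  by rewrite -E1; ring.
by rewrite triD// t1 t2 addr0.
Qed.

End OneRegion.
End Divergence.

(** * Integration by parts along the rays *)

Section Kirchhoff.
Context {R : realType} {d : nat}.
Local Notation P2 := (R * R)%type.
Local Notation P3 := (R * P2)%type.
Local Notation tc := (@time_coord d).
Local Notation sc := (@space_coord d).
Local Notation Z := 'rV[R]_(1 + d).
Local Notation X := (@whole R (1 + d)).
Implicit Types (z w : Z) (p : P3) (q : P2) (F W : Z -> R).

Lemma frac_pi q : frac (pi, q) = 1 :> R.
Proof. by rewrite /frac/= cospi opprK -[1 + 1]/(2%:R) divff. Qed.

Lemma frac_0 q : frac (0 : R, q) = 0 :> R.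
Proof. by rewrite /frac/= cos0 subrr mul0r. Qed.

Lemma ray_pi q z : ray (pi, q) z = z.
Proof.
apply/rowP; apply: coord_ind => [|i]; rewrite ?ray_time ?ray_space frac_pi.
  by rewrite mul1r.
by rewrite subrr mulr0 mul0r addr0.
Qed.

Lemma is_derive_comp1 (f g : R -> R) (x a b : R) :
  is_derive (g x) 1 f a -> is_derive x 1 g b -> is_derive x 1 (fun y => f (g y)) (a * b).
Proof. by move=> df dg; have := is_derive1_comp df dg. Qed.

(* The derivative of [H] along the rays, for coefficients still to be chosen;
   [ray] is at [z] for the angle [pi] and at time 0 for the angle 0. *)
Lemma tri_tau (Y : region R (1 + d)) z F (al be ga al' be' ga' : R -> R) :
  (forall p, inner Y (ray p z)) -> smooth Y F ->
  (forall s : R, is_derive s 1 al (al' s)) -> (forall s : R, is_derive s 1 be (be' s)) ->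
  (forall s : R, is_derive s 1 ga (ga' s)) ->
  continuous al' -> continuous be' -> continuous ga' ->
  let t : R := z ord0 tc in
  let a p := partial tc F (ray p z) in
  let H p := sin p.2.1 * (al (frac p) * F (ray p z) +
    t * (be (frac p) * a p) + t * (ga (frac p) * rad z F p)) in
  tri (fun p => sin p.2.1 * (dfrac p * (al' (frac p) * F (ray p z) +
    t * (al (frac p) * (a p - rad z F p)) + t * (be' (frac p) * a p) +
    t ^+ 2 * (be (frac p) * (partial tc (partial tc F) (ray p z) - rad z (partial tc F) p)) +
    t * (ga' (frac p) * rad z F p) +
    t ^+ 2 * (ga (frac p) * (rad z (partial tc F) p - hess z F p))))) =
  sph (fun q => H (pi, q)) - sph (fun q => H (0, q)).
Proof.
move=> Yz sF dal_ dbe dga cal' cbe' cga' t a H.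
have cder (f g : R -> R) : (forall s : R, is_derive s 1 f (g s)) -> continuous f.
  by move=> df s; apply: differentiable_continuous; apply/derivable1_diffP; have [] := df s.
have cfr : continuous (fun p : P3 => frac p) := cont_frac (@cont_id _).
have cdf : continuous (fun p : P3 => dfrac p) := cont_dfrac (@cont_id _).
have cc (f : R -> R) : continuous f -> continuous (fun p : P3 => f (frac p)).
  by move=> cf; exact: cont_comp cfr cf.
have {}cal' := cc _ cal'; have {}cbe' := cc _ cbe'; have {}cga' := cc _ cga'.
have cal := cc _ (cder _ _ dal_); have cbe := cc _ (cder _ _ dbe).
have cga := cc _ (cder _ _ dga).
have st := smooth_partial tc sF; have stt := smooth_partial tc st.
have si i := smooth_partial (sc i) sF.
have cF := cont_ray_fun Yz sF; have ca := cont_ray_fun Yz st.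
have cA := cont_ray_fun Yz stt; have cb := cont_rad Yz sF.
have cB := cont_rad Yz st.
have cs : continuous (fun p : P3 => sin p.2.1) by cont.
have cC : continuous (hess z F).
  apply: cont_sum => i.
  have co : continuous (fun p : P3 => omega p.2 i) by apply: cont_omega; cont.
  exact: contM co (cont_rad Yz (si i)).
have drad (ta : R) q : is_derive ta 1 (fun x => rad z F (x, q))
    (dfrac (ta, q) * t * (rad z (partial tc F) (ta, q) - hess z F (ta, q))).
  have dr (i : 'I_d) := is_deriveZf (omega q i) (is_derive_ray_tau Yz ta q (si i)).
  have := is_derive_sumf dr; apply: is_derive_ext => //.
  rewrite mulrBr /hess /rad !mulr_sumr -sumrB; apply: eq_bigr => i _ /=.
  rewrite (partialC (sc i) tc sF (Yz _)); rewrite -/(rad z (partial (sc i) F) (ta, q)).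
  by move: (rad _ _ _) (partial _ _ _) (omega _ _) (dfrac _) => *; rewrite /t; ring.
apply: (@tri_dtau R H) => [ta q||].
- have df := is_derive_frac ta q.
  have dal1 := is_derive_comp1 (g := fun x => frac (x, q)) (dal_ _) df.
  have dbe1 := is_derive_comp1 (g := fun x => frac (x, q)) (dbe _) df.
  have dga1 := is_derive_comp1 (g := fun x => frac (x, q)) (dga _) df.
  have dF := is_derive_ray_tau Yz ta q sF.
  have da := is_derive_ray_tau Yz ta q st.
  have := is_deriveZf (sin q.1) (is_deriveDf (is_deriveDf (is_deriveMf dal1 dF)
    (is_deriveZf t (is_deriveMf dbe1 da))) (is_deriveZf t (is_deriveMf dga1 (drad ta q)))).
  apply: is_derive_ext => //=; congr (_ * _).
  rewrite -/t -/(a (ta, q)).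
  move: (al' _) (al _) (be' _) (be _) (ga' _) (ga _) (F _) (a _) (dfrac _) (rad _ _ _)
    (rad _ _ _) (hess _ _ _) (partial _ _ _) => *; ring.
- by rewrite /H; cont.
- by cont.
Qed.

End Kirchhoff.

(** * Duhamel's operator *)

Section Duhamel.
Context {R : realType} {d : nat}.
Hypothesis d3 : (d <= 3)%N.
Local Notation P2 := (R * R)%type.
Local Notation P3 := (R * P2)%type.
Local Notation tc := (@time_coord d).
Local Notation sc := (@space_coord d).
Local Notation Z := 'rV[R]_(1 + d).
Local Notation X := (@whole R (1 + d)).
Implicit Types (z w : Z) (p : P3) (q : P2) (F W : Z -> R).

Lemma cont_hess (Y : region R (1 + d)) z F : (forall p, inner Y (ray p z)) ->
  smooth Y F -> continuous (hess z F).
Proof.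
move=> Yz sF; apply: cont_sum => i.
have co : continuous (fun p : P3 => omega p.2 i) by apply: cont_omega; cont.
exact: contM co (cont_rad Yz (smooth_partial (sc i) sF)).
Qed.

Lemma cont_ang (Y : region R (1 + d)) z F : (forall p, inner Y (ray p z)) ->
  smooth Y F -> continuous (ang z F).
Proof.
move=> Yz sF.
have cfr : continuous (fun p : P3 => frac p) := cont_frac (@cont_id _).
have cdf : continuous (fun p : P3 => dfrac p) := cont_dfrac (@cont_id _).
have cl := cont_ray_fun Yz (smooth_lap sF).
have ch := cont_hess Yz sF; have cr := cont_rad Yz sF.
by rewrite /ang; cont.
Qed.

(** The kernel of the retarded potential. With the radius r = t (1 - s), the measure r dr is t^2 (1
    - s) ds up to sign, ds is [dfrac] d tau, and sin is the surface element; [duhamel] adds the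
    factor t^2. *)
Definition wave_weight p : R :=
  (4 * pi)^-1 * ((1 - frac p) * (dfrac p * sin p.2.1)).

Lemma cont_wave_weight : continuous wave_weight.
Proof.
have cfr : continuous (fun p : P3 => frac p) := cont_frac (@cont_id _).
have cdf : continuous (fun p : P3 => dfrac p) := cont_dfrac (@cont_id _).
by rewrite /wave_weight; cont.
Qed.

Let pi4_gt0 : 0 < 4 * pi :> R. Proof. by rewrite mulr_gt0// pi_gt0. Qed.

Lemma abs_sin_le1 (x : R) : `|sin x| <= 1.
Proof. by rewrite ler_norml sin_geN1 sin_le1. Qed.

Lemma wave_weight_bound p : `|wave_weight p| <= (4 * pi)^-1.
Proof.
have i0 : 0 <= (4 * pi)^-1 :> R by rewrite invr_ge0 ltW.
rewrite /wave_weight normrM (ger0_norm i0) -[leRHS]mulr1 ler_wpM2l//.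
have h (a b : R) : `|a| <= 1 -> `|b| <= 1 -> `|a * b| <= 1.
  by move=> ha hb; rewrite normrM -[leRHS]mulr1 ler_pM.
apply: (h); first by have := frac_ge0 p; have := frac_le1 p; rewrite ler_norml; lra.
apply: (h); last exact: abs_sin_le1.
rewrite /dfrac normrM [X in _ * X]ger0_norm// ler_pdivrMr// mul1r.
by apply: le_trans (abs_sin_le1 _) _; lra.
Qed.

Definition duhamel F z : R := z ord0 tc ^+ 2 * ray_mean wave_weight F z.

Lemma is_derive_coord z (i j : 'I_(1 + d)) :
  is_derive z (delta_mx ord0 i) (fun x : Z => x ord0 j) (i == j)%:R.
Proof.
apply/is_derive_along0.
have := is_deriveDf (is_deriveMr (i == j)%:R (is_derive_id (0 : R) 1))
  (is_derive_cstf (0 : R) 1 (z ord0 j)).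
apply: is_derive_ext => [r|]; last by rewrite mul1r addr0.
by rewrite !mxE eqxx/= eq_sym.
Qed.

Lemma is_derive_time z : is_derive z (delta_mx ord0 tc) (fun x : Z => x ord0 tc) 1.
Proof. by have := is_derive_coord z tc tc; rewrite eqxx. Qed.

Lemma is_derive_time_space z i :
  is_derive z (delta_mx ord0 (sc i)) (fun x : Z => x ord0 tc) 0.
Proof. by have := is_derive_coord z (sc i) tc. Qed.

Lemma partial_coord (i j : 'I_(1 + d)) :
  partial i (fun x : Z => x ord0 j) = fun=> (i == j)%:R.
Proof. by apply/funext => z; have [_ <-] := is_derive_coord z i j. Qed.

Lemma smooth_coord (j : 'I_(1 + d)) : smooth X (fun x : Z => x ord0 j).
Proof.
have r0 : regular X (fun x : Z => x ord0 j).
  split=> [i x _|]; first by have [] := is_derive_coord x i j.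
  exists (fun x : Z => x ord0 j); split=> //; apply: continuous_subspaceT.
  exact: coord_continuous.
case=> [|i s] //=; rewrite partial_coord; exact: smooth_cst.
Qed.

Lemma smooth_duhamel F : smooth X F -> smooth X (duhamel F).
Proof.
move=> sF; apply: smoothM; last exact: smooth_ray_mean cont_wave_weight sF.
by apply: smoothM; exact: smooth_coord.
Qed.

Lemma cont_family W : smooth X W -> continuous (fun zp : Z * P3 => W (ray zp.2 zp.1)).
Proof.
move=> sW; have cr : continuous (fun zp : Z * P3 => ray zp.2 zp.1).
  by apply: cont_ray; [exact: cont_snd|exact: cont_fst].
exact: cont_comp cr (smooth_whole_continuous sW).
Qed.

Lemma cont_rad_family W : smooth X W -> continuous (fun zp : Z * P3 => rad zp.1 W zp.2).
Proof.
move=> sW; apply: cont_sum => i.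
have co : continuous (fun zp : Z * P3 => omega zp.2.2 i) by apply: cont_omega; cont.
exact: contM co (cont_family (smooth_partial (sc i) sW)).
Qed.

Lemma is_derive_ray_time W z p : smooth X W ->
  is_derive z (delta_mx ord0 tc) (fun x => W (ray p x))
    (frac p * partial tc W (ray p z) + (1 - frac p) * rad z W p).
Proof.
move=> sW; have := @is_derive_ray R d X W z tc p sW Logic.I.
apply: is_derive_ext => //; rewrite sum_coord /rad mulr_sumr.
rewrite {1}/ray_coef ray_time mxE !eqxx/= mulr1; congr (_ + _); apply: eq_bigr => i _.
by rewrite /ray_coef ray_space !mxE !eqxx/= add0r mul1r mulrA.
Qed.

Lemma is_derive_ray_space W z p i : smooth X W ->
  is_derive z (delta_mx ord0 (sc i)) (fun x => W (ray p x))
    (partial (sc i) W (ray p z)).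
Proof.
move=> sW; have := @is_derive_ray R d X W z (sc i) p sW Logic.I.
apply: is_derive_ext => //; rewrite sum_coord.
rewrite {1}/ray_coef ray_time mxE !eqxx/= mulr0 mul0r add0r (bigD1 i)//= big1 => [|j ji].
  by rewrite /ray_coef ray_space !mxE !eqxx/= mul0r mul0r !addr0 mul1r.
rewrite /ray_coef ray_space !mxE !eqxx/= mul0r mul0r addr0.
by rewrite (_ : (sc j == sc i) = false) ?mul0r// sc_inj (negbTE ji).
Qed.

Lemma partial_tri i (h h' : Z * P3 -> R) :
  (forall z p, is_derive z (delta_mx ord0 i) (fun x => h (x, p)) (h' (z, p))) ->
  continuous h -> continuous h' ->
  partial i (fun z => tri (fun p => h (z, p))) = (fun z => tri (fun p => h' (z, p))).
Proof.
move=> dh ch ch'; apply/funext => z.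
by have [_ <-] := @tri_is_derive_dir R _ h h' z (delta_mx ord0 i) dh ch ch'.
Qed.

(** [h0], [h1] and [h2] are the integrands of [duhamel F] and of its first two time derivatives.
    They are functions of the pair (z, p) because differentiation under [tri] asks for joint
    continuity. *)
Let h0 F (zp : Z * P3) : R :=
  wave_weight zp.2 * (zp.1 ord0 tc ^+ 2 * F (ray zp.2 zp.1)).

Let slope F (zp : Z * P3) : R :=
  frac zp.2 * partial tc F (ray zp.2 zp.1) + (1 - frac zp.2) * rad zp.1 F zp.2.

Let h1 F (zp : Z * P3) : R := wave_weight zp.2 *
  (2 * zp.1 ord0 tc * F (ray zp.2 zp.1) + zp.1 ord0 tc ^+ 2 * slope F zp).

Let hh F (zp : Z * P3) : R :=
  \sum_(i < d) omega zp.2.2 i * partial tc (partial (sc i) F) (ray zp.2 zp.1).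

Let h2 F (zp : Z * P3) : R := wave_weight zp.2 *
  (2 * F (ray zp.2 zp.1) + 4 * zp.1 ord0 tc * slope F zp + zp.1 ord0 tc ^+ 2 *
   (frac zp.2 * slope (partial tc F) zp + (1 - frac zp.2) *
    (frac zp.2 * hh F zp + (1 - frac zp.2) * hess zp.1 F zp.2))).

Let cw : continuous (fun zp : Z * P3 => wave_weight zp.2).
Proof. exact: cont_comp (@cont_snd _ _) cont_wave_weight. Qed.

Let ct : continuous (fun zp : Z * P3 => zp.1 ord0 tc).
Proof. by apply: cont_coord; exact: cont_fst. Qed.

Let cfr : continuous (fun zp : Z * P3 => frac zp.2).
Proof. by apply: cont_frac; exact: cont_snd. Qed.

Let cslope F : smooth X F -> continuous (slope F).
Proof.
move=> sF; have cr := cont_rad_family sF.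
have ca := cont_family (smooth_partial tc sF).
by rewrite /slope; cont.
Qed.

Let ch0 F : smooth X F -> continuous (h0 F).
Proof. by move=> sF; have cF := cont_family sF; rewrite /h0; cont. Qed.

Let ch1 F : smooth X F -> continuous (h1 F).
Proof.
by move=> sF; have cF := cont_family sF; have cs := cslope sF; rewrite /h1; cont.
Qed.

Let ch2 F : smooth X F -> continuous (h2 F).
Proof.
move=> sF; have cF := cont_family sF; have cs := cslope sF.
have cs' := cslope (smooth_partial tc sF).
have co (i : 'I_d) : continuous (fun zp : Z * P3 => omega zp.2.2 i).
  by apply: cont_omega; cont.
have chh : continuous (hh F).
  apply: cont_sum => i.
  exact: contM (co i) (cont_family (smooth_partial tc (smooth_partial (sc i) sF))).
have che : continuous (fun zp : Z * P3 => hess zp.1 F zp.2).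
  apply: cont_sum => i.
  exact: contM (co i) (cont_rad_family (smooth_partial (sc i) sF)).
by rewrite /h2; cont.
Qed.

Let is_derive_slope F z p : smooth X F ->
  is_derive z (delta_mx ord0 tc) (fun x => slope F (x, p))
   (frac p * slope (partial tc F) (z, p) + (1 - frac p) *
    (frac p * hh F (z, p) + (1 - frac p) * hess z F p)).
Proof.
move=> sF.
have dr (i : 'I_d) := is_deriveZf (omega p.2 i) (is_derive_ray_time z p (smooth_partial (sc i) sF)).
have := is_deriveDf (is_deriveZf (frac p) (is_derive_ray_time z p (smooth_partial tc sF)))
  (is_deriveZf (1 - frac p) (is_derive_sumf dr)).
apply: is_derive_ext => //; congr (_ + _ * _).
rewrite /hh /hess !mulr_sumr -big_split/=; apply: eq_bigr => i _.
by rewrite /=; move: (partial _ _ _) (rad _ _ _) => *; ring.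
Qed.

Let dt2 z : is_derive z (delta_mx ord0 tc) (fun x : Z => x ord0 tc ^+ 2) (2 * z ord0 tc).
Proof.
have dt := is_derive_time z.
by have := is_deriveMf dt dt; apply: is_derive_ext => [x|]; rewrite ?expr2//; ring.
Qed.

Lemma duhamelE F : smooth X F -> duhamel F = (fun z => tri (fun p => h0 F (z, p))).
Proof.
move=> sF; apply/funext => z; rewrite /duhamel /ray_mean.
have Xz p : inner X (ray p z) by [].
have cc := contM cont_wave_weight (cont_ray_fun Xz sF).
rewrite -(triZ _ cc); congr tri; apply/funext => p; rewrite /h0/=.
by move: (F _) => *; ring.
Qed.

Let partial_duhamel_time F : smooth X F ->
  partial tc (duhamel F) = (fun z => tri (fun p => h1 F (z, p))).
Proof.
move=> sF; rewrite duhamelE//; apply: partial_tri; [|exact: ch0|exact: ch1].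
move=> z p; have := is_deriveZf (wave_weight p) (is_deriveMf (dt2 z) (is_derive_ray_time z p sF)).
by apply: is_derive_ext.
Qed.

Let partial_duhamel_time2 F : smooth X F ->
  partial tc (partial tc (duhamel F)) = (fun z => tri (fun p => h2 F (z, p))).
Proof.
move=> sF; rewrite partial_duhamel_time//; apply: partial_tri; [|exact: ch1|exact: ch2].
move=> z p; have dt := is_derive_time z.
have := is_deriveZf (wave_weight p) (is_deriveDf
  (is_deriveMf (is_deriveZf 2 dt) (is_derive_ray_time z p sF))
  (is_deriveMf (dt2 z) (is_derive_slope z p sF))).
apply: is_derive_ext => //; rewrite /h2/=; congr (_ * _).
rewrite -[frac p * partial _ _ _ + _]/(slope F (z, p)).
move: (slope _ _) (slope _ _) (hh _ _) (hess _ _ _) (F _) => *; ring.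
Qed.

Let partial_duhamel_space F i : smooth X F ->
  partial (sc i) (duhamel F) = duhamel (partial (sc i) F).
Proof.
move=> sF; have sp := smooth_partial (sc i) sF.
rewrite !duhamelE//; apply: partial_tri; [|exact: ch0|exact: ch0].
move=> z p; have dt := is_derive_time_space z i.
have := is_deriveZf (wave_weight p) (is_deriveMf (is_deriveMf dt dt) (is_derive_ray_space z p i sF)).
by apply: is_derive_ext => //; rewrite /h0/=; congr (_ * _); ring.
Qed.

Lemma duhamel0 F z : z ord0 tc = 0 -> duhamel F z = 0.
Proof. by move=> z0; rewrite /duhamel z0 expr0n mul0r. Qed.

Lemma tri0 : tri (fun _ : P3 => 0) = 0 :> R.
Proof.
rewrite (_ : (fun _ => _) = (fun p : P3 => 0 * 0)); first by rewrite triZ ?mul0r//; cont.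
by apply/funext => p; rewrite mul0r.
Qed.

Lemma partial_duhamel0 F z : smooth X F -> z ord0 tc = 0 ->
  partial tc (duhamel F) z = 0.
Proof.
move=> sF z0; rewrite partial_duhamel_time// -tri0; congr tri; apply/funext => p.
by rewrite /h1/= z0 expr0n/= mulr0 !mul0r addr0 mulr0.
Qed.

Lemma dal_duhamel F z : smooth X F -> dal (duhamel F) z = F z.
Proof.
move=> sF; have st := smooth_partial tc sF; have sl := smooth_lap sF.
have Xz p : inner X (ray p z) by [].
set t : R := z ord0 tc.
rewrite /dal; have -> : lap (duhamel F) z = duhamel (lap F) z.
  rewrite /lap; transitivity (\sum_(i < d) duhamel (partial (sc i) (partial (sc i) F)) z).
    apply: eq_bigr => i _; rewrite !partial_duhamel_space//.
    exact: smooth_partial.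
  rewrite /duhamel /ray_mean -mulr_sumr -tri_sum.
    by congr (_ * tri _); apply/funext => p; rewrite mulr_sumr.
  move=> i; apply: contM; first exact: cont_wave_weight.
  by apply: (cont_ray_fun Xz); do 2 apply: smooth_partial.
rewrite (partial_duhamel_time2 sF) (duhamelE sl).
have c1 : continuous (fun p => h2 F (z, p)) := @cont_slice _ _ _ _ z (ch2 sF).
have c2 : continuous (fun p => h0 (lap F) (z, p)) := @cont_slice _ _ _ _ z (ch0 sl).
have ca := cont_ang Xz sF.
rewrite -triB//.
(* For al = 2 s - s^2, be = s^2 - s^3 and ga = 2 s - 3 s^2 + s^3 the identity
   of [tri_tau] has the integrand of [dal (duhamel F)] on the left, up to a
   multiple of [ang], and F z on the right. *)
have did (s : R) := is_derive_id s (1 : R).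
have dsq (s : R) := is_deriveMf (did s) (did s).
have dcu (s : R) := is_deriveMf (dsq s) (did s).
(* The coefficients are read off the integrand: al' = 2 (1 - s) from the terms in F, be = s^2 (1 -
   s) from the second time derivative, and ga = (1 - s) - (1 - s)^3 from the second radial
   derivative once [ang] has removed the Laplacian. All vanish at 0, and at 1 only al survives, with
   value 1. *)
have dal_ (s : R) : is_derive s 1 (fun s => 2 * s - s * s) (2 - 2 * s).
  have := is_deriveBf (is_deriveZf 2 (did s)) (dsq s).
  by apply: is_derive_ext => //=; ring.
have dbe (s : R) : is_derive s 1 (fun s => s * s - s * s * s) (2 * s - 3 * s * s).
  by have := is_deriveBf (dsq s) (dcu s); apply: is_derive_ext => //=; ring.
have dga (s : R) : is_derive s 1 (fun s => 2 * s - 3 * (s * s) + s * s * s)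
    (2 - 6 * s + 3 * s * s).
  have := is_deriveDf (is_deriveBf (is_deriveZf 2 (did s)) (is_deriveZf 3 (dsq s))) (dcu s).
  by apply: is_derive_ext => //=; ring.
have ca1 : continuous (fun s : R => 2 - 2 * s) by cont.
have cb1 : continuous (fun s : R => 2 * s - 3 * s * s) by cont.
have cg1 : continuous (fun s : R => 2 - 6 * s + 3 * s * s) by cont.
have := tri_tau Xz sF dal_ dbe dga ca1 cb1 cg1; rewrite -/t /=.
have -> : (fun q => sin q.1 * ((2 * frac (pi, q) - frac (pi, q) * frac (pi, q)) *
    F (ray (pi, q) z) + t * ((frac (pi, q) * frac (pi, q) -
      frac (pi, q) * frac (pi, q) * frac (pi, q)) * partial tc F (ray (pi, q) z)) +
    t * ((2 * frac (pi, q) - 3 * (frac (pi, q) * frac (pi, q)) +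
      frac (pi, q) * frac (pi, q) * frac (pi, q)) * rad z F (pi, q)))) =
    (fun q => F z * sin q.1).
  apply/funext => q; rewrite frac_pi ray_pi; move: (partial _ _ _) (rad _ _ _) (F z) => *.
  by ring.
have -> : (fun q => sin q.1 * ((2 * frac (0, q) - frac (0, q) * frac (0, q)) *
    F (ray (0, q) z) + t * ((frac (0, q) * frac (0, q) -
      frac (0, q) * frac (0, q) * frac (0, q)) * partial tc F (ray (0, q) z)) +
    t * ((2 * frac (0, q) - 3 * (frac (0, q) * frac (0, q)) +
      frac (0, q) * frac (0, q) * frac (0, q)) * rad z F (0, q)))) =
    (fun q => 0 * sin q.1).
  apply/funext => q; rewrite frac_0; move: (partial _ _ _) (rad _ _ _) (F _) => *.
  by ring.
rewrite !sph_sin mulr0 subr0 => E.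
apply: (@mulfI _ (4 * pi)); first by rewrite gt_eqF.
rewrite -E.
(* Adding t times [ang] costs nothing by [tri_ang]; it trades the Laplacian for the second radial
   derivative and a first-order term. *)
transitivity (tri (fun p => (4 * pi) * (h2 F (z, p) - h0 (lap F) (z, p)) + t * ang z F p)).
  have c12 := contB c1 c2.
  have c4 : continuous (fun p => (4 * pi) * (h2 F (z, p) - h0 (lap F) (z, p))).
    by apply: contM c12; exact: cont_cst.
  have cta : continuous (fun p => t * ang z F p) by apply: contM ca; exact: cont_cst.
  by rewrite [RHS](triD c4 cta) (triZ _ c12) (triZ _ ca) (tri_ang d3 Xz sF) mulr0 addr0.
congr tri; apply/funext => p; rewrite /h2 /h0 /ang /wave_weight/= -/t.
have -> : hh F (z, p) = rad z (partial tc F) p.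
  by apply: eq_bigr => i _; rewrite (partialC _ _ sF (Xz _)).
rewrite /slope/= -/t.
have h4 (x y : R) : (4 * pi) * ((4 * pi)^-1 * x * y) = x * y.
  by rewrite !mulrA mulfV ?mul1r// gt_eqF.
rewrite -mulrBr h4.
move: (partial _ _ _) (partial _ _ _) (rad _ _ _) (rad _ _ _) (hess _ _ _) (F _) (lap _ _).
move: (frac p) (dfrac p) (sin _) => *; ring.
Qed.

End Duhamel.

(** * Bounds from Kirchhoff's formula and for Duhamel's operator *)

Section WaveBound.
Context {R : realType} {d : nat}.
Hypothesis d3 : (d <= 3)%N.
Local Notation P2 := (R * R)%type.
Local Notation P3 := (R * P2)%type.
Local Notation tc := (@time_coord d).
Local Notation sc := (@space_coord d).
Local Notation Z := 'rV[R]_(1 + d).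
Local Notation X := (@whole R (1 + d)).
Implicit Types (z w : Z) (p : P3) (q : P2) (F W : Z -> R).

(** Inside the first term, 1 accounts for F on the base, |t| for its time derivative and |t| d for
    its radial derivative, a sum of d products with components of [omega]; [tri_cst] t^2 accounts
    for the source. The powers of pi are the sizes of the parameter boxes. *)
Definition kirchhoff_cst (t : R) : R :=
  (4 * pi)^-1 * (pi * ((pi *+ 2) * (1 + `|t| * (1 + d%:R))) + tri_cst * t ^+ 2).

Lemma kirchhoff_bound (Y : region R (1 + d)) z F (M : R) :
  (forall p, inner Y (ray p z)) -> smooth Y F ->
  (forall q, `|F (ray (0 : R, q) z)| <= M) ->
  (forall q, `|partial tc F (ray (0 : R, q) z)| <= M) ->
  (forall i q, `|partial (sc i) F (ray (0 : R, q) z)| <= M) ->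
  (forall p, `|dal F (ray p z)| <= M) ->
  `|F z| <= kirchhoff_cst (z ord0 tc) * M.
Proof.
move=> Yz sF hF hFt hFi hD; set t : R := z ord0 tc.
have pi4_gt0 : 0 < 4 * pi :> R by rewrite mulr_gt0// pi_gt0.
have M0 : 0 <= M by apply: le_trans (hD (0, (0, 0))); exact: normr_ge0.
(* Kirchhoff's formula is [tri_tau] for al = 1 and be = ga = 1 - s. *)
have d1 (s : R) : is_derive s 1 (fun _ : R => 1 : R) (0 : R) by exact: is_derive_cstf.
have d2 (s : R) : is_derive s 1 (fun s : R => 1 - s : R) (-1 : R).
  by have := is_deriveBf (d1 s) (is_derive_id s (1 : R)); rewrite sub0r.
have c0 : continuous (fun _ : R => 0 : R) by exact: cont_cst.
have c1 : continuous (fun _ : R => -1 : R) by exact: cont_cst.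
have := tri_tau Yz sF d1 d2 d2 c0 c1 c1; rewrite -/t /=.
pose G q : R := sin q.1 * (F (ray (0, q) z) + t * partial tc F (ray (0, q) z) +
  t * rad z F (0, q)).
have -> : (fun q => sin q.1 * (1 * F (ray (0, q) z) +
    t * ((1 - frac (0, q)) * partial tc F (ray (0, q) z)) +
    t * ((1 - frac (0, q)) * rad z F (0, q)))) = G.
  by apply/funext => q; rewrite frac_0 /G; move: (F _) (partial _ _ _) (rad _ _ _) => *; ring.
have -> : (fun q => sin q.1 * (1 * F (ray (pi, q) z) +
    t * ((1 - frac (pi, q)) * partial tc F (ray (pi, q) z)) +
    t * ((1 - frac (pi, q)) * rad z F (pi, q)))) = (fun q => F z * sin q.1).
  apply/funext => q; rewrite frac_pi ray_pi.
  by move: (F _) (partial _ _ _) (rad _ _ _) => *; ring.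
rewrite sph_sin.
(* With this choice the mixed terms cancel and - 2 t rad F + t^2 (1 - s) (F_tt - hess F) remains, up
   to the factors sin and [dfrac]. This is the d'Alembertian in E plus t times the bracket of [ang],
   whose integral is 0. *)
pose E p : R := sin p.2.1 * (dfrac p * (t ^+ 2 * (1 - frac p) * dal F (ray p z))).
have cfr : continuous (fun p : P3 => frac p) := cont_frac (@cont_id _).
have cdf : continuous (fun p : P3 => dfrac p) := cont_dfrac (@cont_id _).
have cD := cont_ray_fun Yz (smooth_dal sF).
have cE : continuous E by rewrite /E; cont.
have ca := cont_ang Yz sF.
have cta : continuous (fun p => t * ang z F p) by apply: contM ca; exact: cont_cst.
rewrite (_ : tri _ = tri (fun p => E p + t * ang z F p)); last first.
  congr tri; apply/funext => p; rewrite /E /ang -/t /dal.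
  move: (partial _ _ _) (partial _ _ _) (rad _ _ _) (rad _ _ _) (hess _ _ _) (F _) (lap _ _).
  by move: (frac p) (dfrac p) (sin _) => *; ring.
rewrite (triD cE cta) (triZ _ ca) (tri_ang d3 Yz sF) mulr0 addr0 => EG.
have tE : `|tri E| <= tri_cst * (t ^+ 2 * M).
  apply: (tri_bound cE) => p.
  have f1 : `|1 - frac p| <= 1.
    by have := frac_ge0 p; have := frac_le1 p; rewrite ler_norml; lra.
  have f2 : `|dfrac p| <= 1.
    rewrite /dfrac normrM [X in _ * X]ger0_norm// ler_pdivrMr// mul1r.
    by apply: le_trans (abs_sin_le1 _) _; lra.
  have h (a b c : R) : `|a| <= 1 -> `|b| <= c -> `|a * b| <= c.
    by move=> ha hb; rewrite normrM -[leRHS]mul1r ler_pM.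
  rewrite /E; apply: (h); first exact: abs_sin_le1.
  apply: (h) => //; rewrite -mulrA normrM ger0_norm ?sqr_ge0// ler_wpM2l ?sqr_ge0//.
  exact: h.
have cz : continuous (fun q : P2 => (0 : R, q)).
  by apply: cont_pair; [exact: cont_cst|exact: cont_id].
have cG : continuous G.
  have cF0 := cont_comp cz (cont_ray_fun Yz sF).
  have cF1 := cont_comp cz (cont_ray_fun Yz (smooth_partial tc sF)).
  have cr := cont_comp cz (cont_rad Yz sF).
  by rewrite /G; cont.
have tG : `|sph G| <= pi * ((pi *+ 2) * ((1 + `|t| * (1 + d%:R)) * M)).
  apply: (sph_bound cG) => q; rewrite /G normrM -[leRHS]mul1r.
  rewrite ler_pM// ?abs_sin_le1//.
  rewrite (le_trans (ler_normD _ _))//.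
  have -> : (1 + `|t| * (1 + d%:R)) * M = (M + `|t| * M) + `|t| * (d%:R * M) by ring.
  rewrite lerD//; last first.
    rewrite normrM ler_wpM2l// /rad (le_trans (ler_norm_sum _ _ _))//.
    apply: (@le_trans _ _ (\sum_(i < d) M)); last first.
      by rewrite sumr_const card_ord mulr_natl.
    apply: ler_sum => i _; rewrite normrM -[leRHS]mul1r ler_pM// ?omega_le1//.
  by rewrite (le_trans (ler_normD _ _))// lerD// normrM ler_wpM2l.
have -> : F z = (4 * pi)^-1 * (sph G + tri E).
  by rewrite EG addrC subrK mulrA mulVf ?mul1r// gt_eqF.
rewrite /kirchhoff_cst normrM gtr0_norm ?invr_gt0// -[leRHS]mulrA.
rewrite ler_wpM2l ?invr_ge0 ?(ltW pi4_gt0)// (le_trans (ler_normD _ _))//.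
have -> : (pi * (pi *+ 2 * (1 + `|t| * (1 + d%:R))) + tri_cst * t ^+ 2) * M =
    pi * (pi *+ 2 * ((1 + `|t| * (1 + d%:R)) * M)) + tri_cst * (t ^+ 2 * M) by ring.
exact: lerD.
Qed.

Lemma est_cst K k (c : R) : est X K 0 k (fun _ _ => c).
Proof.
move=> s _; exists `|c|; near=> e => z _.
rewrite powRr0 mulr1 (pderivX_inner s (smooth_cst X c) Logic.I).
by case: s => [//|i s]; rewrite (@pderiv_cst _ _ (i :: s) c)// normr0.
Unshelve. all: by end_near. Qed.

Lemma est_time K k (M : R) : (forall z, K z -> `|z ord0 tc| <= M) ->
  est X K 0 k (fun _ z => z ord0 tc).
Proof.
move=> KM.
have e0 : est X K 0 0 (fun _ z => z ord0 tc).
  apply/est0_inner => //; first by move=> e _; exact: smooth_coord.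
  by exists M; near=> e => z Kz; rewrite powRr0 mulr1; exact: KM.
case: k => [//|k]; apply/estS; split=> // i.
apply: (@est_congr _ _ _ _ _ _ (fun _ => fun=> (i == tc)%:R)); last exact: est_cst.
by move=> e _ z _; rewrite partial_coord.
Unshelve. all: by end_near. Qed.

Lemma est_duhamel K a k (M : R) (u : R -> Z -> R) : ray_closed K ->
  (forall z, K z -> `|z ord0 tc| <= M) -> smooth_net X u ->
  est X K a k u -> est X K a k (fun e => duhamel (u e)).
Proof.
move=> rK KM su hu.
have sc_ : smooth_net X (fun _ z => z ord0 tc) by move=> e _; exact: smooth_coord.
have ht := est_time (k := k) KM.
have hr := est_ray_mean rK cont_wave_weight wave_weight_bound su hu.
have sr : smooth_net X (fun e => ray_mean wave_weight (u e)).
  by move=> e e01; apply: smooth_ray_mean (su e e01); exact: cont_wave_weight.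
have := estM _ (smooth_netM sc_ sc_) sr (estM _ sc_ sc_ ht ht) hr.
by rewrite !add0r; apply.
Qed.

End WaveBound.

(** * Estimates on truncated cones *)

Section Cones.
Context {R : realType} {d : nat}.
Hypothesis d3 : (d <= 3)%N.
Local Notation P2 := (R * R)%type.
Local Notation P3 := (R * P2)%type.
Local Notation tc := (@time_coord d).
Local Notation sc := (@space_coord d).
Local Notation Z := 'rV[R]_(1 + d).
Implicit Types (z w y : Z) (p : P3) (q : P2) (x : 'rV[R]_d).

Lemma sqr_enorm x : enorm x ^+ 2 = \sum_(i < d) x ord0 i ^+ 2.
Proof. by rewrite sqr_sqrtr// sumr_ge0// => i _; exact: sqr_ge0. Qed.

Lemma enorm_ge0 x : 0 <= enorm x.
Proof. exact: sqrtr_ge0. Qed.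

Lemma coord_le_enorm x i : `|x ord0 i| <= enorm x.
Proof.
rewrite -sqrtr_sqr ler_wsqrtr// (bigD1 i)//= lerDl sumr_ge0// => j _.
exact: sqr_ge0.
Qed.

Lemma omega_sum_le1 q : \sum_(i < d) omega q i ^+ 2 <= 1.
Proof.
have := omega_norm q; have s k := sqr_ge0 (omega q k).
have := s 0%N; have := s 1%N; have := s 2%N.
move: d3; case: d => [|[|[|[|//]]]] _; rewrite ?big_ord0 ?big_ord_recl ?big_ord0 /=; lra.
Qed.

(** Cauchy-Schwarz, by expanding the square of |x| w - x. The condition on w is an inequality
    because [omega] truncated to d components may be shorter than 1. *)
Lemma dot_le_enorm x (w : 'I_d -> R) : \sum_(i < d) w i ^+ 2 <= 1 ->
  \sum_(i < d) x ord0 i * w i <= enorm x.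
Proof.
move=> w1; have [x0|x0] := eqVneq (enorm x) 0.
  rewrite big1 ?x0// => i _; have := coord_le_enorm x i.
  by rewrite x0 normr_le0 => /eqP ->; rewrite mul0r.
have x1 : 0 < enorm x by rewrite lt_neqAle eq_sym x0 enorm_ge0.
have : 0 <= \sum_(i < d) (enorm x * w i - x ord0 i) ^+ 2.
  by rewrite sumr_ge0// => i _; exact: sqr_ge0.
have -> : \sum_(i < d) (enorm x * w i - x ord0 i) ^+ 2 =
    enorm x ^+ 2 * (\sum_(i < d) w i ^+ 2) - 2 * enorm x * (\sum_(i < d) x ord0 i * w i) +
    enorm x ^+ 2.
  rewrite {2}sqr_enorm !mulr_sumr -sumrB -big_split/=; apply: eq_bigr => i _; ring.
move: (\sum_(i < d) x ord0 i * w i) w1 => S w1.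
have : enorm x ^+ 2 * (\sum_(i < d) w i ^+ 2) <= enorm x ^+ 2.
  by rewrite -[leRHS]mulr1 ler_wpM2l ?sqr_ge0.
move=> h1 h2; have : 2 * enorm x * S <= 2 * enorm x * enorm x.
  by rewrite -[leRHS]mulrA -expr2; lra.
by rewrite ler_pM2l// mulr_gt0.
Qed.

Lemma enorm_shift_le x (w : 'I_d -> R) (s : R) : \sum_(i < d) w i ^+ 2 <= 1 ->
  enorm (\row_i (x ord0 i + s * w i)) <= enorm x + `|s|.
Proof.
move=> w1; rewrite -(@ler_pXn2r _ 2)// ?nnegrE ?addr_ge0 ?enorm_ge0//.
have -> : enorm (\row_i (x ord0 i + s * w i)) ^+ 2 = enorm x ^+ 2 +
    2 * (\sum_(i < d) x ord0 i * (s * w i)) + s ^+ 2 * \sum_(i < d) w i ^+ 2.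
  rewrite !sqr_enorm !mulr_sumr -!big_split/=; apply: eq_bigr => i _.
  by rewrite mxE; ring.
have h : \sum_(i < d) x ord0 i * (s * w i) <= `|s| * enorm x.
  rewrite (_ : \sum_(i < d) _ = `|s| * \sum_(i < d) x ord0 i * (Num.sg s * w i)).
    rewrite ler_wpM2l// dot_le_enorm//; apply: le_trans w1; apply: ler_sum => i _.
    rewrite exprMn -[leRHS]mul1r ler_wpM2r ?sqr_ge0// sqr_sg.
    by case: (s != 0).
  rewrite mulr_sumr; apply: eq_bigr => i _.
  by rewrite [in LHS](numEsg s); ring.
have h2 : s ^+ 2 * \sum_(i < d) w i ^+ 2 <= `|s| ^+ 2.
  by rewrite real_normK ?num_real// -[leRHS]mulr1 ler_wpM2l ?sqr_ge0.
have -> : (enorm x + `|s|) ^+ 2 = enorm x ^+ 2 + 2 * (`|s| * enorm x) + `|s| ^+ 2 by ring.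
by rewrite !lerD// ler_wpM2l.
Qed.

Lemma enorm_shift_ge x (w : 'I_d -> R) (s : R) : \sum_(i < d) w i ^+ 2 <= 1 ->
  enorm x - `|s| <= enorm (\row_i (x ord0 i + s * w i)).
Proof.
move=> w1; rewrite lerBlDr -[`|s|]normrN.
have := enorm_shift_le (\row_i (x ord0 i + s * w i)) (- s) w1.
by congr (enorm _ <= _); apply/rowP => i; rewrite !mxE mulNr addrK.
Qed.

(* The part of the slab outside the forward cone of {|x| < rho} and inside the
   backward cone of {|x| <= L}. *)
Definition truncated_cone (T rho L : R) : set Z :=
  [set z | inner (slab T) z /\
     rho + z ord0 tc <= enorm (rsubmx z) <= L - z ord0 tc].

Lemma rsubmx_space z i : rsubmx z ord0 i = z ord0 (sc i).
Proof. by rewrite mxE. Qed.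

Lemma event_rsubmx z : event (z ord0 tc) (rsubmx z) = z.
Proof.
apply/rowP; apply: coord_ind => [|i]; first by rewrite event_time.
by rewrite event_space rsubmx_space.
Qed.

Lemma rsubmx_event (t : R) x : rsubmx (event t x) = x.
Proof. by rewrite /event row_mxKr. Qed.

Lemma rsubmx_ray p z : rsubmx (ray p z) =
  \row_i (rsubmx z ord0 i + z ord0 tc * (1 - frac p) * omega p.2 i).
Proof. by apply/rowP => i; rewrite rsubmx_space ray_space !mxE. Qed.

(** The vertex is moved down by delta, a ray is taken and moved back up: the result is a ray from z
    that ends at time delta. Along it |x| changes by at most the lost time, which is the slope of
    both walls; the last hypothesis keeps the time positive. *)
Lemma truncated_cone_ray (T rho L delta : R) z p : truncated_cone T rho L z ->
  0 <= delta < z ord0 tc -> 0 < delta \/ 0 < frac p ->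
  truncated_cone T rho L (delta *: delta_mx 0 tc +
    ray p ((- delta) *: delta_mx 0 tc + z)).
Proof.
move=> [/= /andP[z0 zT] /andP[z1 z2]] /andP[d0 dz] dp.
set y := (- delta) *: delta_mx 0 tc + z.
have yt : y ord0 tc = z ord0 tc - delta by rewrite !mxE !eqxx/= mulr1 addrC.
have ys : rsubmx y = rsubmx z.
  by apply/rowP => i; rewrite !rsubmx_space !mxE eqxx/= mulr0 add0r.
set w := delta *: _ + _.
have wt : w ord0 tc = delta + frac p * (z ord0 tc - delta).
  by rewrite mxE ray_time yt !mxE !eqxx/= mulr1.
have ws : rsubmx w = \row_i (rsubmx z ord0 i +
    (z ord0 tc - delta) * (1 - frac p) * omega p.2 i).
  apply/rowP => i; rewrite rsubmx_space mxE ray_space -rsubmx_space ys yt.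
  by rewrite !mxE eqxx/= mulr0 add0r.
have f0 := frac_ge0 p; have f1 := frac_le1 p.
have s0 : 0 <= (z ord0 tc - delta) * (1 - frac p).
  by rewrite mulr_ge0 ?subr_ge0// ltW.
have e1 := enorm_shift_le (rsubmx z) ((z ord0 tc - delta) * (1 - frac p)) (omega_sum_le1 p.2).
have e2 := enorm_shift_ge (rsubmx z) ((z ord0 tc - delta) * (1 - frac p)) (omega_sum_le1 p.2).
rewrite -ws (ger0_norm s0) in e1 e2.
split; rewrite /= wt.
  have h : 0 <= frac p * (z ord0 tc - delta) by rewrite mulr_ge0// subr_ge0 ltW.
  have h' : frac p * (z ord0 tc - delta) <= z ord0 tc - delta.
    by rewrite -[leRHS]mul1r ler_wpM2r// subr_ge0 ltW.
  apply/andP; split; last by lra.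
  case: dp => [dp|fp]; first by lra.
  by rewrite ltr_wpDl// mulr_gt0// subr_gt0.
move: e1 e2 z1 z2; move: (enorm _) (enorm _) (z ord0 tc) (frac p) => *.
by apply/andP; split; nra.
Qed.

Lemma truncated_cone_vertical (T rho L s t : R) x :
  truncated_cone T rho L (event t x) -> 0 < s <= t -> truncated_cone T rho L (event s x).
Proof.
move=> [/=]; rewrite !event_time !rsubmx_event => /andP[t0 tT] /andP[h1 h2] /andP[s0 st].
by split; rewrite /= !event_time ?rsubmx_event; apply/andP; split; lra.
Qed.

Lemma is_derive_event_time (T : R) (u : Z -> R) x (s : R) : smooth (slab T) u ->
  0 < s < T -> is_derive s 1 (fun r => u (event r x)) (partial tc u (event s x)).
Proof.
move=> su sT; have e r : event r x = r *: delta_mx 0 tc + event 0 x.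
  apply/rowP; apply: coord_ind => [|i]; rewrite ?event_time ?event_space mxE.
    by rewrite event_time !mxE !eqxx/= mulr1 addr0.
  by rewrite event_space !mxE eqxx/= mulr0 add0r.
have := @is_derive_partial R _ (slab T) u tc (event 0 x) s (smooth_regular su).
rewrite -e => /(_ _); rewrite /= event_time => /(_ sT).
by apply: is_derive_ext => // r; rewrite -e.
Qed.

(** The derivative is known at positive times only and the trace is a limit from there, so the mean
    value theorem is used on [s, t] and s tends to 0. *)
Lemma trace_MVT (T : R) (u : Z -> R) (t B : R) x : 0 < T -> smooth (slab T) u ->
  0 < t < T -> (forall s, 0 < s <= t -> `|partial tc u (event s x)| <= B) ->
  `|u (event t x)| <= `|trace T u x| + t * B.
Proof.
move=> T0 su /andP[t0 tT] hB.
have B0 : 0 <= B by apply: le_trans (hB t _); rewrite ?normr_ge0// t0 lexx.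
suff h : `|u (event t x) - trace T u x| <= t * B.
  by rewrite -[u _](subrK (trace T u x)) addrC (le_trans (ler_normD _ _))// lerD2l.
have cl : (fun s => `|u (event t x) - u (event s x)|) @ (0 : R)^'+ -->
    `|u (event t x) - trace T u x|.
  apply: cvg_norm; apply: cvgB; first exact: cvg_cst.
  by apply: trace_cvg => //; exact: smooth_regular.
rewrite -(cvg_lim _ cl)//; apply: limr_le; first by apply/cvg_ex; eexists; exact: cl.
near=> s; have s0 : 0 < s by near: s; exact: nbhs_right_gt.
have st : s < t by near: s; exact: nbhs_right_lt.
have dd r : s <= r <= t -> is_derive r 1 (fun r => u (event r x)) (partial tc u (event r x)).
  move=> /andP[sr rt]; apply: (is_derive_event_time _ su).
  by rewrite (lt_le_trans s0)// (le_lt_trans rt).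
have [r||c] := @MVT_segment R (fun r => u (event r x)) (fun r => partial tc u (event r x))
  s t (ltW st).
- by rewrite in_itv/= => /andP[sr rt]; apply: dd; rewrite !ltW.
- apply: derivable_within_continuous => r; rewrite in_itv/= => srt.
  by have [] := dd r srt.
rewrite in_itv/= => /andP[sc_ ct] ->; rewrite normrM mulrC ler_pM//.
  by rewrite gtr0_norm ?subr_gt0// gerBl ltW.
by apply: hB; rewrite (lt_le_trans s0).
Unshelve. all: by end_near. Qed.

Lemma enorm_continuous : continuous (@enorm R d).
Proof.
have cs : continuous (fun x : 'rV[R]_d => \sum_(i < d) x ord0 i ^+ 2).
  by apply: cont_sum => i; apply: contX; exact: coord_continuous.
exact: cont_comp cs (@sqrt_continuous R).
Qed.

End Cones.

(** * Translations *)

Section Translation.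
Context {R : realType} {n : nat}.
Implicit Types (Y : region R n) (u : 'rV[R]_n -> R) (c : 'rV[R]_n).

Lemma is_derive_translate_dir u c x v l : is_derive (c + x) v u l ->
  is_derive x v (fun y => u (c + y)) l.
Proof.
have e : (fun k : R => k^-1 *: ((u \o shift (c + x)) (k *: v) - u (c + x))) =
    (fun k : R => k^-1 *: (((fun y => u (c + y)) \o shift x) (k *: v) - u (c + x))).
  by apply/funext => k /=; rewrite addrCA.
move=> [du eu]; apply: DeriveDef; first by move: du; rewrite /derivable e.
by move: eu; rewrite /derive e.
Qed.

(** On a region without closure extendability is mere continuity, which u has at interior points of
    Y; no boundary values need to be translated. *)
Lemma regular_translate Y Y' u c : with_closure Y' = false ->
  (forall y, inner Y' y -> inner Y (c + y)) -> regular Y u ->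
  regular Y' (fun y => u (c + y)).
Proof.
move=> Yf Yc ru; split=> [i x Xx|].
  have [] // := @is_derive_translate_dir u c x (delta_mx 0 i) ('D_(delta_mx 0 i) u (c + x)) _.
  by apply: derivableP; have [+ _] := ru; apply; exact: Yc.
exists (fun y => u (c + y)); split=> //; apply/subspace_continuousP => x.
rewrite /carrier Yf => Yx; apply: cvg_within_filter.
apply: (@cvg_comp _ _ _ (fun y => c + y) u _ (nbhs (c + x))).
  by apply: cvgD; [exact: cvg_cst|exact: cvg_id].
exact: (regular_continuous ru (Yc x Yx)).
Qed.

Lemma partial_translate Y i u c x : regular Y u -> inner Y (c + x) ->
  partial i (fun y => u (c + y)) x = partial i u (c + x).
Proof.
move=> [du _] Yx; have [] // := @is_derive_translate_dir u c x (delta_mx 0 i) (partial i u (c + x)) _.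
by rewrite partialE; apply: derivableP; exact: du.
Qed.

Lemma smooth_translate Y Y' u c : with_closure Y' = false ->
  (forall y, inner Y' y -> inner Y (c + y)) -> smooth Y u ->
  smooth Y' (fun y => u (c + y)).
Proof.
move=> Yf Yc su; apply/smooth_uptoP => k; elim: k u su => [|k ih] u su.
  by case=> // _; exact: regular_translate Yf Yc (smooth_regular su).
apply/smooth_uptoS; split; first exact: regular_translate Yf Yc (smooth_regular su).
move=> i; apply: smooth_upto_congr (ih _ (smooth_partial i su)) => y Yy.
by rewrite (partial_translate _ (smooth_regular su) (Yc y Yy)).
Qed.

Lemma pderiv_translate Y Y' s u c x : 
  (forall y, inner Y' y -> inner Y (c + y)) -> smooth Y u -> inner Y' x ->
  pderiv s (fun y => u (c + y)) x = pderiv s u (c + x).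
Proof.
move=> Yc; elim: s u x => //= i s ih u x su Yx; rewrite -ih//; last exact: smooth_partial.
apply: (@pderiv_congr _ _ Y') => // y Yy.
by rewrite (partial_translate _ (smooth_regular su) (Yc y Yy)).
Qed.

End Translation.

Lemma bigO_on_finite (R : realType) (I : finType) (D : Type) (K : set D) (b : R) (u : I -> R -> D -> R) :
  (forall i, bigO_on K b (u i)) -> exists2 C : R, 0 <= C &
  \forall e \near 0^'+, forall i x, K x -> `|u i e x| <= C * e `^ b.
Proof.
move=> hu.
have /choice[C HC] : forall i, exists C : R, 0 <= C /\
    \forall e \near 0^'+, forall x, K x -> `|u i e x| <= C * e `^ b.
  by move=> i; have [C C0 HC] := bigO_on_pos (hu i); exists C.
exists (\sum_i C i); first by rewrite sumr_ge0// => i _; have [] := HC i.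
apply: (@filter_forall _ _ (fun i (e : R) => forall x, K x ->
  `|u i e x| <= (\sum_i C i) * e `^ b) (0^'+)) => i.
have [_] := HC i; apply: filterS => e He x Kx; apply: le_trans (He x Kx) _.
rewrite ler_wpM2r ?powR_ge0// (bigD1 i)//= lerDl sumr_ge0// => j _.
by have [] := HC j.
Qed.

(** * A priori bounds for all derivatives on a truncated cone *)

Section APriori.
Context {R : realType} {d : nat}.
Hypothesis d3 : (d <= 3)%N.
Local Notation P2 := (R * R)%type.
Local Notation P3 := (R * P2)%type.
Local Notation tc := (@time_coord d).
Local Notation sc := (@space_coord d).
Local Notation Z := 'rV[R]_(1 + d).
Implicit Types (z w y : Z) (p : P3) (q : P2) (x : 'rV[R]_d).

Lemma open_shifted_slab (T delta : R) : open [set z : Z | 0 < delta + z ord0 tc < T].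
Proof.
rewrite (_ : [set _ | _] = (fun z => delta + z ord0 tc) @^-1` `]0, T[%classic).
  have ct : continuous (fun z : Z => delta + z ord0 tc).
    exact: contD (@cont_cst _ _ delta) (@time_continuous R d).
  by apply: open_comp => [z _|]; [exact: ct|exact: interval_open].
by apply/seteqP; split=> z /=; rewrite in_itv.
Qed.

Definition shifted_slab (T delta : R) : region R (1 + d) :=
  Region (@open_shifted_slab T delta) false.

Lemma kirchhoff_cst_ge0 (t : R) : 0 <= @kirchhoff_cst R d t.
Proof.
have p0 : 0 <= pi :> R := pi_ge0 R.
have p2 : 0 <= pi *+ 2 :> R by rewrite mulrn_wge0.
have h : 0 <= 1 + `|t| * (1 + d%:R) :> R by rewrite addr_ge0// mulr_ge0// addr_ge0.
have tt := @tri_cst_ge0 R; have t2 := sqr_ge0 t.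
apply: mulr_ge0; first by rewrite invr_ge0 mulr_ge0.
apply: addr_ge0; last exact: mulr_ge0.
by apply: mulr_ge0 => //; exact: mulr_ge0.
Qed.

Lemma kirchhoff_cst_le (s t : R) : 0 <= s <= t ->
  @kirchhoff_cst R d s <= @kirchhoff_cst R d t.
Proof.
move=> /andP[s0 st]; have t0 := le_trans s0 st.
have p0 : 0 <= pi :> R := pi_ge0 R.
have p2 : 0 <= pi *+ 2 :> R by rewrite mulrn_wge0.
have tt := @tri_cst_ge0 R.
rewrite /kirchhoff_cst !ger0_norm//.
apply: ler_wpM2l; first by rewrite invr_ge0 mulr_ge0.
apply: lerD; apply: ler_wpM2l => //; last by rewrite ler_pXn2r ?nnegrE.
by apply: ler_wpM2l => //; rewrite lerD2l; exact: ler_wpM2r.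
Qed.

(** A ray down to time 0 would leave the open slab, where alone v is differentiated. After a
    translation by delta the cone of z has its base at time delta, and [kirchhoff_bound] applies to
    the translated function. *)
Lemma dal_bound (T rho L delta M : R) (v : Z -> R) z : 0 < T -> smooth (slab T) v ->
  truncated_cone T rho L z -> 0 < delta < z ord0 tc ->
  (forall y, truncated_cone T rho L y -> y ord0 tc = delta ->
    [/\ `|v y| <= M, `|partial tc v y| <= M &
      forall i, `|partial (sc i) v y| <= M]) ->
  (forall y, truncated_cone T rho L y -> `|dal v y| <= M) ->
  `|v z| <= @kirchhoff_cst R d T * M.
Proof.
move=> T0 sv Az /andP[de0 dez] hM hD; pose c : Z := delta *: delta_mx 0 tc.
have Yc y : inner (shifted_slab T delta) y -> inner (slab T) (c + y).
  by rewrite /= !mxE !eqxx/= mulr1.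
pose z' : Z := - delta *: delta_mx 0 tc + z.
have cz' : c + z' = z by rewrite /c /z' addrA -scalerDl subrr scale0r add0r.
have d0z : 0 <= delta < z ord0 tc by rewrite ltW.
have Ar p : truncated_cone T rho L (c + ray p z').
  by apply: (truncated_cone_ray d3 Az d0z); left.
have Yz p : inner (shifted_slab T delta) (ray p z').
  by have [/=] := Ar p; rewrite !mxE !eqxx/= mulr1.
have sv' := smooth_translate (Y' := shifted_slab T delta) erefl Yc sv.
have pd s p := @pderiv_translate _ _ (slab T) (shifted_slab T delta) s v c (ray p z') Yc sv (Yz p).
have pd1 i p : partial i (fun y => v (c + y)) (ray p z') = partial i v (c + ray p z').
  exact: (pd [:: i] p).
have pd2 i p : partial i (partial i (fun y => v (c + y))) (ray p z') =
    partial i (partial i v) (c + ray p z').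
  exact: (pd [:: i; i] p).
have tr q : (c + ray (0, q) z') ord0 tc = delta.
  by rewrite mxE ray_time frac_0 mul0r addr0 !mxE !eqxx mulr1.
have M0 : 0 <= M by apply: le_trans (hD z Az); exact: normr_ge0.
have := @kirchhoff_bound R d d3 (shifted_slab T delta) z' (fun y => v (c + y)) M Yz sv'.
rewrite cz' => h; apply: le_trans (h _ _ _ _) _.
- by move=> q; have [+ _ _] := hM _ (Ar (0, q)) (tr q).
- by move=> q; rewrite pd1; have [_ + _] := hM _ (Ar (0, q)) (tr q).
- by move=> i q; rewrite pd1; have [_ _ +] := hM _ (Ar (0, q)) (tr q); apply.
- move=> p; have el : lap (fun y => v (c + y)) (ray p z') = lap v (c + ray p z').
    by apply: eq_bigr => i _; exact: pd2.
  have -> : dal (fun y => v (c + y)) (ray p z') = dal v (c + ray p z').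
    exact: (congr2 (fun a b => a - b) (pd2 tc p) el).
  exact: hD.
have [/= /andP[_ zT] _] := Az.
rewrite ler_wpM2r// kirchhoff_cst_le// /z' !mxE !eqxx/= mulr1.
by apply/andP; split; lra.
Qed.

Lemma est_inner (Y : region R (1 + d)) (K : set Z) a k (u : R -> Z -> R) :
  K `<=` inner Y -> smooth_net Y u -> est Y K a k u <->
  forall s, (size s <= k)%N -> bigO_on K a (fun e => pderiv s (u e)).
Proof.
move=> KY su; split=> h s sk; apply: bigO_on_congr (h s sk) => e x e01 Kx.
  by rewrite pderivX_inner//; [exact: su|exact: KY].
by rewrite pderivX_inner//; [exact: su|exact: KY].
Qed.

Definition annulus (rho L : R) : set 'rV[R]_d := [set x | rho <= enorm x <= L].

Variables (T rho L : R).
Hypothesis T0 : 0 < T.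
Local Notation X := (@slab R d T).
Local Notation A := (truncated_cone T rho L).
Local Notation B := (annulus rho L).

Variables (w : R -> Z -> R) (a : R).
Hypothesis a0 : 0 <= a.
Hypothesis sw : smooth_net X w.
Hypothesis bw : forall s, bigO_on A 0 (fun e => pderiv s (w e)).
Hypothesis hF : forall s, bigO_on A a (fun e => pderiv s (dal (w e))).
Hypothesis hd0 : forall s : seq 'I_d,
  bigO_on B a (fun e => trace T (pderiv (map sc s) (w e))).
Hypothesis hd1 : forall s : seq 'I_d,
  bigO_on B a (fun e => trace T (pderiv (map sc s) (partial tc (w e)))).

Lemma trace_congr (u v : Z -> R) : (forall y, inner X y -> u y = v y) ->
  trace T u = trace T v.
Proof. by move=> uv; apply/funext => x; rewrite /trace (extension_congr uv). Qed.

Lemma annulus_of_cone y : A y -> B (rsubmx y).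
Proof.
move=> [/= /andP[y0 _] /andP[h1 h2]]; rewrite /annulus/=.
by apply/andP; split; lra.
Qed.

Lemma trace_MVT_cone (u : Z -> R) (C Bd : R) y : smooth X u -> A y ->
  (forall x, B x -> `|trace T u x| <= C) ->
  (forall y, A y -> `|partial tc u y| <= Bd) ->
  `|u y| <= C + y ord0 tc * Bd.
Proof.
move=> su Ay hC hB; have [/= yT _] := Ay.
rewrite -{1}(event_rsubmx y); apply: le_trans (trace_MVT T0 su yT _) _.
  move=> s /andP[s0 sy]; apply: hB; apply: (@truncated_cone_vertical _ _ _ _ _ s (y ord0 tc)).
    by rewrite event_rsubmx.
  by rewrite s0.
by rewrite lerD2r hC//; exact: annulus_of_cone.
Qed.

(* Kirchhoff's formula from the time delta, with delta -> 0 for fixed e: the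
   boundedness of all derivatives brings the data at time delta to the trace. *)
Lemma spatial_bound (s : seq 'I_d) : bigO_on A a (fun e => pderiv (map sc s) (w e)).
Proof.
pose v e := pderiv (map sc s) (w e).
have sv e : 0 < e <= 1 -> smooth X (v e) by move=> e01; apply: smooth_pderiv; exact: sw.
have [C0 C00 HC0] := bigO_on_pos (hd0 s).
have [Ct Ct0 HCt] := bigO_on_pos (hd1 s).
have [Ci Ci0 HCi] := bigO_on_finite (fun i => hd0 (rcons s i)).
have [CD CD0 HCD] := bigO_on_pos (hF (map sc s)).
have [B1 B10 HB1] := bigO_on_pos (bw (rcons (map sc s) tc)).
have [B2 B20 HB2] := bigO_on_pos (bw (map sc s ++ [:: tc; tc])).
have [B3 B30 HB3] := bigO_on_finite (fun i => bw (map sc s ++ [:: sc i; tc])).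
exists (@kirchhoff_cst R d T * (C0 + Ct + Ci + CD)); near=> e => z Az.
have e01 : 0 < e <= 1 by near: e; exact: near0_itv.
have sve := sv e e01; have swe := sw e01.
pose M := (C0 + Ct + Ci + CD) * e `^ a; pose Bd := B1 + B2 + B3.
have ea0 : 0 <= e `^ a by exact: powR_ge0.
have M0 : 0 <= M by rewrite mulr_ge0// !addr_ge0.
have Bd0 : 0 <= Bd by rewrite !addr_ge0.
rewrite -mulrA -/M; set kT := kirchhoff_cst T.
have kT0 : 0 <= kT by exact: kirchhoff_cst_ge0.
have t0 : forall x, B x -> `|trace T (v e) x| <= M.
  move=> x Bx; apply: (@le_trans _ _ (C0 * e `^ a)); first by move: x Bx; near: e.
  by rewrite ler_wpM2r// -!addrA lerDl !addr_ge0.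
have t1 : forall x, B x -> `|trace T (partial tc (v e)) x| <= M.
  move=> x Bx; rewrite (@trace_congr _ (pderiv (map sc s) (partial tc (w e)))); last first.
    by move=> y Xy; rewrite (pderiv_partial _ _ swe Xy).
  apply: (@le_trans _ _ (Ct * e `^ a)); first by move: x Bx; near: e.
  by rewrite ler_wpM2r// addrAC -addrA -addrA (addrCA C0) lerDl !addr_ge0.
have t2 : forall i x, B x -> `|trace T (partial (sc i) (v e)) x| <= M.
  move=> i x Bx; rewrite (_ : partial (sc i) (v e) = pderiv (map sc (rcons s i)) (w e)).
    apply: (@le_trans _ _ (Ci * e `^ a)); first by move: i x Bx; near: e.
    by rewrite ler_wpM2r// addrAC lerDr !addr_ge0.
  by rewrite map_rcons -cats1 pderiv_cat.
have hD y : A y -> `|dal (v e) y| <= M.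
  move=> Ay; have Xy : inner X y by have [] := Ay.
  rewrite -(pderiv_dal _ swe Xy).
  apply: (@le_trans _ _ (CD * e `^ a)); first by move: (y) Ay; near: e.
  by rewrite ler_wpM2r// lerDr !addr_ge0.
have b1 y : A y -> `|partial tc (v e) y| <= Bd.
  move=> Ay; apply: (@le_trans _ _ B1); last by rewrite /Bd -addrA lerDl addr_ge0.
  have -> : partial tc (v e) = pderiv (rcons (map sc s) tc) (w e).
    by rewrite -cats1 pderiv_cat.
  by rewrite -[B1]mulr1 -(powRr0 e); move: (y) Ay; near: e.
have b2 y : A y -> `|partial tc (partial tc (v e)) y| <= Bd.
  move=> Ay; apply: (@le_trans _ _ B2); last by rewrite /Bd addrAC lerDr addr_ge0.
  have -> : partial tc (partial tc (v e)) = pderiv (map sc s ++ [:: tc; tc]) (w e).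
    by rewrite pderiv_cat.
  by rewrite -[B2]mulr1 -(powRr0 e); move: (y) Ay; near: e.
have b3 i y : A y -> `|partial tc (partial (sc i) (v e)) y| <= Bd.
  move=> Ay; apply: (@le_trans _ _ B3); last by rewrite /Bd lerDr addr_ge0.
  have -> : partial tc (partial (sc i) (v e)) = pderiv (map sc s ++ [:: sc i; tc]) (w e).
    by rewrite pderiv_cat.
  by rewrite -[B3]mulr1 -(powRr0 e); move: (i) (y) Ay; near: e.
have [/= /andP[z0 zT] _] := Az.
apply/ler_addgt0Pr => eta_ eta0.
(* Between time 0 and delta the data drift by at most delta Bd; multiplied by kT this stays below
   the tolerance [eta_]. The + 1 covers kT Bd = 0. *)
pose delta := Num.min (z ord0 tc / 2) (eta_ / (kT * Bd + 1)).
have kB : 0 < kT * Bd + 1 by rewrite ltr_wpDl// mulr_ge0.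
have de0 : 0 < delta by rewrite lt_min !divr_gt0.
have dez : delta < z ord0 tc.
  by rewrite (le_lt_trans (_ : _ <= z ord0 tc / 2)) ?ge_min ?lexx// ltr_pdivrMr// ltr_pMr// ltr1n.
have hde : 0 < delta < z ord0 tc by rewrite de0.
have hdB : 0 <= delta * Bd by rewrite mulr_ge0// ltW.
have := @dal_bound T rho L delta (M + delta * Bd) (v e) z T0 sve Az hde.
move=> /(_ _ _)/le_trans; apply.
- move=> y Ay yt; split.
  + by rewrite -yt; exact: (trace_MVT_cone sve Ay t0 b1).
  + by rewrite -yt; exact: (trace_MVT_cone (smooth_partial tc sve) Ay t1 b2).
  + by move=> i; rewrite -yt; exact: (trace_MVT_cone (smooth_partial (sc i) sve) Ay (t2 i) (b3 i)).
- by move=> y Ay; rewrite (le_trans (hD y Ay))// lerDl.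
rewrite mulrDr lerD2l -/kT mulrCA.
apply: (@le_trans _ _ (eta_ / (kT * Bd + 1) * (kT * Bd))).
  apply: ler_wpM2r; first exact: mulr_ge0.
  by rewrite /delta ge_min lexx orbT.
by rewrite mulrAC ler_pdivrMr// ler_wpM2l ?lerDl// ltW.
Unshelve. all: by end_near. Qed.

Lemma word_split (s : seq 'I_(1 + d)) :
  exists s0 : seq 'I_d, perm_eq s (nseq (count_mem tc s) tc ++ map sc s0).
Proof.
elim: s => [|j s [s0 ps]]; first by exists [::].
move: j; apply: coord_ind => [|i].
  by exists s0; rewrite /= ?eqxx perm_cons.
exists (i :: s0); rewrite /= ?add0n.
apply: (@perm_trans _ (sc i :: (nseq (count_mem tc s) tc ++ map sc s0))).
  by rewrite perm_cons.
by have := perm_catCA [:: sc i] (nseq (count_mem tc s) tc) (map sc s0) => /permPl.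
Qed.

(* Two time derivatives are traded for two space derivatives by the equation. *)
Lemma word_bound (s : seq 'I_(1 + d)) : bigO_on A a (fun e => pderiv s (w e)).
Proof.
have [m] := ubnP (count_mem tc s); elim: m s => // m ih s.
have [s0 ps] := word_split s; move: ps.
case: (count_mem tc s) => [|[|k]] /= ps sm.
- apply: (bigO_on_congr _ (spatial_bound s0)) => e y e01 Ay.
  by apply/esym; apply: (pderiv_perm ps (sw e01)); have [] := Ay.
(* A single time derivative cannot be traded. It is controlled by its trace and by its own time
   derivative, which is the d'Alembertian plus the Laplacian of a spatial derivative, both already
   bounded. *)
- have [Ct Ct0 HCt] := bigO_on_pos (hd1 s0).
  have [CD CD0 HCD] := bigO_on_pos (hF (map sc s0)).
  have [Ci Ci0 HCi] := bigO_on_finite (fun i => spatial_bound (s0 ++ [:: i; i])).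
  exists (Ct + T * (CD + d%:R * Ci)); near=> e => y Ay.
  have e01 : 0 < e <= 1 by near: e; exact: near0_itv.
  have swe := sw e01; have Xy : inner X y by have [] := Ay.
  have [/= /andP[y0 yT] _] := Ay.
  rewrite (pderiv_perm ps swe Xy)/= (pderiv_partial _ _ swe Xy) mulrDl -mulrA mulrDl -mulrA.
  have ea0 : 0 <= e `^ a by exact: powR_ge0.
  apply: (@le_trans _ _ (Ct * e `^ a + y ord0 tc * (CD * e `^ a + d%:R * (Ci * e `^ a)))).
    apply: trace_MVT_cone => //.
    + by apply: smooth_partial; exact: smooth_pderiv.
    + move=> x Bx; rewrite (@trace_congr _ (pderiv (map sc s0) (partial tc (w e)))); last first.
        by move=> y' Xy'; rewrite (pderiv_partial _ _ swe Xy').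
      by move: x Bx; near: e.
    move=> y' Ay'; have Xy' : inner X y' by have [] := Ay'.
    have -> : partial tc (partial tc (pderiv (map sc s0) (w e))) y' =
        dal (pderiv (map sc s0) (w e)) y' + lap (pderiv (map sc s0) (w e)) y'.
      by rewrite /dal subrK.
    rewrite -(pderiv_dal _ swe Xy') (le_trans (ler_normD _ _))// lerD//.
      by move: (y') Ay'; near: e.
    rewrite /lap (le_trans (ler_norm_sum _ _ _))//.
    apply: (@le_trans _ _ (\sum_(i < d) Ci * e `^ a)); last first.
      by rewrite sumr_const card_ord mulr_natl.
    apply: ler_sum => i _.
    have -> : partial (sc i) (partial (sc i) (pderiv (map sc s0) (w e))) =
        pderiv (map sc (s0 ++ [:: i; i])) (w e) by rewrite map_cat pderiv_cat.
    by move: (i) (y') Ay'; near: e.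
  by rewrite lerD2l ler_wpM2r ?addr_ge0 ?mulr_ge0// ltW.
pose s' := nseq k tc ++ map sc s0.
have ck : count_mem tc s' = k.
  rewrite /s' count_cat count_nseq /= ?eqxx mul1n (_ : count _ _ = 0)%N ?addn0//.
  by rewrite count_map; apply/eqP; rewrite -leqn0 leqNgt -has_count; apply/hasPn => i _.
have km i : (count_mem tc (sc i :: sc i :: s') < m)%N.
  by rewrite /= ck; move: sm; rewrite ltnS; exact: ltnW.
have hl : bigO_on A a (fun e y => \sum_(i < d) pderiv (sc i :: sc i :: s') (w e) y).
  have [C C0 HC] := bigO_on_finite (fun i : 'I_d => ih (sc i :: sc i :: s') (km i)).
  exists (d%:R * C); near=> e => y Ay.
  rewrite (le_trans (ler_norm_sum _ _ _))// -mulrA.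
  apply: (@le_trans _ _ (\sum_(i < d) C * e `^ a)); last first.
    by rewrite sumr_const card_ord mulr_natl.
  by apply: ler_sum => i _; move: (i) (y) Ay; near: e.
apply: bigO_on_congr (bigO_onD (hF s') hl) => e y e01 Ay.
have swe := sw e01; have Xy : inner X y by have [] := Ay.
rewrite (pderiv_perm ps swe Xy)/= -/s'.
have sp i : smooth X (pderiv [:: sc i; sc i] (w e)) by exact: smooth_pderiv.
have -> : \sum_(i < d) pderiv s' (partial (sc i) (partial (sc i) (w e))) y =
    pderiv s' (lap (w e)) y.
  symmetry; exact: (@pderiv_sum _ _ X _ (index_enum _) (fun i : 'I_d => pderiv [:: sc i; sc i] (w e)) s' y sp Xy).
rewrite -(pderivD s' (smooth_dal swe) (smooth_lap swe) Xy).
by apply: (pderiv_congr _ _ Xy) => y' Xy'; rewrite /dal subrK.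
Unshelve. all: by end_near. Qed.

End APriori.

(** * The gain of a power of e *)

Section Bootstrap.
Context {R : realType} {d : nat}.
Hypothesis d3 : (d <= 3)%N.
Local Notation tc := (@time_coord d).
Local Notation sc := (@space_coord d).
Local Notation Z := 'rV[R]_(1 + d).
Implicit Types (z w y : Z) (a : R) (k m : nat).

Lemma est_num (Y : region R (1 + d)) (K : set Z) b k (c : R -> R) :
  K `<=` inner Y -> bigO b c -> est Y K b k (fun e _ => c e).
Proof.
move=> KY [C HC]; apply/est_inner => //; first by move=> e _; exact: smooth_cst.
case=> [|i s] sk; first by exists C; apply: filterS HC.
by apply: (bigO_on_congr _ (bigO_on0 K b)) => e x _ _; rewrite (@pderiv_cst _ _ (i :: s)).
Qed.

Lemma estB (Y : region R (1 + d)) (K : set Z) a k (u v : R -> Z -> R) :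
  K `<=` carrier Y -> smooth_net Y u -> smooth_net Y v ->
  est Y K a k u -> est Y K a k v -> est Y K a k (fun e z => u e z - v e z).
Proof. by move=> KY su sv hu hv s sk; apply: bigO_pderivXB => //; [exact: hu|exact: hv]. Qed.

Lemma est_ge (Y : region R (1 + d)) (K : set Z) a a' k (u : R -> Z -> R) :
  a' <= a -> est Y K a k u -> est Y K a' k u.
Proof. by move=> aa hu s sk; apply: bigO_on_le aa _; exact: hu. Qed.

Variables (T rho L : R).
Hypothesis T0 : 0 < T.
Local Notation X := (@slab R d T).
Local Notation A := (truncated_cone T rho L).
Local Notation B := (annulus rho L).
Variables (f : smooth_fun R) (c : R -> R) (b : R) (u v : R -> Z -> R).
Hypotheses (b0 : 0 < b) (hc : bigO b c).
Hypotheses (su : smooth_net X u) (sv : smooth_net X v).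
Hypotheses (bu : forall k, est X A 0 k u) (bv : forall k, est X A 0 k v).

Definition defect (u : R -> Z -> R) e z : R := dal (u e) z - c e * f (u e z).

Hypotheses (ru : forall a k, 0 <= a -> est X A a k (defect u))
           (rv : forall a k, 0 <= a -> est X A a k (defect v)).

Let w e z : R := u e z - v e z.

Hypothesis hd0 : forall s a, 0 <= a ->
  bigO_on B a (fun e => trace T (pderiv (map sc s) (w e))).
Hypothesis hd1 : forall s a, 0 <= a ->
  bigO_on B a (fun e => trace T (pderiv (map sc s) (partial tc (w e)))).

Let AI : A `<=` inner X. Proof. by move=> z []. Qed.
Let AX : A `<=` carrier X. Proof. by move=> z /AI; exact: inner_carrier. Qed.
Let sw : smooth_net X w. Proof. exact: smooth_netB. Qed.

Let sfc (u' : R -> Z -> R) : smooth_net X u' -> smooth_net X (fun e z => f (u' e z)).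
Proof. exact: smooth_net_comp. Qed.

Let sres (u' : R -> Z -> R) : smooth_net X u' -> smooth_net X (defect u').
Proof.
move=> su' e e01; apply: smoothB; first exact: smooth_dal (su' e e01).
by apply: smoothZ; exact: (sfc su' e01).
Qed.

(** The d'Alembertian of u - v is a difference of defects, which is negligible, plus c (f(u) -
    f(v)). The factor c supplies e^b, and f(u) - f(v) inherits e^a from u - v because both nets are
    bounded with all their derivatives. *)
Let est_step a k : 0 <= a -> (forall k, est X A a k w) ->
  est X A (b + a) k (fun e => dal (w e)).
Proof.
move=> a0 hw; have ba0 : 0 <= b + a by rewrite addr_ge0// ltW.
apply: (@est_congr _ _ _ _ _ _ (fun e z =>
  (defect u e z - defect v e z) + c e * (f (u e z) - f (v e z)))).
  move=> e e01 z Xz; rewrite (dalB (su e01) (sv e01) Xz) /defect.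
  by move: (dal _ _) (dal _ _) => *; ring.
have scf : smooth_net X (fun e z => f (u e z) - f (v e z)).
  exact: (smooth_netB (sfc su) (sfc sv)).
apply: estD => //.
- exact: (smooth_netB (sres su) (sres sv)).
- by apply: smooth_netM => // e _; exact: smooth_cst.
- exact: (estB AX (sres su) (sres sv) (ru ba0) (rv ba0)).
- apply: (estM AX _ scf (est_num AI hc)).
    by move=> e _; exact: smooth_cst.
  by apply: est_compB => //; exact: hw.
Qed.

(* The right-hand side gains a factor e^b over u - v, and this gain passes to
   u - v by [word_bound]. *)
Lemma bootstrap a k : 0 <= a -> est X A a k w.
Proof.
have step m : forall k, est X A (b *+ m) k w.
  elim: m => [|m ih] k'; first by rewrite mulr0n; exact: estB.
  have bm0 : 0 <= b *+ m by rewrite mulrn_wge0// ltW.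
  have bm1 : 0 <= b *+ m.+1 by rewrite mulrn_wge0// ltW.
  apply/(est_inner _ _ AI sw) => s _; apply: (word_bound d3 T0 sw) => //.
  - move=> s'; apply: (iffLR (est_inner 0 (size s') AI sw)) => //.
    exact: estB.
  - move=> s'; apply: (iffLR (est_inner _ (size s') AI _)) => //.
      by move=> e e01; apply: smooth_dal; exact: sw.
    by rewrite mulrS; exact: est_step.
  - by move=> s'; exact: hd0.
  - by move=> s'; exact: hd1.
move=> a0; apply: est_ge (step (Num.truncn (a / b)).+1 k).
rewrite -mulr_natr mulrC -ler_pdivrMr// ltW//.
exact: truncnS_gt.
Qed.

End Bootstrap.

(** * Approximate solutions by Picard iteration *)

Section Selection.
Context {R : realType}.
Implicit Types (e a b : R).

Lemma near_powR_le1 (C a : R) : 0 < a -> \forall e \near (0 : R)^'+, C * e `^ a <= 1.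
Proof.
move=> a0; have C1 : 0 < `|C| + 1 by rewrite ltr_wpDl.
have d0 : 0 < (`|C| + 1)^-1 `^ a^-1 by rewrite powR_gt0// invr_gt0.
near=> e; have e0 : 0 < e by near: e; exact: nbhs_right_gt.
have ed : e <= (`|C| + 1)^-1 `^ a^-1 by near: e; exact: nbhs_right_le.
have : e `^ a <= ((`|C| + 1)^-1 `^ a^-1) `^ a.
  by apply: ge0_ler_powR; rewrite ?nnegrE ?ltW.
rewrite -powRrM mulVf ?gt_eqF// powRr1 ?invr_ge0 ?(ltW C1)// => h.
apply: (@le_trans _ _ ((`|C| + 1) * e `^ a)).
  by rewrite ler_wpM2r ?powR_ge0// ler_wpDr// ler_norm.
by rewrite mulrC -ler_pdivlMr// mul1r.
Unshelve. all: by end_near. Qed.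

(** Giving up a positive power of e absorbs the constant. The diagonal choice below relies on this,
    since the constants depend on the iterate. *)
Lemma bigO_on_absorb (D : Type) (K : set D) (u : R -> D -> R) a b : b < a ->
  bigO_on K a u -> \forall e \near (0 : R)^'+, forall x, K x -> `|u e x| <= e `^ b.
Proof.
move=> ba [C HC]; have ab0 : 0 < a - b by rewrite subr_gt0.
have h := near_powR_le1 C ab0; near=> e => x Kx.
have e0 : 0 < e by near: e; exact: nbhs_right_gt.
apply: (@le_trans _ _ (C * e `^ a)); first by move: x Kx; near: e.
rewrite -[in leLHS](subrK b a) powRD; last by apply/implyP => _; rewrite gt_eqF.
rewrite mulrA -[leRHS]mul1r ler_wpM2r ?powR_ge0//.
by near: e.
Unshelve. all: by end_near. Qed.

(** M e is the largest admissible m below [top e]. The cutoff near 1 / e makes the maximum finite,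
    and still admits every fixed N once e is small. *)
Lemma diagonal_selection (P : nat -> R -> Prop) :
  (forall m, \forall e \near (0 : R)^'+, P m e) ->
  exists M : R -> nat, forall N, \forall e \near (0 : R)^'+, (N <= M e)%N /\ P (M e) e.
Proof.
move=> hP.
have /choice[de hde] : forall m, exists r : R, 0 < r /\ forall e, 0 < e < r -> P m e.
  move=> m; have [r /= r0 hr] := hP m; exists r; split=> // e /andP[e0 er].
  by apply: hr => //=; rewrite sub0r normrN gtr0_norm.
pose ok e (m : nat) := [forall j : 'I_m.+1, e < de j].
pose top e := (Num.truncn e^-1).+1.
exists (fun e => \max_(m < top e | ok e m) m)%N => N.
near=> e; have e0 : 0 < e by near: e; exact: nbhs_right_gt.
have okN : ok e N.
  apply/forallP; near: e.
  apply: (@filter_forall _ _ (fun (j : 'I_N.+1) e => is_true (e < de j)) (0^'+)) => j.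
  by apply: nbhs_right_lt; have [] := hde j.
have Ntop : (N < top e)%N.
  have eN : e <= N.+1%:R^-1 by near: e; apply: nbhs_right_le; rewrite invr_gt0.
  rewrite /top ltnS truncn_ge_nat ?invr_ge0 ?(ltW e0)//.
  apply: (@le_trans _ _ N.+1%:R); first by rewrite ler_nat.
  by rewrite -[leLHS]invrK lef_pV2 ?posrE ?invr_gt0.
split.
  exact: (@leq_bigmax_cond _ (fun m : 'I_(top e) => ok e m) (fun m => nat_of_ord m) (Ordinal Ntop) okN).
have : (0 < #|[pred m : 'I_(top e) | ok e m]|)%N by apply/card_gt0P; exists (Ordinal Ntop).
move=> /(@eq_bigmax_cond _ _ (fun m => nat_of_ord m))[m okm ->].
have [_] := hde m; apply; rewrite e0/=.
by move/forallP : okm => /(_ ord_max).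
Unshelve. all: by end_near. Qed.

End Selection.

(** * Data lifted to space-time, and backward cones *)

Section Lift.
Context {R : realType} {d : nat}.
Hypothesis d3 : (d <= 3)%N.
Local Notation tc := (@time_coord d).
Local Notation sc := (@space_coord d).
Local Notation Z := 'rV[R]_(1 + d).
Local Notation X := (@whole R (1 + d)).
Local Notation Xd := (@whole R d).
Implicit Types (z w y : Z) (a : R) (k m : nat) (g h : 'rV[R]_d -> R).

Definition lift g z : R := g (rsubmx z).

Lemma rsubmx_line (r : R) (j : 'I_(1 + d)) z :
  rsubmx (r *: delta_mx ord0 j + z) = r *: rsubmx (delta_mx ord0 j) + rsubmx z.
Proof. by apply/rowP => i; rewrite !mxE. Qed.

Lemma rsubmx_delta_time : rsubmx (delta_mx ord0 tc : Z) = 0.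
Proof. by apply/rowP => i; rewrite !mxE. Qed.

Lemma rsubmx_delta_space i : rsubmx (delta_mx ord0 (sc i) : Z) = delta_mx ord0 i.
Proof. by apply/rowP => j; rewrite rsubmx_space !mxE !eqxx/= sc_inj. Qed.

Lemma cont_rsubmx : continuous (fun z : Z => rsubmx z).
Proof.
apply: cont_rV => i; rewrite (_ : (fun _ => _) = (fun z : Z => z ord0 (sc i))).
  exact: coord_continuous.
by apply/funext => z; rewrite rsubmx_space.
Qed.

Lemma is_derive_lift_time g z : is_derive z (delta_mx ord0 tc) (lift g) 0.
Proof.
apply/is_derive_along0.
rewrite (_ : (fun _ => _) = (fun=> lift g z)); first exact: is_derive_cstf.
by apply/funext => r; rewrite /lift rsubmx_line rsubmx_delta_time scaler0 add0r.
Qed.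

Lemma is_derive_lift_space g z i : smooth Xd g ->
  is_derive z (delta_mx ord0 (sc i)) (lift g) (lift (partial i g) z).
Proof.
move=> sg; apply/is_derive_along0.
rewrite (_ : (fun _ => _) = (fun r => g (r *: delta_mx ord0 i + rsubmx z))).
  have := @is_derive_partial R d Xd g i (rsubmx z) 0 (smooth_regular sg) Logic.I.
  by rewrite scale0r add0r.
by apply/funext => r; rewrite /lift rsubmx_line rsubmx_delta_space.
Qed.

Lemma partial_lift_time g : partial tc (lift g) = fun=> 0.
Proof. by apply/funext => z; have [_ <-] := is_derive_lift_time g z. Qed.

Lemma partial_lift_space g i : smooth Xd g -> partial (sc i) (lift g) = lift (partial i g).
Proof. by move=> sg; apply/funext => z; have [_ <-] := is_derive_lift_space z i sg. Qed.

Lemma smooth_lift g : smooth Xd g -> smooth X (lift g).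
Proof.
have r0 (g' : 'rV[R]_d -> R) : smooth Xd g' -> regular X (lift g').
  move=> sg; split=> [i x _|].
    move: i; apply: coord_ind => [|i]; first by have [] := is_derive_lift_time g' x.
    by have [] := is_derive_lift_space x i sg.
  exists (lift g'); split=> //; apply: continuous_subspaceT.
  apply: cont_comp cont_rsubmx _ => x; exact: (smooth_continuous sg).
move=> sg; apply/smooth_uptoP => k; elim: k g sg => [|k ih] g sg.
  by case=> // _; exact: r0.
apply/smooth_uptoS; split; first exact: r0.
apply: coord_ind => [|i].
  by rewrite partial_lift_time; apply: (iffLR (smooth_uptoP _ _)); exact: smooth_cst.
by rewrite partial_lift_space//; apply: ih; exact: smooth_partial.
Qed.

Lemma est_lift (K : set Z) a k (g : R -> 'rV[R]_d -> R) : smooth_net Xd g ->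
  (forall s, bigO_on ((fun z : Z => rsubmx z) @` K) a (fun e => pderiv s (g e))) ->
  est X K a k (fun e => lift (g e)).
Proof.
have e0 (g' : R -> 'rV[R]_d -> R) : smooth_net Xd g' ->
    bigO_on ((fun z : Z => rsubmx z) @` K) a g' -> est X K a 0 (fun e => lift (g' e)).
  move=> sg [C HC]; apply/est0_inner => //; first by move=> e e01; apply: smooth_lift; exact: sg.
  by exists C; apply: filterS HC => e He z Kz; apply: He; exists z.
elim: k g => [|k ih] g sg hg; first exact: e0 sg (hg [::]).
apply/estS; split; first exact: e0 sg (hg [::]).
apply: coord_ind => [|i].
  apply: (@est_congr _ _ _ _ _ _ (fun _ => fun=> 0)).
    by move=> e _ x _; rewrite partial_lift_time.
  by move=> s _; exact: bigO_pderivX0.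
apply: (@est_congr _ _ _ _ _ _ (fun e => lift (partial i (g e)))).
  by move=> e e01 x _; rewrite (partial_lift_space i (sg e e01)).
apply: ih; first exact: smooth_net_partial.
by move=> s; exact: (hg (i :: s)).
Qed.

Lemma compact_annulus (rho L : R) : compact (@annulus R d rho L).
Proof.
have cl : closed (@annulus R d rho L).
  rewrite (_ : annulus _ _ = (@enorm R d) @^-1` `[rho, L]%classic).
    apply: preimage_closed; last exact: interval_closed.
    by move=> x _; exact: enorm_continuous.
  by apply/seteqP; split=> x /=; rewrite in_itv.
apply: (subclosed_compact cl (@rV_compact R d (fun _ => `[- L, L]%classic) _)).
  by move=> i; exact: segment_compact.
move=> x /andP[_ xL] i /=; rewrite in_itv/= -ler_norml.
exact: le_trans (coord_le_enorm x i) xL.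
Qed.

(* The part over [0, T] of the backward cone of {|x| <= L}. *)
Definition back_cone (T L : R) : set Z :=
  [set z : Z | 0 <= z ord0 tc <= T /\ enorm (rsubmx z) <= L - z ord0 tc].

(** Along a ray |x| grows by at most t (1 - s), which is exactly the drop in time. *)
Lemma ray_closed_back_cone (T L : R) : ray_closed (back_cone T L).
Proof.
move=> z p [/andP[z0 zT] zL].
have f0 := frac_ge0 p; have f1 := frac_le1 p.
have s0 : 0 <= z ord0 tc * (1 - frac p) by rewrite mulr_ge0 ?subr_ge0.
have e1 := enorm_shift_le (rsubmx z) (z ord0 tc * (1 - frac p)) (omega_sum_le1 d3 p.2).
rewrite -rsubmx_ray (ger0_norm s0) in e1.
rewrite /back_cone /= ray_time; split; last by apply: le_trans e1 _; nra.
apply/andP; split; first exact: mulr_ge0.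
by apply: le_trans zT; rewrite -[leRHS]mul1r ler_wpM2r.
Qed.

Lemma back_cone_time (T L : R) z : back_cone T L z -> `|z ord0 tc| <= T.
Proof. by move=> [/andP[z0 zT] _]; rewrite ger0_norm. Qed.

Lemma back_cone_space (T L : R) :
  (fun z : Z => rsubmx z) @` back_cone T L `<=` @annulus R d 0 L.
Proof.
move=> _ [z [/andP[z0 zT] zL] <-]; rewrite /annulus/= enorm_ge0/=.
by apply: le_trans zL _; rewrite gerBl.
Qed.

Lemma duhamelB F G : smooth X F -> smooth X G ->
  duhamel (fun z : Z => F z - G z) = (fun z => duhamel F z - duhamel G z).
Proof.
move=> sF sG; apply/funext => z; rewrite /duhamel -mulrBr; congr (_ * _).
have Xz p : inner X (ray p z) by [].
have cF := contM (@cont_wave_weight R) (cont_ray_fun Xz sF).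
have cG := contM (@cont_wave_weight R) (cont_ray_fun Xz sG).
rewrite /ray_mean -(triB cF cG); congr tri; apply/funext => p.
by rewrite mulrBr.
Qed.

End Lift.

(** * Picard iterates and the diagonal net *)

Section Picard.
Context {R : realType} {d : nat}.
Hypothesis d3 : (d <= 3)%N.
Local Notation tc := (@time_coord d).
Local Notation sc := (@space_coord d).
Local Notation Z := 'rV[R]_(1 + d).
Local Notation X := (@whole R (1 + d)).
Local Notation Xd := (@whole R d).
Implicit Types (z w y : Z) (a : R) (k m : nat).

Variables (g h : R -> 'rV[R]_d -> R) (f : smooth_fun R) (c : R -> R) (b T : R).
Hypotheses (sg : smooth_net Xd g) (sh : smooth_net Xd h) (b0 : 0 < b) (hc : bigO b c).
Hypotheses (bg : forall L s, bigO_on (@annulus R d 0 L) 0 (fun e => pderiv s (g e)))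
           (bh : forall L s, bigO_on (@annulus R d 0 L) 0 (fun e => pderiv s (h e))).

Definition linear_data e z : R := lift (g e) z + z ord0 tc * lift (h e) z.

(** [linear_data] has the right data but does not solve the equation; Duhamel's operator removes its
    d'Alembertian without touching the data. Existence thus needs no formula for the homogeneous
    problem. *)
Definition free_wave e z : R :=
  linear_data e z - duhamel (dal (linear_data e)) z.

Fixpoint picard n e : Z -> R :=
  if n is m.+1 then
    fun z => free_wave e z + duhamel (fun y => c e * f (picard m e y)) z
  else free_wave e.

Local Notation K L := (@back_cone R d T L).

Lemma smooth_linear_data : smooth_net X linear_data.
Proof.
move=> e e01; apply: smoothD; first exact: smooth_lift (sg e01).
by apply: smoothM; [exact: smooth_coord|exact: smooth_lift (sh e01)].
Qed.

Lemma smooth_free_wave : smooth_net X free_wave.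
Proof.
move=> e e01; have sl := smooth_linear_data e01; apply: smoothB => //.
by apply: smooth_duhamel; exact: smooth_dal.
Qed.

Let smooth_source (u : R -> Z -> R) : smooth_net X u ->
  smooth_net X (fun e y => c e * f (u e y)).
Proof. by move=> su e e01; apply: smoothZ; exact: smooth_comp (su e e01). Qed.

Lemma smooth_picard n : smooth_net X (picard n).
Proof.
elim: n => [|n ih]; first exact: smooth_free_wave.
move=> e e01; apply: smoothD; first exact: smooth_free_wave.
by apply: smooth_duhamel; exact: (smooth_source ih).
Qed.

Lemma dal_free_wave e z : 0 < e <= 1 -> dal (free_wave e) z = 0.
Proof.
move=> e01; have sl := smooth_linear_data e01.
have sd := smooth_dal sl.
rewrite (dalB sl (smooth_duhamel sd) (Logic.I : inner X z)).
by rewrite (dal_duhamel d3 _ sd) subrr.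
Qed.

Lemma dalD (Y : region R (1 + d)) (u v : Z -> R) z : smooth Y u -> smooth Y v ->
  inner Y z -> dal (fun y => u y + v y) z = dal u z + dal v z.
Proof.
move=> su sv Yz.
have pp i : partial i (partial i (fun y => u y + v y)) z =
    partial i (partial i u) z + partial i (partial i v) z.
  exact: (pderivD [:: i; i] su sv Yz).
have e : lap (fun y => u y + v y) z = lap u z + lap v z.
  by apply: etrans (big_split _ _ _ _ _); apply: eq_bigr => i _; exact: pp.
apply: (etrans (congr2 (fun a b => a - b) (pp tc) e)).
by rewrite opprD addrACA.
Qed.

Lemma dal_picardS n e z : 0 < e <= 1 ->
  dal (picard n.+1 e) z = c e * f (picard n e z).
Proof.
move=> e01; have sv := smooth_free_wave e01.
have ss := smooth_source (@smooth_picard n) e01.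
rewrite (dalD sv (smooth_duhamel ss) (Logic.I : inner X z)).
by rewrite dal_free_wave// add0r (dal_duhamel d3 _ ss).
Qed.

Lemma linear_data0 e z : z ord0 tc = 0 -> linear_data e z = g e (rsubmx z).
Proof. by move=> z0; rewrite /linear_data z0 mul0r addr0. Qed.

Lemma partial_linear_data0 e z : 0 < e <= 1 -> z ord0 tc = 0 ->
  partial tc (linear_data e) z = h e (rsubmx z).
Proof.
move=> e01 z0.
have := is_deriveDf (is_derive_lift_time (g e) z)
  (is_deriveMf (is_derive_time z) (is_derive_lift_time (h e) z)).
by move=> [_]; rewrite -partialE mulr0 addr0 mul1r add0r.
Qed.

Lemma free_wave0 e z : z ord0 tc = 0 -> free_wave e z = g e (rsubmx z).
Proof. by move=> z0; rewrite /free_wave linear_data0// duhamel0// subr0. Qed.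

Lemma partial_free_wave0 e z : 0 < e <= 1 -> z ord0 tc = 0 ->
  partial tc (free_wave e) z = h e (rsubmx z).
Proof.
move=> e01 z0; have sl := smooth_linear_data e01; have sd := smooth_dal sl.
have := pderivB [:: tc] sl (smooth_duhamel sd) (Logic.I : inner X z).
rewrite /= => ->.
by rewrite partial_linear_data0// partial_duhamel0// subr0.
Qed.

Lemma picard0 n e z : z ord0 tc = 0 -> picard n e z = g e (rsubmx z).
Proof.
by case: n => [|n] z0; rewrite /= free_wave0// duhamel0// addr0.
Qed.

Lemma partial_picard0 n e z : 0 < e <= 1 -> z ord0 tc = 0 ->
  partial tc (picard n e) z = h e (rsubmx z).
Proof.
move=> e01 z0; case: n => [|n]; first exact: partial_free_wave0.
have ss := smooth_source (@smooth_picard n) e01.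
have := pderivD [:: tc] (smooth_free_wave e01) (smooth_duhamel ss) (Logic.I : inner X z).
rewrite /= => ->.
by rewrite partial_free_wave0// (partial_duhamel0 ss z0) addr0.
Qed.

Let KX L : K L `<=` carrier X. Proof. by []. Qed.

Let KT L z : K L z -> `|z ord0 tc| <= T. Proof. exact: back_cone_time. Qed.

Let rK L := @ray_closed_back_cone R d d3 T L.

Let est_dal L a (u : R -> Z -> R) : smooth_net X u ->
  (forall k, est X (K L) a k u) -> forall k, est X (K L) a k (fun e => dal (u e)).
Proof.
move=> su hu k.
have spp i : smooth_net X (fun e => partial i (partial i (u e))).
  by move=> e e01; do 2 apply: smooth_partial; exact: su.
have hpp i k' : est X (K L) a k' (fun e => partial i (partial i (u e))).
  have /estS[_ /(_ i)] := hu k'.+2.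
  by move=> /estS[_ /(_ i)].
apply: (@estB _ _ X (K L) a k (fun e => partial tc (partial tc (u e))) (fun e => lap (u e))) => //.
  by move=> e e01; apply: smooth_lap; exact: su.
by apply: est_sum => // i; exact: spp.
Qed.

Lemma est_linear_data L k : est X (K L) 0 k linear_data.
Proof.
have sl (g' : R -> 'rV[R]_d -> R) : smooth_net Xd g' -> smooth_net X (fun e => lift (g' e)).
  by move=> sg' e e01; exact: smooth_lift (sg' e e01).
have st : smooth_net X (fun _ z => z ord0 tc) by move=> e _; exact: smooth_coord.
have hl (g' : R -> 'rV[R]_d -> R) : smooth_net Xd g' ->
    (forall L s, bigO_on (@annulus R d 0 L) 0 (fun e => pderiv s (g' e))) ->
    est X (K L) 0 k (fun e => lift (g' e)).
  move=> sg' bg'; apply: est_lift => // s; apply: bigO_on_sub (bg' L s).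
  exact: back_cone_space.
apply: estD => //; [exact: sl|exact: (smooth_netM st (sl _ sh))|exact: hl|].
rewrite -[0]addr0; apply: (estM _ st (sl _ sh)) => //; last exact: hl.
by apply: (est_time (M := T)) => z; exact: KT.
Qed.

Lemma est_free_wave L k : est X (K L) 0 k free_wave.
Proof.
have sd : smooth_net X (fun e => dal (linear_data e)).
  by move=> e e01; exact: smooth_dal (smooth_linear_data e01).
apply: estB => //.
- exact: smooth_linear_data.
- by move=> e e01; exact: smooth_duhamel (sd e e01).
- exact: est_linear_data.
apply: (est_duhamel (@rK L) (@KT L) sd).
by apply: est_dal; [exact: smooth_linear_data|move=> k'; exact: est_linear_data].
Qed.

Let est_scale L a k (u : R -> Z -> R) : smooth_net X u -> est X (K L) a k u ->
  est X (K L) (b + a) k (fun e y => c e * u e y).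
Proof.
move=> su hu; apply: (estM _ _ su (est_num _ hc)) => //.
by move=> e _; exact: smooth_cst.
Qed.

Let smooth_fcomp (u : R -> Z -> R) : smooth_net X u -> smooth_net X (fun e y => f (u e y)).
Proof. exact: smooth_net_comp. Qed.

Lemma est_picard n L k : est X (K L) 0 k (picard n).
Proof.
elim: n k => [|n ih] k; first exact: est_free_wave.
have ss := smooth_source (@smooth_picard n).
apply: (@estD _ _ X (K L) 0 k free_wave
  (fun e => duhamel (fun y => c e * f (picard n e y)))) => //.
- exact: smooth_free_wave.
- by move=> e e01; exact: smooth_duhamel (ss e e01).
- exact: est_free_wave.
apply: (est_duhamel (@rK L) (@KT L) ss).
apply: (@est_ge _ _ _ _ (b + 0)); first by rewrite addr0 ltW.
apply: est_scale; first exact: smooth_fcomp (@smooth_picard n).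
by apply: est_comp => //; exact: smooth_picard.
Qed.

Lemma est_picard_diff n L k :
  est X (K L) (b *+ n.+1) k (fun e z => picard n.+1 e z - picard n e z).
Proof.
elim: n k => [|n ih] k.
  have ss := smooth_source (@smooth_picard 0).
  apply: (@est_congr _ _ _ _ _ _ (fun e => duhamel (fun y => c e * f (picard 0 e y)))).
    by move=> e _ z _ /=; rewrite addrC addKr.
  apply: (est_duhamel (@rK L) (@KT L) ss).
  rewrite mulr1n -[b]addr0; apply: est_scale; first exact: smooth_fcomp (@smooth_picard 0).
  by apply: est_comp => //; [exact: smooth_picard|exact: est_picard].
have s1 := smooth_source (@smooth_picard n.+1); have s0 := smooth_source (@smooth_picard n).
apply: (@est_congr _ _ _ _ _ _ (fun e => duhamel (fun y =>
    c e * f (picard n.+1 e y) - c e * f (picard n e y)))).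
  move=> e e01 z _; rewrite (duhamelB (s1 e e01) (s0 e e01)).
  have alg (p q r : R) : q - r = (p + q) - (p + r) by ring.
  exact: (alg (free_wave e z)).
apply: (est_duhamel (@rK L) (@KT L) (smooth_netB s1 s0)).
have sp1 := @smooth_picard n.+1; have sp0 := @smooth_picard n.
apply: (@est_congr _ _ _ _ _ _ (fun e y => c e * (f (picard n.+1 e y) - f (picard n e y)))).
  by move=> e _ y _; rewrite mulrBr.
rewrite mulrS; apply: est_scale; first exact: (smooth_netB (smooth_fcomp sp1) (smooth_fcomp sp0)).
by apply: est_compB => //; exact: est_picard.
Qed.

(** The constants of [est_picard] depend on n and say nothing about a diagonal net. The positive
    power e^b does: for e small, depending on n, the distance to the one free wave is at most 1. *)
Lemma est_picard_free n L k : est X (K L) b k (fun e z => picard n e z - free_wave e z).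
Proof.
elim: n => [|n ih].
  apply: (@est_congr _ _ _ _ _ _ (fun _ => fun=> 0)).
    by move=> e _ z _ /=; rewrite subrr.
  by move=> s _; exact: bigO_pderivX0.
apply: (@est_congr _ _ _ _ _ _ (fun e z => (picard n.+1 e z - picard n e z) +
    (picard n e z - free_wave e z))).
  by move=> e _ z _; rewrite addrA subrK.
have sp1 := @smooth_picard n.+1; have sp0 := @smooth_picard n; have sf := smooth_free_wave.
apply: estD => //; [exact: (smooth_netB sp1 sp0)|exact: (smooth_netB sp0 sf)|].
apply: (est_ge _ (@est_picard_diff n L k)).
by rewrite mulrS lerDl mulrn_wge0// ltW.
Qed.

Lemma smooth_defect u : smooth_net X u -> smooth_net X (defect f c u).
Proof.
move=> su e e01; apply: smoothB; first exact: smooth_dal (su e e01).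
exact: (smooth_source su).
Qed.

(** The iterate n + 1 solves the equation with iterate n inside f, so its defect is c times a
    difference of f at consecutive iterates. The factor c adds one power to the n + 1 of
    [est_picard_diff]. *)
Lemma est_defect n L k : est X (K L) (b *+ n.+2) k (defect f c (picard n.+1)).
Proof.
have sp1 := @smooth_picard n.+1; have sp0 := @smooth_picard n.
apply: (@est_congr _ _ _ _ _ _ (fun e y => c e * (f (picard n e y) - f (picard n.+1 e y)))).
  by move=> e e01 z _; rewrite /defect (dal_picardS _ _ e01) mulrBr.
rewrite mulrS; apply: est_scale; first exact: (smooth_netB (smooth_fcomp sp0) (smooth_fcomp sp1)).
apply: est_compB => //; [exact: est_picard|exact: est_picard|].
apply: (@est_congr _ _ _ _ _ _ (fun e z => 0 - (picard n.+1 e z - picard n e z))).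
  by move=> e _ z _; rewrite sub0r opprB.
apply: estB => //.
- by move=> e _; exact: smooth_cst.
- exact: (smooth_netB sp1 sp0).
- by move=> s _; exact: bigO_pderivX0.
- exact: est_picard_diff.
Qed.

Lemma approximate_solution : exists u : R -> Z -> R,
  [/\ smooth_net X u,
      forall L k, est X (K L) 0 k u,
      forall L k a, 0 <= a -> est X (K L) a k (defect f c u) &
      forall e z, 0 < e <= 1 -> z ord0 tc = 0 ->
        u e z = g e (rsubmx z) /\ partial tc (u e) z = h e (rsubmx z)].
Proof.
(* Word length, size of the cone and power of e are all tied to m, so that one choice of m as a
   function of e serves every k, L and a. Words of length at most m are finitely many, hence P m
   holds for all small e. *)
pose P m e := forall (s : m.-bseq 'I_(1 + d)) z, K m%:R z ->
  `|pderiv s (fun y => picard m.+1 e y - free_wave e y) z| <= 1 /\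
  `|pderiv s (defect f c (picard m.+1) e) z| <= e `^ (b *+ m).
have sd m : smooth_net X (fun e y => picard m.+1 e y - free_wave e y).
  exact: (smooth_netB (@smooth_picard m.+1) smooth_free_wave).
have hP m : \forall e \near (0 : R)^'+, P m e.
  rewrite /P; apply: (@filter_forall _ _ (fun (s : m.-bseq 'I_(1 + d)) e =>
    forall z, K m%:R z ->
    `|pderiv s (fun y => picard m.+1 e y - free_wave e y) z| <= 1 /\
    `|pderiv s (defect f c (picard m.+1) e) z| <= e `^ (b *+ m)) (0^'+)) => s.
  have h1 : bigO_on (K m%:R) b (fun e => pderiv s (fun y => picard m.+1 e y - free_wave e y)).
    by apply: (iffLR (est_inner b m _ (sd m))) (size_bseq s) => //; exact: est_picard_free.
  have h2 : bigO_on (K m%:R) (b *+ m.+2) (fun e => pderiv s (defect f c (picard m.+1) e)).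
    apply: (iffLR (est_inner _ m _ (smooth_defect (@smooth_picard m.+1)))) (size_bseq s) => //.
    exact: est_defect.
  (* The defect is O(e^(b (m + 2))); the spare power absorbs the constant. *)
  have l2 : b *+ m < b *+ m.+2.
    by rewrite -[m.+2]addn2 mulrnDr ltrDl mulrn_wgt0.
  near=> e => z Kz; split.
    by rewrite -(powRr0 e); move: z Kz; near: e; exact: bigO_on_absorb h1.
  by move: z Kz; near: e; exact: bigO_on_absorb h2.
have [M HM] := diagonal_selection hP.
have KL L m : L <= m%:R -> K L `<=` K m%:R.
  by move=> Lm z [zT zL]; split=> //; apply: le_trans zL _; rewrite lerD2r.
have sM : smooth_net X (fun e => picard (M e).+1 e).
  by move=> e e01; exact: smooth_picard.
exists (fun e => picard (M e).+1 e); split=> //.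
- move=> L k; apply/(est_inner _ _ _ sM) => // s sk.
  have /bigO_on_pos[C C0 HC] : bigO_on (K L) 0 (fun e => pderiv s (free_wave e)).
    by apply: (iffLR (est_inner 0 k _ smooth_free_wave)) sk => //; exact: est_free_wave.
  exists (1 + C); have hM := HM (maxn k (Num.truncn L).+1); near=> e => z Kz.
  have e01 : 0 < e <= 1 by near: e; exact: near0_itv.
  have [kM PM] : (maxn k (Num.truncn L).+1 <= M e)%N /\ P (M e) e by near: e.
  have LM : L <= (M e)%:R.
    apply: (le_trans (ltW (truncnS_gt L))); rewrite ler_nat.
    exact: leq_trans (leq_maxr _ _) kM.
  have sMe : (size s <= M e)%N by exact: leq_trans sk (leq_trans (leq_maxl _ _) kM).
  have [h1 _] := PM (Bseq sMe) z (KL _ _ LM z Kz).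
  have h1' : `|pderiv s (picard (M e).+1 e) z - pderiv s (free_wave e) z| <= 1.
    have hB := pderivB s (@smooth_picard (M e).+1 e e01) (smooth_free_wave e01) (Logic.I : inner X z).
    by rewrite -hB; exact: h1.
  rewrite powRr0 mulr1 -[pderiv s _ z](subrK (pderiv s (free_wave e) z)).
  rewrite (le_trans (ler_normD _ _))// lerD//.
  by rewrite -[C]mulr1 -(powRr0 e); move: (z) Kz; near: e.
- move=> L k a a0; apply/(est_inner _ _ _ (smooth_defect sM)) => // s sk.
  set N := maxn (maxn k (Num.truncn L).+1) (Num.truncn (a / b)).+1.
  exists 1; have hM := HM N; near=> e => z Kz.
  have e01 : 0 < e <= 1 by near: e; exact: near0_itv.
  have [NM PM] : (N <= M e)%N /\ P (M e) e by near: e.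
  have kM := leq_trans (leq_maxl _ _) NM.
  have LM : L <= (M e)%:R.
    apply: (le_trans (ltW (truncnS_gt L))); rewrite ler_nat.
    exact: leq_trans (leq_maxr _ _) kM.
  have sMe : (size s <= M e)%N by exact: leq_trans sk (leq_trans (leq_maxl _ _) kM).
  have [_ h2] := PM (Bseq sMe) z (KL _ _ LM z Kz).
  rewrite mul1r; apply: le_trans h2 _.
  apply: ger_powR; first by [].
  rewrite -mulr_natr mulrC -ler_pdivrMr//.
  apply: (le_trans (ltW (truncnS_gt _))); rewrite ler_nat.
  exact: leq_trans (leq_maxr _ _) NM.
- by move=> e z e01 z0; rewrite picard0// partial_picard0.
Unshelve. all: by end_near. Qed.

End Picard.

(** * The Cauchy problem in the algebra *)

Section Restriction.
Context {R : realType} {n : nat}.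
Implicit Types (Y : region R n) (u : 'rV[R]_n -> R) (A B K : set 'rV[R]_n).
Local Notation W := (@whole R n).

Lemma restrict_extendable Y u s : smooth W u ->
  {within carrier Y, continuous (pderiv s u)}.
Proof.
move=> su; apply: continuous_subspaceT => x.
exact: (smooth_continuous (smooth_pderiv s su) (Logic.I : inner W x)).
Qed.

Lemma smooth_restrict Y u : smooth W u -> smooth Y u.
Proof.
move=> su s; split=> [i x _|]; first by have [+ _] := su s; apply.
by exists (pderiv s u); split=> //; exact: restrict_extendable.
Qed.

Lemma pderivX_restrict Y s u x : smooth W u -> carrier Y x ->
  pderivX Y s u x = pderiv s u x.
Proof.
by move=> su Yx; apply: extension_uniq => //; exact: restrict_extendable.
Qed.

Lemma est_restrict Y K a k (u : R -> 'rV[R]_n -> R) : K `<=` carrier Y ->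
  smooth_net W u -> est W K a k u -> est Y K a k u.
Proof.
move=> KY su hu s /hu; apply: bigO_on_congr => e x e01 Kx.
rewrite (pderivX_restrict s (su e e01) (Logic.I : carrier W x)).
by rewrite (pderivX_restrict s (su e e01) (KY x Kx)).
Qed.

(** At boundary points derivatives are limits of interior values, and a non-strict bound passes to
    the limit with the same constant. *)
Lemma est_closure Y A B a k (u : R -> 'rV[R]_n -> R) : smooth_net Y u ->
  (forall x, B x -> carrier Y x /\ \forall y \near x, inner Y y -> A y) ->
  est Y A a k u -> est Y B a k u.
Proof.
move=> su hB hu s sk; have [C HC] := hu s sk; exists C.
near=> e => x Bx; have e01 : 0 < e <= 1 by near: e; exact: near0_itv.
have [Yx nA] := hB x Bx; have sue := su e e01.
have ? := within_nbhs_proper (carrier_closure Yx).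
have cl : (fun y => `|pderiv s (u e) y|) @ within (inner Y) (nbhs x) -->
    `|pderivX Y s (u e) x|.
  by apply: cvg_norm; apply: extension_cvgP => //; have [] := sue s.
rewrite -(cvg_lim _ cl)//; apply: limr_le; first by apply/cvg_ex; eexists; exact: cl.
have hC : forall y, A y -> `|pderivX Y s (u e) y| <= C * e `^ a by near: e.
rewrite /prop_near1 /within /=; apply: filterS nA => y Ay Yy.
rewrite -(_ : pderivX Y s (u e) y = pderiv s (u e) y); first exact: hC (Ay Yy).
by apply: extension_inner => //; have [] := sue s.
Unshelve. all: by end_near. Qed.

Lemma bounded_moderate Y (u : R -> 'rV[R]_n -> R) : smooth_net Y u ->
  bounded_type Y u -> u \in moderate_net Y.
Proof.
move=> su bu; apply/asboolP; split=> // K s cK KY; exists 0; exact: bu.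
Qed.

Lemma Gclass_sum Y (I : Type) (r : seq I) (u : I -> mnet Y) :
  \sum_(i <- r) Gclass (u i) = Gclass (\sum_(i <- r) u i).
Proof.
elim: r => [|i r ih]; last by rewrite !big_cons ih GclassD.
by rewrite !big_nil -(subrr (0 : mnet Y)) -GclassB subrr.
Qed.

Lemma mnet_sumE Y (I : Type) (r : seq I) (u : I -> mnet Y) e x :
  (\sum_(i <- r) u i : mnet Y) e x = \sum_(i <- r) u i e x.
Proof.
elim: r => [|i r ih]; first by rewrite !big_nil.
by rewrite !big_cons -ih.
Qed.

End Restriction.

(** * From truncated cones to compact subsets of the slab *)

Section ConeTransfer.
Context {R : realType} {d : nat}.
Local Notation tc := (@time_coord d).
Local Notation sc := (@space_coord d).
Local Notation Z := 'rV[R]_(1 + d).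
Implicit Types (z w y : Z) (a : R) (k m : nat).

Variable T : R.
Hypothesis T0 : 0 < T.
Local Notation X := (@slab R d T).
Local Notation A rho L := (@truncated_cone R d T rho L).

(** Strict inequalities and no bound on the time make this set open, so that its trace on the closed
    slab is relatively open and includes points with t = 0 and t = T. *)
Definition open_cone (rho L : R) : set Z :=
  [set z : Z | rho + z ord0 tc < enorm (rsubmx z) < L - z ord0 tc].

Lemma enorm_rsubmx_continuous : continuous (fun z : Z => enorm (rsubmx z)).
Proof. exact: cont_comp (@cont_rsubmx R d) (@enorm_continuous R d). Qed.

Lemma open_open_cone rho L : open (open_cone rho L).
Proof.
have tcc := @coord_continuous R 1 (1 + d) ord0 tc.
have cst (r : R) : continuous (fun _ : Z => r) by exact: cont_cst.
have e1 := enorm_rsubmx_continuous.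
rewrite (_ : open_cone _ _ =
  ((fun z : Z => enorm (rsubmx z) - (rho + z ord0 tc)) @^-1` [set r : R | 0 < r]) `&`
  ((fun z : Z => L - z ord0 tc - enorm (rsubmx z)) @^-1` [set r : R | 0 < r])).
  apply: openI; apply: open_comp; try exact: open_gt.
    by move=> z _; exact: (contB e1 (contD (cst rho) tcc)).
  by move=> z _; exact: (contB (contB (cst L) tcc) e1).
by apply/seteqP; split=> z; rewrite /open_cone/= !subr_gt0; move/andP.
Qed.

Lemma est_open_cone rho L a k (u : R -> Z -> R) : smooth_net X u ->
  est X (A rho L) a k u -> est X (carrier X `&` open_cone rho L) a k u.
Proof.
move=> su; apply: est_closure => // z [Xz Oz]; split=> //.
have : open_nbhs z (open_cone rho L) by split=> //; exact: open_open_cone.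
move/open_nbhs_nbhs; apply: filterS => y /andP[y1 y2] Yy.
by split=> //; rewrite !ltW.
Qed.

Lemma compact_enorm_bound (K : set Z) : compact K ->
  exists L, forall z, K z -> enorm (rsubmx z) < L.
Proof.
move=> cK; have : compact ((fun z : Z => enorm (rsubmx z)) @` K).
  apply: continuous_compact => //; apply: continuous_subspaceT.
  exact: enorm_rsubmx_continuous.
move=> /compact_bounded[M [Mr hM]]; exists (M + 2) => z Kz.
have M1 : M < M + 1 by rewrite ltrDl.
have : `|enorm (rsubmx z)| <= M + 1 by apply: (hM _ M1); exists z.
by rewrite ger0_norm ?enorm_ge0// => h; apply: le_lt_trans h _; rewrite ltrD2l ltr1n.
Qed.

Lemma compact_sub_back_cone (K : set Z) : compact K -> K `<=` carrier X ->
  exists L, K `<=` back_cone T L.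
Proof.
move=> /compact_enorm_bound[L hL] KX; exists (L + T) => z Kz.
have := KX z Kz; rewrite carrier_slab// => /= /andP[z0 zT].
split; first by rewrite z0.
by have := hL z Kz; lra.
Qed.

(** For rho = - T - 1 the inner condition is void when t <= T, since rho + t is negative: only the
    backward cone remains. *)
Lemma compact_sub_open_cone (K : set Z) : compact K -> K `<=` carrier X ->
  exists L, K `<=` carrier X `&` open_cone (- T - 1) L.
Proof.
move=> /compact_enorm_bound[L hL] KX; exists (L + T) => z Kz.
split; first exact: KX.
have := KX z Kz; rewrite carrier_slab// => /= /andP[z0 zT].
have := hL z Kz; have := enorm_ge0 (rsubmx z) => *.
by apply/andP; split; lra.
Qed.

Lemma compact_cylinder (L : R) :
  compact [set z : Z | 0 <= z ord0 tc <= T /\ enorm (rsubmx z) <= L].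
Proof.
have cl : closed [set z : Z | 0 <= z ord0 tc <= T /\ enorm (rsubmx z) <= L].
  rewrite (_ : [set _ | _] = ((fun z : Z => z ord0 tc) @^-1` `[0, T]%classic) `&`
    ((fun z : Z => enorm (rsubmx z)) @^-1` `]-oo, L]%classic)).
    apply: closedI; apply: preimage_closed.
    - by move=> z _; exact: coord_continuous.
    - exact: interval_closed.
    - by move=> z _; exact: enorm_rsubmx_continuous.
    - exact: interval_closed.
  by apply/seteqP; split=> z /=; rewrite !in_itv/=.
apply: (subclosed_compact cl (@rV_compact R (1 + d)
  (fun _ => `[- (T + `|L|), T + `|L|]%classic) _)).
  by move=> i; exact: segment_compact.
move=> z [/andP[z0 zT] zL] i /=; rewrite in_itv/= -ler_norml.
move: i; apply: coord_ind => [|i].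
  by rewrite ger0_norm// ler_wpDr.
rewrite -rsubmx_space (le_trans (coord_le_enorm _ i))// (le_trans zL)//.
by rewrite (le_trans (ler_norm L))// lerDr ltW.
Qed.

(** A truncated cone lies over the open interval (0, T) and need not be compact; a closed cylinder
    in the slab contains it, and the hypothesis is used there. *)
Lemma bigO_truncated_cone rho L a s (u : R -> Z -> R) :
  (forall K, compact K -> K `<=` carrier X -> bigO_on K a (fun e => pderivX X s (u e))) ->
  bigO_on (A rho L) a (fun e => pderivX X s (u e)).
Proof.
move=> h; apply: bigO_on_sub (h _ (@compact_cylinder L) _).
  move=> z [/= /andP[z0 zT] /andP[_ zL]]; split; first by rewrite !ltW.
  by rewrite (le_trans zL)// gerBl ltW.
by move=> z [zT _]; rewrite carrier_slab.
Qed.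

End ConeTransfer.

(** * Existence, uniqueness and support of the generalized solution *)

Section Solutions.
Context {R : realType} {d : nat}.
Hypothesis d3 : (d <= 3)%N.
Local Notation tc := (@time_coord d).
Local Notation sc := (@space_coord d).
Local Notation Z := 'rV[R]_(1 + d).
Implicit Types (z w y : Z) (a : R) (k m : nat).

Variables (E : gnum R) (f : smooth_fun R) (T : R).
Hypothesis T0 : 0 < T.
Local Notation X := (@slab R d T).
Local Notation W := (@whole R d).
Local Notation c := (repr E).

(** This is the passage from the quotient to nets. Any bounded representative will do, because the
    class f(U) does not depend on it ([Gcomp_class]). *)
Lemma wave_equationP (U : colombeau0 X) (u : mnet X) :
  Gclass u = G0_val U -> bounded_type X u ->
  (Gdt (Gdt U) - Glaplacian U = Gscale E (Gcomp f U)) <->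
  negligible_on X (carrier X) (defect f c u).
Proof.
move=> uU bu; have su := mnet_smooth u.
pose v := MNet (bounded_moderate (smooth_net_comp f su) (bounded_comp f su bu)).
have -> : G0_val (Gcomp f U) = Gclass v by exact: (@Gcomp_class _ _ _ f U u v uU bu (fun _ _ => erefl)).
have -> : Gscale E (Gclass v) = Gclass (mnet_scale c v).
  have := Gscale_class c v; rewrite (_ : gnum_class c = E) => [//|].
  exact: reprK.
rewrite -uU /Gdt !Gpartial_class.
have -> : Glaplacian (Gclass u) =
    Gclass (\sum_(i < d) mnet_partial (sc i) (mnet_partial (sc i) u)).
  by rewrite -Gclass_sum; apply: eq_bigr => i _; rewrite !Gpartial_class.
rewrite GclassB.
have e : (fun e z => (mnet_partial tc (mnet_partial tc u) -
    \sum_(i < d) mnet_partial (sc i) (mnet_partial (sc i) u)) e z -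
    mnet_scale c v e z) = defect f c u.
  apply/funext => e; apply/funext => z.
  have -> : (mnet_partial tc (mnet_partial tc u) -
    \sum_(i < d) mnet_partial (sc i) (mnet_partial (sc i) u)) e z =
    mnet_partial tc (mnet_partial tc u) e z -
    (\sum_(i < d) mnet_partial (sc i) (mnet_partial (sc i) u)) e z by [].
  by rewrite mnet_sumE.
by rewrite -e; exact: GclassP.
Qed.

Lemma pderivX_traceB (p q : Z -> R) s x : smooth X p -> smooth X q ->
  pderivX W s (fun x => trace T p x - trace T q x) x =
  trace T (pderiv (map sc s) (fun z => p z - q z)) x.
Proof.
move=> sp sq; have Wx : carrier W x by [].
rewrite (pderivXB s (smooth_trace T0 sp) (smooth_trace T0 sq) Wx).
rewrite (pderivX_trace s x T0 sp) (pderivX_trace s x T0 sq).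
exact/esym/(pderivXB (map sc s) sp sq (@carrier_event _ _ T x T0)).
Qed.

Variable b : R.
Hypotheses (b0 : 0 < b) (hc : bigO b c).

Let estA (u : R -> Z -> R) a k rho L :
  (forall K s, compact K -> K `<=` carrier X -> bigO_on K a (fun e => pderivX X s (u e))) ->
  est X (truncated_cone T rho L) a k u.
Proof. by move=> h s _; apply: bigO_truncated_cone => // K; exact: h. Qed.

(** One statement serves twice: for negative rho the annulus is a full ball, which gives uniqueness,
    and for v = 0 with rho above r the data vanish on it, which gives the support. *)
Lemma comparison (rho L : R) (u v : R -> Z -> R) a k : 0 <= a ->
  smooth_net X u -> smooth_net X v -> bounded_type X u -> bounded_type X v ->
  negligible_on X (carrier X) (defect f c u) ->
  negligible_on X (carrier X) (defect f c v) ->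
  (forall s a, 0 <= a -> bigO_on (annulus rho L) a
    (fun e => pderivX W s (fun x => trace T (u e) x - trace T (v e) x))) ->
  (forall s a, 0 <= a -> bigO_on (annulus rho L) a
    (fun e => pderivX W s (fun x => trace T (partial tc (u e)) x -
                                    trace T (partial tc (v e)) x))) ->
  est X (carrier X `&` open_cone rho L) a k (fun e z => u e z - v e z).
Proof.
move=> a0 su sv bu bv ru rv h0 h1.
apply: est_open_cone; first exact: smooth_netB.
apply: (bootstrap d3 T0 b0 hc su sv _ _ _ _ _ _ a0).
- by move=> k'; apply: estA; exact: bu.
- by move=> k'; apply: estA; exact: bv.
- by move=> a' k' a'0; apply: estA => K s cK KX; exact: ru.
- by move=> a' k' a'0; apply: estA => K s cK KX; exact: rv.
- move=> s a' a'0; apply: bigO_on_congr (h0 s a' a'0) => e x e01 _.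
  exact: pderivX_traceB (su e e01) (sv e e01).
- move=> s a' a'0; apply: bigO_on_congr (h1 s a' a'0) => e x e01 _.
  rewrite (pderivX_traceB s x (smooth_partial tc (su e e01)) (smooth_partial tc (sv e e01))).
  congr (_ x); apply: trace_congr => y Xy; apply: pderiv_congr Xy => z Xz.
  exact/esym/(pderivB [:: tc] (su e e01) (sv e e01) Xz).
Qed.

Lemma trace_negligible (u v : mnet X) : Gtrace T0 (Gclass u) = Gtrace T0 (Gclass v) ->
  negligible_on W (carrier W) (fun e x => trace T (u e) x - trace T (v e) x).
Proof. by rewrite !Gtrace_class => /GclassP. Qed.

Lemma solution_unique (U V : colombeau0 X) :
  Gdt (Gdt U) - Glaplacian U = Gscale E (Gcomp f U) ->
  Gdt (Gdt V) - Glaplacian V = Gscale E (Gcomp f V) ->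
  Gtrace T0 U = Gtrace T0 V -> Gtrace T0 (Gdt U) = Gtrace T0 (Gdt V) -> U = V.
Proof.
move=> eU eV h0 h1; apply: val_inj => /=.
set u := repr (G0_val U); set v := repr (G0_val V).
have uU : Gclass u = U := Gclass_repr _; have vV : Gclass v = V := Gclass_repr _.
have bu := bounded_repr U; have bv := bounded_repr V.
have ru := iffLR (wave_equationP uU bu) eU.
have rv := iffLR (wave_equationP vV bv) eV.
rewrite -uU -vV in h0 h1 *; rewrite /Gdt !Gpartial_class in h1.
apply/GclassP => K s a cK KX a0.
have [L KL] := compact_sub_open_cone T0 cK KX.
have su := mnet_smooth u; have sv := mnet_smooth v.
apply: bigO_on_sub KL _.
apply: (comparison (k := size s) a0 su sv bu bv ru rv) => // s' a' a'0.
- exact: (trace_negligible h0 s' (@compact_annulus _ _ _ _) _ a'0).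
- exact: (trace_negligible h1 s' (@compact_annulus _ _ _ _) _ a'0).
Qed.

(** The strict inequality keeps the compact annulus off the support, where the estimates of
    vanishing on compact sets apply. *)
Lemma annulus_vanishing (V : colombeau W) (v : mnet W) (r rho L : R) s a :
  Gclass v = V -> supp V `<=` [set x | enorm x <= r] -> r < rho -> 0 <= a ->
  bigO_on (annulus rho L) a (fun e => pderivX W s (v e)).
Proof.
move=> vV sV rr a0; have [_] := vanishes_off_supp V.
rewrite -vV => /(vanishes_on_class _ _)h.
apply: h => //; first exact: compact_annulus.
move=> x /andP[xr _]; split=> //; rewrite vV => /sV /= xr'.
by have := lt_le_trans rr (le_trans xr xr'); rewrite ltxx.
Qed.

Hypothesis f0 : f 0 = 0.

(** As f(0) = 0, the zero net solves the equation; U is compared with it on a cone around a point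
    with |x| > t + r, whose base avoids the ball of radius r. *)
Lemma solution_supp (U : colombeau0 X) (r : R) :
  Gdt (Gdt U) - Glaplacian U = Gscale E (Gcomp f U) ->
  supp (Gtrace T0 U) `<=` [set x | enorm x <= r] ->
  supp (Gtrace T0 (Gdt U)) `<=` [set x | enorm x <= r] ->
  supp U `<=` cone T r.
Proof.
move=> eU h0 h1 z [Xz nz]; split=> //; rewrite leNgt; apply/negP => zr; apply: nz.
set u := repr (G0_val U); have uU : Gclass u = U := Gclass_repr _.
have bu := bounded_repr U; have ru := iffLR (wave_equationP uU bu) eU.
have su := mnet_smooth u.
rewrite -uU in h0 h1 *; rewrite /Gdt Gpartial_class in h1.
pose t := z ord0 tc; pose n := enorm (rsubmx z).
(* rho is the midpoint of r and n - t, hence above r and with z strictly inside the cone; any L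
   above n + t would do. *)
pose rho := (r + n - t) / 2; pose L := n + t + 1.
have rr : r < rho by rewrite /rho /t /n; lra.
exists (carrier X `&` open_cone rho L); last first.
  by split=> //; rewrite /open_cone/= /rho /L /t /n; apply/andP; split; lra.
split; first by exists (open_cone rho L) => //; exact: open_open_cone.
apply/vanishes_on_class; first by move=> y [].
move=> K s a cK KA a0; apply: bigO_on_sub KA _.
pose o : Z -> R := fun=> 0.
have s0 : smooth_net X (fun=> o) by move=> e _; exact: smooth_cst.
have po i : partial i o = o by exact: partial_cst.
have t0 : trace T o = fun=> 0.
  by apply/funext => x; rewrite /trace extension_cst//; exact: carrier_event.
have r0 e y : defect f c (fun=> o) e y = 0.
  rewrite /defect /dal /lap !po big1 => [|i _]; last by rewrite !po.
  by rewrite /o f0 mulr0 !subr0.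
have n0 : negligible_on X (carrier X) (defect f c (fun=> o)).
  move=> K' s' a' _ KX _; apply: bigO_on_congr (bigO_pderivX0 s' a' KX) => e x _ _.
  by congr (pderivX _ _ _ x); apply/funext => y; rewrite r0.
have b00 : bounded_type X (fun=> o).
  by move=> K' s' _ KX; exact: bigO_pderivX0.
have htr (v : mnet X) : supp (Gtrace T0 (Gclass v)) `<=` [set x | enorm x <= r] ->
    forall s a, 0 <= a -> bigO_on (annulus rho L) a
      (fun e => pderivX W s (fun x => trace T (v e) x - 0)).
  move=> hv s' a' a'0.
  have := @annulus_vanishing _ (mnet_trace T0 v) r rho L s' a' (esym (Gtrace_class T0 v)) hv rr a'0.
  apply: bigO_on_congr => e x _ _ /=; congr (pderivX _ _ _ x).
  by apply/funext => y; rewrite subr0.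
have := comparison (rho := rho) (L := L) (k := size s) a0 su s0 bu b00 ru n0.
move=> /(_ _ _ s (leqnn _)) h.
have : bigO_on (carrier X `&` open_cone rho L) a
    (fun e => pderivX X s (fun y => u e y - 0)).
  apply: h => s' a' a'0; first by rewrite /= t0; exact: htr.
  by rewrite /= po t0; exact: (htr _ h1).
apply: bigO_on_congr => e x _ _; congr (pderivX _ _ _ x).
by apply/funext => y; rewrite subr0.
Qed.

(** The net of [approximate_solution] is smooth on all of space-time and takes the data exactly for
    every e in (0, 1]; restricted to the slab, only its defect is negligible rather than zero. *)
Lemma solution_exists (U0 U1 : colombeau0 W) : exists U : colombeau0 X,
  [/\ Gdt (Gdt U) - Glaplacian U = Gscale E (Gcomp f U),
      Gtrace T0 U = U0 & Gtrace T0 (Gdt U) = U1].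
Proof.
set g := repr (G0_val U0); set h := repr (G0_val U1).
have gU : Gclass g = U0 := Gclass_repr _; have hU : Gclass h = U1 := Gclass_repr _.
have sg := mnet_smooth g; have sh := mnet_smooth h.
have bd (V : colombeau0 W) L s :
    bigO_on (@annulus R d 0 L) 0 (fun e => pderiv s (repr (G0_val V) e)).
  have := bounded_repr V s (@compact_annulus R d 0 L) (fun _ _ => Logic.I).
  apply: bigO_on_congr => e x e01 _.
  have sV := mnet_smooth (repr (G0_val V)) e01.
  by apply: extension_inner => //; have [] := sV s.
have [u [su bu ru tu]] := approximate_solution d3 f T sg sh b0 hc (bd U0) (bd U1).
have su' : smooth_net X u by move=> e e01; exact: smooth_restrict (su e e01).
have KX L : back_cone T L `<=` carrier X by move=> z [zT _]; rewrite carrier_slab.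
have cv a (v : R -> Z -> R) : smooth_net (@whole R (1 + d)) v ->
    (forall L k, est (@whole R (1 + d)) (back_cone T L) a k v) ->
    forall K s, compact K -> K `<=` carrier X -> bigO_on K a (fun e => pderivX X s (v e)).
  move=> sv hv K s cK KXX; have [L KL] := compact_sub_back_cone T0 cK KXX.
  apply: bigO_on_sub KL _.
  exact: (est_restrict (KX L) sv (hv L (size s)) (leqnn _)).
have bu' : bounded_type X u by exact: cv.
pose um := MNet (bounded_moderate su' bu').
have hU0 : Gclass um \in @bounded_class R (1 + d) X by apply/asboolP; exists um.
have ttr (v : Z -> R) x : smooth (@whole R (1 + d)) v -> trace T v x = v (event 0 x).
  by move=> sv; exact: (pderivX_restrict [::] sv (@carrier_event _ _ T x T0)).
have negligible0 (v : R -> 'rV[R]_d -> R) :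
    (forall e x, 0 < e <= 1 -> v e x = 0) -> negligible_on W (carrier W) v.
  move=> v0 K s a _ _ _; apply: bigO_on_congr (@bigO_pderivX0 _ _ W K s a (fun _ _ => Logic.I)).
  by move=> e x e01 _; congr (pderivX _ _ _ x); apply/funext => y; rewrite v0.
exists (Colombeau0 hU0); split.
- apply/(@wave_equationP (Colombeau0 hU0) um) => // K s a cK KXX a0.
  apply: (cv a _ (smooth_defect f c su)) => // L k; exact: ru.
- rewrite /= Gtrace_class -gU; apply/GclassP.
  apply: negligible0 => e x e01 /=; rewrite ttr; last exact: su.
  by have [-> _] := tu e _ e01 (event_time 0 x); rewrite rsubmx_event subrr.
- rewrite /= /Gdt Gpartial_class Gtrace_class -hU; apply/GclassP.
  apply: negligible0 => e x e01 /=; rewrite ttr; last exact: smooth_partial (su e e01).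
  by have [_ ->] := tu e _ e01 (event_time 0 x); rewrite rsubmx_event subrr.
Qed.

End Solutions.

Theorem theorem3p1 (R : realType) (d : nat) (hd : (1 <= d <= 3)%N)
  (E : gnum R) (hE : (0%:E < valuation E)%E)
  (f : smooth_fun R) (hf : f 0 = 0)
  (r : R) (hr : 0 <= r)
  (U0 U1 : colombeau0 (@whole R d))
  (cU0 : compact (supp U0)) (cU1 : compact (supp U1))
  (sU0 : supp U0 `<=` [set x | enorm x <= r])
  (sU1 : supp U1 `<=` [set x | enorm x <= r])
  (T : R) (hT : 0 < T) :
  exists! U : colombeau0 (@slab R d T),
    [/\ supp U `<=` cone T r,
        Gdt (Gdt U) - Glaplacian U = Gscale E (Gcomp f U),
        Gtrace hT U = U0 &
        Gtrace hT (Gdt U) = U1].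
Proof.
have /andP[_ d3] := hd.
have [_ [b hb <-]] := ereal_sup_gt hE; rewrite lte_fin => b0.
have [U [eU tU tU']] := solution_exists d3 f hT b0 hb U0 U1.
exists U; split=> [|V [_ eV tV tV']].
  split=> //.
  by apply: (solution_supp d3 b0 hb hf eU); rewrite ?tU ?tU'.
by apply: (solution_unique d3 b0 hb eU eV); rewrite ?tU ?tU' ?tV ?tV'.
Qed.
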